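(* Let $n$ and $k$ be integers with $2\le k\le n-1$, and let $\psi$ be a real-valued $C^{\infty}$-function defined in a neighborhood of $0\in\mathbb R^n$. Then there exist an open neighborhood $U$ of $0\in\mathbb R^n$ (contained in the domain of $\psi$) and a real-valued function $u\in C^{\infty}(U)$ such that $$\sigma_k(\kappa_1(x),\cdots,\kappa_n(x))=\psi(x)\quad\text{for all }x\in U,$$ where $\kappa_1(x),\cdots,\kappa_n(x)$ are the principal curvatures of the graph of $u$ at the point $(x,u(x))$.
   Context: For $\mu=(\mu_1,\cdots,\mu_n)\in\mathbb R^n$, $\sigma_k(\mu)=\sum_{i_1<\cdots<i_k}\mu_{i_1}\cdots\mu_{i_k}$ is the $k$-th elementary symmetric function. For a $C^2$-function $u$ on a domain in $\mathbb R^n$, the principal curvatures of the graph $\{(x,u(x))\}\subset\mathbb R^{n+1}$ at $(x,u(x))$ are the eigenvalues (counted with multiplicity) of the matrix $g^{-1}h$, where $g_{ij}=\delta_{ij}+\partial_iu\,\partial_ju$ and $h_{ij}=\partial_{ij}u/\sqrt{1+|\nabla u|^2}$, all evaluated at $x$. With this sign convention, the sum of the principal curvatures is $\frac{1}{\sqrt{1+|\nabla u|^2}}\left(\Delta u-\frac{\partial_iu\,\partial_ju\,\partial_{ij}u}{1+|\nabla u|^2}\right)$ (summation over repeated indices) and their product is $\det(\nabla^2u)(1+|\nabla u|^2)^{-\frac{n+2}{2}}$. *)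

(* Defs.v *)
From HB Require Import structures.
From mathcomp Require Import all_boot all_order all_algebra.
From mathcomp Require Import all_classical all_reals all_analysis.

Set Implicit Arguments.
Unset Strict Implicit.
Unset Printing Implicit Defensive.

Import Order.TTheory GRing.Theory Num.Theory.
Import numFieldNormedType.Exports.

Local Open Scope classical_set_scope.
Local Open Scope ring_scope.

(* Points of R^n are row vectors. Functions on an open set U are represented
   by total functions; at a point of U, all the notions below depend only on
   the values taken near that point. *)

Definition partial (R : realType) (n : nat) (i : 'I_n)
    (f : 'rV[R]_n -> R) : 'rV[R]_n -> R :=
  fun x => 'D_(delta_mx 0 i) f x.

Definition iter_partial (R : realType) (n : nat) (s : seq 'I_n)
    (f : 'rV[R]_n -> R) : 'rV[R]_n -> R :=
  foldr (@partial R n) f s.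

(* 'D_v f is a total operator, so the existence of each partial derivative has
   to be required in addition to its continuity. *)
Definition smooth_on (R : realType) (n : nat) (U : set 'rV[R]_n)
    (f : 'rV[R]_n -> R) : Prop :=
  forall s : seq 'I_n, forall x : 'rV[R]_n, U x ->
    {for x, continuous (iter_partial s f)} /\
    (forall i : 'I_n, derivable (iter_partial s f) x (delta_mx 0 i)).

Definition sigma (R : realType) (n k : nat) (mu : 'rV[R]_n) : R :=
  \sum_(A : {set 'I_n} | #|A| == k) \prod_(i in A) mu 0 i.

(* 1 + |grad u|^2 with the Euclidean norm; the library norm on 'rV[R]_n is the
   sup norm. *)
Definition area_sq (R : realType) (n : nat) (u : 'rV[R]_n -> R)
    (x : 'rV[R]_n) : R :=
  1 + \sum_(i < n) (partial i u x) ^+ 2.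

Definition first_form (R : realType) (n : nat) (u : 'rV[R]_n -> R)
    (x : 'rV[R]_n) : 'M[R]_n :=
  \matrix_(i, j) ((i == j)%:R + partial i u x * partial j u x).

Definition second_form (R : realType) (n : nat) (u : 'rV[R]_n -> R)
    (x : 'rV[R]_n) : 'M[R]_n :=
  \matrix_(i, j) (partial i (partial j u) x / Num.sqrt (area_sq u x)).

(* kappa lists the eigenvalues of A with multiplicity: it determines kappa up
   to a permutation of its entries. *)
Definition eigenvalues_with_mult (R : realType) (n : nat) (A : 'M[R]_n)
    (kappa : 'rV[R]_n) : Prop :=
  char_poly A = \prod_(i < n) ('X - (kappa 0 i)%:P).

Definition principal_curvatures (R : realType) (n : nat)
    (u : 'rV[R]_n -> R) (x : 'rV[R]_n) (kappa : 'rV[R]_n) : Prop :=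
  eigenvalues_with_mult (invmx (first_form u x) *m second_form u x) kappa.

(* Main.v *)
Require Import Defs.
From HB Require Import structures.
From mathcomp Require Import all_boot all_order all_algebra.
From mathcomp Require Import all_classical all_reals all_analysis.
From mathcomp Require Import complex zify ring lra.
Import Order.TTheory GRing.Theory Num.Theory.
Import numFieldNormedType.Exports.
Local Open Scope classical_set_scope.
Local Open Scope ring_scope.
Set Implicit Arguments.
Unset Strict Implicit.
Unset Printing Implicit Defensive.

(** The equation is solved on a torus after rescaling. Write F(A) for the k-th
elementary symmetric function of the spectrum of A and choose
lambda = (-a, t, ..., t) with F(diag lambda) = psi 0 and all partial derivatives
S_i = dF/dlambda_i > 0; this is possible for either sign of psi 0 because
2 <= k <= n - 1. With u = sum_i lambda_i x_i^2 / 2 + w and w small, the equation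
reads sum_i S_i d_ii w = (small data) + (terms of order two), so that the
unknown f = sum_i S_i d_ii w solves a fixed point equation: the operators
d_ij (sum_l S_l d_ll)^-1 are bounded Fourier multipliers, and functions with
absolutely summable Fourier coefficients form a Banach algebra. The square root
sqrt(1 + |grad u|^2) is kept as a second unknown, which makes every
nonlinearity polynomial.

The fixed point equation is discretised by collocation on the grid
(Z/(2M+1))^n, where all sums are finite and products are pointwise. The norms
|g| = sum_m |g^(m)| (1 + eta |m|)^q are submultiplicative, hence one
contraction argument applies to all of them; for every q there is eta such
that the data are still small, and therefore all derivatives of the discrete
solutions are bounded uniformly in M. A limit along an ultrafilter is then
smooth and solves the equation. *)

(** * Hartley transform on a discrete torus *)

(** Since [psi] may vanish or change sign, ellipticity is not taken from a positivity cone of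
    curvatures: it comes from the model matrix diag lambda, at which all S_i are positive whatever
    the value [psi 0]. For the rescaled data, only the sup norm is shown to become small with eps,
    while derivatives are bounded uniformly. Interpolation between the two gives smallness in the
    unweighted Wiener norm, and this fixes eps once and for all. A higher order q must not shrink
    eps again, so it is the weight that adapts: as eta tends to 0 the weighted norm of the data
    approaches the unweighted one. The contraction radius depends only on the algebra rules, so the
    same iterates obey the bounds of every order. The grid of size M carries just the M-th iterate;
    its residual is O(2^-M) and disappears in the limit. Quadratic functions are not periodic, so in
    the gradient the coordinates are replaced by periodic functions that agree with them near 0, and
    the equation is recovered only there. The kernel cos + sin keeps all scalars real; its product
    formula costs a factor 2 in submultiplicativity. *)

Section Cas.
Variable R : realType.
Implicit Types t x y : R.

Definition cas t : R := cos t + sin t.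

Lemma cos_periodz x (z : int) : cos (x + 2 * pi * z%:~R) = cos x.
Proof.
have P := periodicn (@cosD2pi R).
case: z => [m|m].
  by rewrite -[RHS](P m); congr cos; rewrite -mulr_natr -pmulrn; ring.
rewrite NegzE -[LHS](P m.+1); congr cos.
by rewrite mulrNz -mulr_natr -pmulrn; ring.
Qed.

Lemma sin_periodz x (z : int) : sin (x + 2 * pi * z%:~R) = sin x.
Proof. by rewrite -!cosBpihalf addrAC cos_periodz. Qed.

Lemma cas_periodz x (z : int) : cas (x + 2 * pi * z%:~R) = cas x.
Proof. by rewrite /cas cos_periodz sin_periodz. Qed.

Lemma cas0 : cas 0 = 1.
Proof. by rewrite /cas cos0 sin0 addr0. Qed.

Lemma cas_le2 t : `|cas t| <= 2.
Proof.
apply: le_trans (ler_normD _ _) _.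
by have := cos_max t; have := sin_max t; lra.
Qed.

Lemma casM x y : cas x * cas y = cos (x - y) + sin (x + y).
Proof. rewrite /cas cosB sinD; ring. Qed.

(* The product formula that makes absolutely convergent Hartley series an algebra *)
Lemma casM4 x y : cas x * cas y =
  2^-1 * (cas (x - y) + cas (y - x) + cas (x + y) - cas (- (x + y))).
Proof.
have -> : y - x = - (x - y) by rewrite opprB.
by rewrite casM /cas !cosN !sinN; field.
Qed.

End Cas.

Section Grid.
Variables (R : realType) (n M : nat).
Local Notation N := (M.*2.+1).
Local Notation h := (2 * pi / N%:R : R).

Definition grid : finType := {ffun 'I_n -> 'I_N}.

(** Points and frequencies share one index set, centred in [-M, M]. The odd side N = 2 M + 1 makes
    it symmetric under x -> -x. *)
Definition cen (x : grid) (i : 'I_n) : int := (x i : nat)%:Z - M%:Z.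

Definition dot (k l : 'I_n -> int) : int := \sum_i k i * l i.

Definition phase (k : 'I_n -> int) (x : grid) : R := h * (dot k (cen x))%:~R.

Definition ch (k : 'I_n -> int) (x : grid) : R := cas (phase k x).

Definition coef (g : grid -> R) (m : grid) : R :=
  (#|grid|%:R)^-1 * \sum_x g x * ch (cen m) x.

Lemma natN_neq0 : (N%:R : R) != 0. Proof. by rewrite pnatr_eq0. Qed.

Definition gshift (i : 'I_n) (x : grid) : grid :=
  [ffun j => if j == i then ordS (x j) else x j].

Lemma gshift_inj i : injective (gshift i).
Proof.
move=> x y /ffunP E; apply/ffunP => j; have := E j; rewrite !ffunE.
by case: eqP => // _ /ordS_inj.
Qed.

Lemma cen_ordS (j : 'I_N) :
  exists b : bool, ((ordS j : nat)%:Z = (j : nat)%:Z + 1 - b%:Z * N%:Z)%R.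
Proof.
have := ltn_ord j; rewrite leq_eqVlt => /orP[/eqP E|lt].
  exists true; have -> : (ordS j : nat) = 0%N by rewrite /= E modnn.
  by move: (nat_of_ord j) E => q <-; rewrite mul1r -addn1 PoszD subrr.
by exists false; rewrite /ordS /= modn_small // mul0r subr0 -addn1 PoszD.
Qed.

Lemma phase_gshift k i x :
  exists z : int, phase k (gshift i x) = phase k x + h * (k i)%:~R + 2 * pi * z%:~R.
Proof.
have [b Hb] := cen_ordS (x i).
exists (- (k i * b%:Z)).
rewrite /phase /dot (bigD1 i) //= [in RHS](bigD1 i) //=.
rewrite (eq_bigr (fun j => k j * cen x j)); last first.
  by move=> j ji; rewrite /cen !ffunE (negPf ji).
have -> : cen (gshift i x) i = cen x i + 1 - b%:Z * N%:Z.
  by rewrite /cen ffunE eqxx Hb; ring.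
have hN : N%:R != 0 :> R := natN_neq0.
rewrite !rmorphD /= !rmorphM /= !rmorphD !rmorphN /= !rmorphM /=.
by rewrite -[(N%:Z)%:~R]/(N%:R : R); field; rewrite nat1r natN_neq0.
Qed.

(** [rev_ord] is x -> -x in centred coordinates; it permutes the grid, and the sine is odd. *)
Lemma sum_sin_phase k : \sum_x sin (phase k x) = 0.
Proof.
pose r (x : grid) : grid := [ffun i => rev_ord (x i)].
have rK : involutive r by move=> x; apply/ffunP => i; rewrite !ffunE rev_ordK.
have cr x i : cen (r x) i = - cen x i.
  rewrite /cen ffunE /=; have := ltn_ord (x i); rewrite ltnS => le.
  move: (nat_of_ord (x i)) le => q le.
  by rewrite subSS -subzn // -addnn PoszD; ring.
have E : \sum_x sin (phase k x) = - \sum_x sin (phase k x).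
  rewrite [LHS](reindex_inj (inv_inj rK)) /= -sumrN; apply: eq_bigr => x _.
  rewrite -sinN; congr sin; rewrite /phase -mulrN; congr (_ * _).
  rewrite -rmorphN /= /dot -sumrN; congr (_ %:~R); apply: eq_bigr => i _.
  by rewrite cr mulrN.
by lra.
Qed.

(** A translation by one step in direction [i] multiplies the sum by cos (h k_i), the sine part
    being zero. The sum therefore vanishes unless this factor is 1, which forces N to divide k_i. *)
Lemma sum_cos_phase k i : ~~ (N%:Z %| k i)%Z -> \sum_x cos (phase k x) = 0.
Proof.
move=> ndiv.
have E : \sum_x cos (phase k x) = cos (h * (k i)%:~R) * \sum_x cos (phase k x).
  rewrite [LHS](reindex_inj (@gshift_inj i)) /=.
  rewrite (eq_bigr (fun x => cos (h * (k i)%:~R) * cos (phase k x)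
    - sin (h * (k i)%:~R) * sin (phase k x))); last first.
    move=> x _; have [z ->] := phase_gshift k i x.
    by rewrite cos_periodz cosD; ring.
  by rewrite sumrB -!mulr_sumr sum_sin_phase mulr0 subr0.
have : (1 - cos (h * (k i)%:~R)) * \sum_x cos (phase k x) = 0.
  by rewrite mulrBl mul1r -E subrr.
move/eqP; rewrite mulf_eq0 => /orP[|/eqP//].
rewrite subr_eq0 => /eqP c1; case/negP: ndiv.
pose q := (k i %/ N%:Z)%Z; pose r := (k i %% N%:Z)%Z.
have kE : k i = q * N%:Z + r by exact: divz_eq.
have r0 : 0 <= r by apply: modz_ge0.
have rN : r < N%:Z by apply: ltz_pmod.
suff : r = 0 by move=> r00; apply/dvdz_mod0P.
clearbody q r.
have N0 : 0 < N%:R :> R by rewrite ltr0n.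
have c2 : cos (h * r%:~R) = 1.
  rewrite [RHS]c1 -[LHS](cos_periodz _ q); congr cos.
  rewrite kE rmorphD /= rmorphM /= -[(N%:Z)%:~R]/(N%:R : R). field.
  by rewrite nat1r natN_neq0.
(* The half angle is pi r / N with 0 <= r < N; it lies in (0, pi), where the sine is positive,
   unless r = 0. *)
have s2 : sin (h * r%:~R / 2) = 0.
  have := cos_mulr2n (h * r%:~R / 2); rewrite {1}mulr2n -splitr.
  rewrite c2 cos2sin2 mulr2n => e; apply/eqP; rewrite -sqrf_eq0; apply/eqP.
  by move: e; set y := sin _ ^+ 2; lra.
apply/eqP/negPn/negP => rn0.
have rp : 0 < r by rewrite lt_neqAle eq_sym rn0.
have : 0 < sin (h * r%:~R / 2).
  have rR : (0 : R) < r%:~R by rewrite ltr0z.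
  have rRN : (r%:~R : R) < N%:R by rewrite -[N%:R]/((N%:Z)%:~R) ltr_int.
  have p0 := pi_gt0 R.
  apply: sin_gt0_pi; rewrite !mulr_gt0 ?invr_gt0 //=.
  have -> : h * r%:~R / 2 = pi * (r%:~R / N%:R) by field; rewrite nat1r natN_neq0.
  by rewrite -[ltRHS]mulr1 ltr_pM2l // ltr_pdivrMr // mul1r.
by rewrite s2 ltxx.
Qed.

Lemma dotC k l : dot k l = dot l k.
Proof. by apply: eq_bigr => i _; rewrite mulrC. Qed.

Lemma cen_inj : injective cen.
Proof.
move=> x y E; apply/ffunP => i; apply: val_inj => /=.
have : cen x i = cen y i by rewrite E.
by rewrite /cen => /addIr [].
Qed.

Lemma cen_bound x i : `|cen x i| <= M%:Z.
Proof.
rewrite /cen; have := ltn_ord (x i); rewrite ltnS.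
move: (nat_of_ord (x i)) => q; rewrite -lez_nat -addnn PoszD => le.
rewrite ler_norml; apply/andP; split.
  by rewrite lerBrDl subrr.
by rewrite lerBlDr.
Qed.

(** By [casM] the product is a cosine at the difference plus a sine at the sum. Distinct centred
    frequencies differ in some coordinate by at most 2 M < N in absolute value, so N does not divide
    that difference. *)
Lemma ch_orth m m' : \sum_x ch (cen m) x * ch (cen m') x =
  #|grid|%:R * (m == m')%:R.
Proof.
under eq_bigr => x _ do rewrite /ch casM.
rewrite big_split /=.
pose d : 'I_n -> int := fun i => cen m i - cen m' i.
pose s : 'I_n -> int := fun i => cen m i + cen m' i.
have E1 x : phase (cen m) x - phase (cen m') x = phase d x.
  rewrite /phase -mulrBr -rmorphB /= /dot -sumrB; congr (_ * _%:~R).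
  by apply: eq_bigr => i _; rewrite /d [RHS]mulrBl.
have E2 x : phase (cen m) x + phase (cen m') x = phase s x.
  rewrite /phase -mulrDr -rmorphD /= /dot -big_split; congr (_ * _%:~R).
  by apply: eq_bigr => i _; rewrite /s [RHS]mulrDl.
under eq_bigr => x _ do rewrite E1.
under [X in _ + X]eq_bigr => x _ do rewrite E2.
rewrite sum_sin_phase addr0; case: (eqVneq m m') => [mm'|ne].
  rewrite (eq_bigr (fun=> 1)) ?sumr_const ?mulr1 // => x _.
  by rewrite /phase /dot big1 ?mulr0 ?cos0 // => i _; rewrite /d mm' subrr mul0r.
have [i nd] : exists i, d i != 0.
  apply: contrapT => /forallNP al; case/eqP: ne; apply: cen_inj; apply/funext => i.
  by apply/eqP; rewrite -subr_eq0; have := al i => /negP; rewrite negbK.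
rewrite (@sum_cos_phase d i) ?mulr0 //; apply/negP => /dvdzP[q dq].
have := cen_bound m i; have := cen_bound m' i.
have : d i = cen m i - cen m' i by [].
have q0 : q != 0 by apply: contraNneq nd => q0; rewrite dq q0 mul0r.
move: dq q0; set a := cen m i; set b := cen m' i; move=> -> q0 dab.
rewrite !ler_norml => /andP[b1 b2] /andP[a1 a2].
move: dab q0 a1 a2 b1 b2; rewrite -/a -/b; move: a b; clear => a b.
have -> : (M.*2.+1)%:Z = 2 * M%:Z + 1 by rewrite -addn1 -mul2n PoszD PoszM.
move: (M%:Z) => mm.
by case: (ltrgtP q 0) => // q0; nia.
Qed.

Lemma card_grid_neq0 : (#|grid|%:R : R) != 0.
Proof.
rewrite pnatr_eq0 -lt0n; apply/card_gt0P; exists [ffun=> ord0].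
by rewrite inE.
Qed.

Lemma phaseC m x : phase (cen m) x = phase (cen x) m.
Proof. by rewrite /phase dotC. Qed.

(** [phase] is symmetric in point and frequency, so orthogonality over points is also orthogonality
    over frequencies. *)
Lemma coef_inv g x : g x = \sum_m coef g m * ch (cen m) x.
Proof.
under eq_bigr => m _ do rewrite /coef mulr_sumr mulr_suml.
rewrite exchange_big /= (eq_bigr (fun y => g y * (y == x)%:R)); last first.
  move=> y _; rewrite (eq_bigr (fun m => (#|grid|%:R^-1 * g y) *
     (ch (cen y) m * ch (cen x) m))).
    by rewrite -mulr_sumr ch_orth; field; exact: card_grid_neq0.
  by move=> m _; rewrite /ch phaseC (phaseC m x); ring.
rewrite (bigD1 x) //= eqxx mulr1 big1 ?addr0 // => y /negPf ->.
by rewrite mulr0.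
Qed.

Lemma red_subproof (z : int) : (`|(z + M%:Z) %% N%:Z|%Z < N)%N.
Proof.
have N0 : 0 < N%:Z by [].
have := ltz_pmod (z + M%:Z) N0; have := modz_ge0 (z + M%:Z) (lt0r_neq0 N0).
by case: (_ %% _)%Z.
Qed.

(** Aliasing: the centred representative of [k] modulo N, indistinguishable from [k] on the grid
    ([ch_red]). *)
Definition red (k : 'I_n -> int) : grid := [ffun i => Ordinal (red_subproof (k i))].

Lemma cen_redE k i : cen (red k) i = k i - N%:Z * ((k i + M%:Z) %/ N%:Z)%Z.
Proof.
rewrite /cen ffunE /=.
have N0 : 0 < N%:Z by [].
rewrite gez0_abs ?modz_ge0 // /modz; ring.
Qed.

Lemma ch_red k x : ch (cen (red k)) x = ch k x.
Proof.
pose q i := - ((k i + M%:Z) %/ N%:Z)%Z.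
rewrite /ch -[RHS](cas_periodz _ (dot q (cen x))); congr cas.
rewrite /phase (_ : dot _ _ = dot k (cen x) + N%:Z * dot q (cen x)).
  rewrite rmorphD rmorphM /= -[(N%:Z)%:~R]/(N%:R : R). field.
  by rewrite nat1r natN_neq0.
rewrite /dot mulr_sumr -big_split /=; apply: eq_bigr => i _.
by rewrite cen_redE /q; ring.
Qed.

(** If the reduction moves k_i by a nonzero multiple of N, then |k_i| > M already. Aliasing never
    raises a frequency, so products on the grid are controlled by the same weights as on the
    torus. *)
Lemma cen_red_le k i : `|cen (red k) i| <= `|k i|.
Proof.
have := cen_bound (red k) i; rewrite cen_redE.
set q := divz _ _; case: (eqVneq q 0) => [->|q0]; first by rewrite mulr0 subr0.
move=> hb; apply: (le_trans hb); move: hb; rewrite ler_norml ler_normr.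
have -> : (M.*2.+1)%:Z = 2 * M%:Z + 1 by rewrite -addn1 -mul2n PoszD PoszM.
have : 0 <= M%:Z by [].
move: q0; move: q (k i) (M%:Z); clear => q z mm q0 m0 /andP[a b].
apply/orP; case: (ltrgtP q 0) q0 => // q0 _.
  by right; nia.
by left; nia.
Qed.

Lemma coef_ch k m : coef (ch k) m = (m == red k)%:R.
Proof.
rewrite /coef; under eq_bigr => x _ do rewrite -ch_red.
rewrite ch_orth mulrA mulVf ?card_grid_neq0 // mul1r eq_sym //.
Qed.
End Grid.

(** * Weighted Wiener norms *)

Section AlgNorm.
Variables (R : realType) (X : Type) (nu : (X -> R) -> R).

(** The only rules used by the contraction argument, which therefore applies to every grid and
    weight at once. The 2 in [anM] comes from the four terms with coefficient 1/2 in [casM4]. *)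
Record alg_norm : Prop := AlgNorm {
  an_ge0 : forall f, 0 <= nu f;
  anD : forall f g, nu (fun x => f x + g x) <= nu f + nu g;
  anZ : forall c f, nu (fun x => c * f x) <= `|c| * nu f;
  anM : forall f g, nu (fun x => f x * g x) <= 2 * nu f * nu g;
  an1 : nu (fun=> 1) <= 1 }.

Hypothesis H : alg_norm.

Lemma an_cst c : nu (fun=> c) <= `|c|.
Proof.
have -> : (fun _ : X => c) = (fun x => c * 1) by apply/funext => x; rewrite mulr1.
apply: le_trans (anZ H c (fun=> 1)) _.
by rewrite -[leRHS]mulr1 ler_wpM2l // (an1 H).
Qed.

Lemma an0 : nu (fun=> 0) = 0.
Proof. by apply: le_anti; rewrite (an_ge0 H) andbT -[leRHS](normr0 R) an_cst. Qed.

End AlgNorm.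

Section GridNorm.
Variables (R : realType) (n M : nat).
Local Notation grid := (grid n M).

(** [eta] rescales the frequencies. Every nonnegative [eta] gives a submultiplicative weight; it is
    1 for [eta = 0], and small [eta] brings the norm near the unweighted one ([nrm_interp]). *)
Definition wt (eta : R) (s : nat) (k : 'I_n -> int) : R :=
  (1 + eta * \sum_i `|(k i)%:~R|) ^+ s.

Definition nrm eta s (g : grid -> R) : R :=
  \sum_m `|coef g m| * wt eta s (cen m).

Variables (eta : R) (s : nat).
Hypothesis eta0 : 0 <= eta.

Lemma wt_base (k : 'I_n -> int) : 0 <= eta * \sum_i `|((k i)%:~R : R)|.
Proof. by rewrite mulr_ge0 // sumr_ge0. Qed.

Lemma wt_ge1 k : 1 <= wt eta s k.
Proof. by rewrite exprn_ege1 // lerDl wt_base. Qed.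

Lemma wt_ge0 k : 0 <= wt eta s k.
Proof. exact: le_trans ler01 (wt_ge1 k). Qed.

Lemma wt_le k l : (forall i, `|k i| <= `|l i|) -> wt eta s k <= wt eta s l.
Proof.
move=> kl; rewrite lerXn2r ?nnegrE ?addr_ge0 ?wt_base //.
rewrite lerD2l ler_wpM2l //; apply: ler_sum => i _.
by rewrite -!intr_norm ler_int.
Qed.

Lemma wt_add (k l m : 'I_n -> int) : (forall i, `|m i| <= `|k i| + `|l i|) ->
  wt eta s m <= wt eta s k * wt eta s l.
Proof.
move=> kl; rewrite -exprMn lerXn2r ?nnegrE ?mulr_ge0 ?addr_ge0 ?wt_base //.
apply: (@le_trans _ _ (1 + eta * (\sum_i `|((k i)%:~R : R)| + \sum_i `|((l i)%:~R : R)|))).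
  rewrite lerD2l ler_wpM2l // -big_split; apply: ler_sum => i _.
  by rewrite -!intr_norm /= -intrD ler_int.
by have := wt_base k; have := wt_base l; nra.
Qed.

Lemma hcoefD (f g : grid -> R) m : coef (fun x => f x + g x) m = coef f m + coef g m.
Proof.
rewrite /coef -mulrDr -big_split; congr (_ * _).
by apply: eq_bigr => x _; rewrite mulrDl.
Qed.

Lemma hcoefZ c (f : grid -> R) m : coef (fun x => c * f x) m = c * coef f m.
Proof.
rewrite /coef mulrCA; congr (_ * _); rewrite mulr_sumr.
by apply: eq_bigr => x _; rewrite mulrA.
Qed.

Lemma nrm_ge0 g : 0 <= nrm eta s g.
Proof. by apply: sumr_ge0 => m _; rewrite mulr_ge0 // wt_ge0. Qed.

Lemma nrmD f g : nrm eta s (fun x => f x + g x) <= nrm eta s f + nrm eta s g.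
Proof.
rewrite /nrm -big_split; apply: ler_sum => m _.
by rewrite hcoefD /= -mulrDl ler_wpM2r ?wt_ge0 // ler_normD.
Qed.

Lemma nrmZ c f : nrm eta s (fun x => c * f x) = `|c| * nrm eta s f.
Proof.
by rewrite /nrm mulr_sumr; apply: eq_bigr => m _; rewrite hcoefZ normrM mulrA.
Qed.

Lemma nrm0 : nrm eta s (fun=> 0) = 0.
Proof.
have -> : (fun _ : grid => 0) = (fun x => (0 : R) * 0) by apply/funext => x; rewrite mulr0.
by rewrite nrmZ normr0 mul0r.
Qed.

Lemma nrm_sum (I : Type) (r : seq I) (F : I -> grid -> R) :
  nrm eta s (fun x => \sum_(i <- r) F i x) <= \sum_(i <- r) nrm eta s (F i).
Proof.
elim: r => [|i r IH].
  by under eq_fun do rewrite big_nil; rewrite nrm0 big_nil.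
under eq_fun do rewrite big_cons; rewrite big_cons.
by apply: le_trans (nrmD _ _) _; rewrite lerD2l.
Qed.

Lemma nrm_ch k : nrm eta s (ch R k) <= wt eta s k.
Proof.
rewrite /nrm (bigD1 (red M k)) //= big1 ?addr0 => [|m /negPf ne].
  rewrite coef_ch eqxx normr1 mul1r; apply: wt_le => i.
  exact: cen_red_le.
by rewrite coef_ch ne normr0 mul0r.
Qed.

Lemma nrm_trig (I : finType) (a : I -> R) (k : I -> 'I_n -> int) :
  nrm eta s (fun x => \sum_i a i * ch R (k i) x) <= \sum_i `|a i| * wt eta s (k i).
Proof.
apply: le_trans (nrm_sum _ _) _; apply: ler_sum => i _.
by rewrite nrmZ ler_wpM2l // nrm_ch.
Qed.

Lemma nrm_trig2 (I : finType) (a : I -> R) (k : I -> 'I_n -> int) (A : I -> R) :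
  (forall i, `|a i| <= A i) ->
  nrm eta s (fun x => \sum_i a i * ch R (k i) x) <= \sum_i A i * wt eta s (k i).
Proof.
move=> aA; apply: le_trans (nrm_trig _ _) _; apply: ler_sum => i _.
by rewrite ler_wpM2r ?wt_ge0.
Qed.

Lemma phaseD (k l m : 'I_n -> int) (x : grid) : (forall i, m i = k i + l i) ->
  phase R m x = phase R k x + phase R l x.
Proof.
move=> E; rewrite /phase -mulrDr -rmorphD; congr (_ * _%:~R).
by rewrite /dot -big_split; apply: eq_bigr => i _; rewrite E [LHS]mulrDl.
Qed.

Lemma phaseN (k l : 'I_n -> int) (x : grid) : (forall i, l i = - k i) ->
  phase R l x = - phase R k x.
Proof.
move=> E; rewrite /phase -mulrN -rmorphN; congr (_ * _%:~R).
by rewrite /dot -sumrN; apply: eq_bigr => i _; rewrite E [LHS]mulNr.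
Qed.

Lemma nrm_chM (k l : 'I_n -> int) :
  nrm eta s (fun x => ch R k x * ch R l x) <= 2 * (wt eta s k * wt eta s l).
Proof.
(* The four frequencies of [casM4], each bounded coordinatewise by |k_i| + |l_i|; four coefficients
   of size 1/2 make the factor 2. *)
pose K (j : 'I_4) : 'I_n -> int := [tuple (fun i => k i - l i);
   (fun i => l i - k i); (fun i => k i + l i); (fun i => - (k i + l i))]`_j.
pose a (j : 'I_4) : R := [tuple 2^-1; 2^-1; 2^-1; - 2^-1]`_j.
have -> : (fun x => ch R k x * ch R l x) = (fun x : grid => \sum_j a j * ch R (K j) x).
  apply/funext => x; rewrite !big_ord_recl big_ord0 /= /a /K /= /ch casM4.
  rewrite -(@phaseN k (fun i => - k i) x) // -(@phaseN l (fun i => - l i) x) //.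
  rewrite -(@phaseD k (fun i => - l i) (fun i => k i - l i)) //.
  rewrite -(@phaseD l (fun i => - k i) (fun i => l i - k i)) //.
  rewrite -(@phaseD k l (fun i => k i + l i)) //.
  by rewrite -(@phaseN (fun i => k i + l i) (fun i => - (k i + l i))) //; ring.
apply: le_trans (@nrm_trig2 _ a K (fun=> 2^-1) _) _.
  case; case=> [|[|[|[|//]]]] /= lt; rewrite /a /= ?normrN ger0_norm //.
have W j : wt eta s (K j) <= wt eta s k * wt eta s l.
  apply: wt_add; move: j; case; case=> [|[|[|[|//]]]] lt i; rewrite /K /= ?normrN;
  rewrite ?ler_normD // ?ler_normB // [leRHS]addrC ler_normB //.
rewrite -mulr_sumr; apply: (@le_trans _ _ (2^-1 * \sum_(j < 4) (wt eta s k * wt eta s l))).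
  by rewrite ler_wpM2l // ler_sum.
rewrite sumr_const card_ord -mulr_natr; lra.
Qed.

Lemma nrmM f g : nrm eta s (fun x => f x * g x) <= 2 * nrm eta s f * nrm eta s g.
Proof.
have -> : (fun x => f x * g x) = (fun x : grid => \sum_m \sum_m'
   (coef f m * coef g m') * (ch R (cen m) x * ch R (cen m') x)).
  apply/funext => x; rewrite {1}(coef_inv f x) {1}(coef_inv g x) mulr_suml.
  by apply: eq_bigr => m _; rewrite mulr_sumr; apply: eq_bigr => m' _; ring.
apply: le_trans (nrm_sum _ _) _; rewrite -mulrA mulr_suml mulr_sumr.
apply: ler_sum => m _; apply: le_trans (nrm_sum _ _) _.
rewrite !mulr_sumr; apply: ler_sum => m' _; rewrite nrmZ normrM.
have -> : 2 * (`|coef f m| * wt eta s (cen m) * (`|coef g m'| * wt eta s (cen m'))) =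
  `|coef f m| * `|coef g m'| * (2 * (wt eta s (cen m) * wt eta s (cen m'))) by ring.
by rewrite ler_wpM2l ?mulr_ge0 // nrm_chM.
Qed.

Lemma ch0 (x : grid) : ch R (fun=> 0) x = 1.
Proof.
by rewrite /ch /phase /dot big1 ?mulr0 ?cas0 // => i _; rewrite mul0r.
Qed.

Lemma nrm_alg : alg_norm (nrm eta s).
Proof.
split; [exact: nrm_ge0|exact: nrmD| |exact: nrmM|].
  by move=> c f; rewrite nrmZ.
rewrite (_ : (fun=> 1) = ch R (fun=> 0)); last by apply/funext => x; rewrite ch0.
apply: le_trans (nrm_ch _) _; rewrite /wt big1 ?mulr0 ?addr0 ?expr1n // => i _.
by rewrite normr0.
Qed.

Lemma coef_le_nrm g m : `|coef g m| <= nrm eta s g.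
Proof.
rewrite /nrm (bigD1 m) //= -[leLHS]addr0 lerD //.
  by rewrite ler_peMr // wt_ge1.
by apply: sumr_ge0 => m' _; rewrite mulr_ge0 // wt_ge0.
Qed.

Lemma val_le_nrm g x : `|g x| <= 2 * nrm eta s g.
Proof.
rewrite {1}(coef_inv g x); apply: le_trans (ler_norm_sum _ _ _) _.
rewrite /nrm mulr_sumr; apply: ler_sum => m _; rewrite normrM mulrC.
by rewrite ler_pM // ?cas_le2 // ler_peMr // wt_ge1.
Qed.

End GridNorm.

(** * Polynomial functions in normed algebras *)

Section PolyFun.
Variables (R : realType) (I : finType).
Implicit Types (G Q : (I -> R) -> R).

(** An inductive class of functions: expansion at 0 and passage to limits become inductions, and
    evaluation along functions on a grid is plain application. *)
Inductive polyf : ((I -> R) -> R) -> Prop :=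
| PolyCst c : polyf (fun=> c)
| PolyVar a : polyf (fun z => z a)
| PolyAdd G H : polyf G -> polyf H -> polyf (fun z => G z + H z)
| PolyMul G H : polyf G -> polyf H -> polyf (fun z => G z * H z).

Lemma polyf_opp G : polyf G -> polyf (fun z => - G z).
Proof.
move=> h; have -> : (fun z => - G z) = (fun z => (- 1) * G z).
  by apply/funext => z; rewrite mulN1r.
by apply: PolyMul => //; exact: PolyCst.
Qed.

Lemma polyf_sub G H : polyf G -> polyf H -> polyf (fun z => G z - H z).
Proof. by move=> g h; apply: PolyAdd => //; apply: polyf_opp. Qed.

Lemma polyf_sum (J : Type) (r : seq J) (P : pred J) (F : J -> (I -> R) -> R) :
  (forall j, polyf (F j)) -> polyf (fun z => \sum_(j <- r | P j) F j z).
Proof.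
move=> h; elim: r => [|j r IH].
  by under eq_fun do rewrite big_nil; exact: PolyCst.
by under eq_fun do rewrite big_cons; case: (P j) => //; apply: PolyAdd.
Qed.

Lemma polyf_exp G (m : nat) : polyf G -> polyf (fun z => G z ^+ m).
Proof.
move=> h; elim: m => [|m IH]; first exact: PolyCst.
by under eq_fun do rewrite exprS; apply: PolyMul.
Qed.

(* [vanish j Q] : Q vanishes to order j at 0, uniformly over all normed
   algebras of functions in which its arguments are evaluated. *)
Definition vanish (j : nat) Q : Prop := exists2 C : R, 0 <= C &
  forall (X : Type) (nu : (X -> R) -> R), alg_norm nu ->
  forall (z z' : I -> X -> R) (rho d : R), 0 <= rho -> rho <= 1 -> 0 <= d ->
  (forall a, nu (z a) <= rho) -> (forall a, nu (z' a) <= rho) ->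
  (forall a, nu (fun x => z a x - z' a x) <= d) ->
  nu (fun x => Q (z^~ x)) <= C * rho ^+ j /\
  nu (fun x => Q (z^~ x) - Q (z'^~ x)) <= C * rho ^+ j.-1 * d.

Lemma vanishW j k Q : (j <= k)%N -> vanish k Q -> vanish j Q.
Proof.
move=> jk [C C0 H]; exists C => // X nu nuP z z' rho d r0 r1 d0 hz hz' hd.
have [h1 h2] := H X nu nuP z z' rho d r0 r1 d0 hz hz' hd.
split; first by apply: (le_trans h1); rewrite ler_wpM2l // ler_wiXn2l.
apply: (le_trans h2); rewrite ler_wpM2r // ler_wpM2l // ler_wiXn2l //.
by rewrite -!subn1 leq_sub2r.
Qed.

Lemma vanish_cst c : vanish 0 (fun=> c).
Proof.
exists `|c| => // X nu nuP z z' rho d r0 r1 d0 hz hz' hd; split.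
  by rewrite mulr1; exact: an_cst.
by under eq_fun do rewrite subrr; rewrite an0 // mulr1 mulr_ge0.
Qed.

Lemma vanish0 j : vanish j (fun=> 0).
Proof.
exists 0 => // X nu nuP z z' rho d r0 r1 d0 hz hz' hd; split.
  by rewrite mul0r an0.
by under eq_fun do rewrite subrr; rewrite an0 // !mul0r.
Qed.

Lemma vanish_var a : vanish 1 (fun z => z a).
Proof.
exists 1 => // X nu nuP z z' rho d r0 r1 d0 hz hz' hd; split.
  by rewrite mul1r expr1.
by rewrite !mul1r.
Qed.

Lemma vanishD j G Q : vanish j G -> vanish j Q -> vanish j (fun z => G z + Q z).
Proof.
move=> [C C0 H] [D D0 K]; exists (C + D); first exact: addr_ge0.
move=> X nu nuP z z' rho d r0 r1 d0 hz hz' hd.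
have [h1 h2] := H X nu nuP z z' rho d r0 r1 d0 hz hz' hd.
have [k1 k2] := K X nu nuP z z' rho d r0 r1 d0 hz hz' hd.
split; first by rewrite mulrDl; apply: le_trans (anD nuP _ _) _; exact: lerD.
have -> : (fun x => G (z^~ x) + Q (z^~ x) - (G (z'^~ x) + Q (z'^~ x))) =
  (fun x => (G (z^~ x) - G (z'^~ x)) + (Q (z^~ x) - Q (z'^~ x))).
  by apply/funext => x; ring.
by rewrite !mulrDl; apply: le_trans (anD nuP _ _) _; exact: lerD.
Qed.

(** The difference telescopes as (G z - G z') Q z + G z' (Q z - Q z'); each term carries the 2 of
    [anM], hence the constant 4 C D. *)
Lemma vanishM i j G Q : vanish i G -> vanish j Q ->
  vanish (i + j) (fun z => G z * Q z).
Proof.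
move=> [C C0 H] [D D0 K]; exists (4 * C * D); first by rewrite !mulr_ge0.
move=> X nu nuP z z' rho d r0 r1 d0 hz hz' hd.
have [h1 h2] := H X nu nuP z z' rho d r0 r1 d0 hz hz' hd.
have [k1 k2] := K X nu nuP z z' rho d r0 r1 d0 hz hz' hd.
(* The size of G at z' is read off from the pair (z', z') at distance 0. *)
have [l1 _] := H X nu nuP z' z' rho 0 r0 r1 (lexx _) hz' hz'
   (fun a => ltac:(by under eq_fun do rewrite subrr; rewrite an0)).
have P0 m : 0 <= rho ^+ m by apply: exprn_ge0.
split.
  apply: le_trans (anM nuP _ _) _.
  have := ler_pM (an_ge0 nuP _) (an_ge0 nuP _) h1 k1.
  rewrite exprD; have := mulr_ge0 (mulr_ge0 C0 D0) (mulr_ge0 (P0 i) (P0 j)).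
  by set u := nu _; set v := nu _; move: (rho ^+ i) (rho ^+ j) => a b; lra.
have -> : (fun x => G (z^~ x) * Q (z^~ x) - (G (z'^~ x) * Q (z'^~ x))) =
  (fun x => (G (z^~ x) - G (z'^~ x)) * Q (z^~ x) +
            G (z'^~ x) * (Q (z^~ x) - Q (z'^~ x))).
  by apply/funext => x; ring.
apply: le_trans (anD nuP _ _) _.
apply: le_trans (lerD (anM nuP _ _) (anM nuP _ _)) _.
have A := ler_pM (an_ge0 nuP _) (an_ge0 nuP _) h2 k1.
have B := ler_pM (an_ge0 nuP _) (an_ge0 nuP _) l1 k2.
(* Predecessors are truncated at 0, so these exponents are only ordered, not equal; [rho <= 1] turns
   the order into the wanted bounds. *)
have n1 : ((i + j).-1 <= i.-1 + j)%N by case: (i) => [|i']; rewrite ?leq_pred.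
have n2 : ((i + j).-1 <= i + j.-1)%N by rewrite addnC (addnC i); case: (j) => [|j']; rewrite ?leq_pred.
have E1 : rho ^+ i.-1 * rho ^+ j <= rho ^+ (i + j).-1 by rewrite -exprD ler_wiXn2l.
have E2 : rho ^+ i * rho ^+ j.-1 <= rho ^+ (i + j).-1 by rewrite -exprD ler_wiXn2l.
have CDd : 0 <= C * D * d by rewrite !mulr_ge0.
have F1 := ler_wpM2l CDd E1; have F2 := ler_wpM2l CDd E2.
rewrite -!mulrA in A B F1 F2 *.
move: A B F1 F2; move: (nu _) (nu _) (nu _) (nu _) => a b c e.
move: (rho ^+ i) (rho ^+ j) (rho ^+ i.-1) (rho ^+ j.-1) (rho ^+ (i + j).-1).
by move=> p q r s t A B F1 F2; lra.
Qed.

Lemma vanishZ j c Q : vanish j Q -> vanish j (fun z => c * Q z).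
Proof. exact: (vanishM (vanish_cst c)). Qed.

Lemma vanish_sum (J : Type) (r : seq J) (P : pred J) (F : J -> (I -> R) -> R) k :
  (forall j, vanish k (F j)) -> vanish k (fun z => \sum_(j <- r | P j) F j z).
Proof.
move=> h; elim: r => [|j r IH].
  by under eq_fun do rewrite big_nil; exact: vanish0.
by under eq_fun do rewrite big_cons; case: (P j) => //; apply: vanishD.
Qed.

Definition expands G (c : R) (l : I -> R) : Prop :=
  vanish 2 (fun z => G z - c - \sum_a l a * z a).

Lemma vanish_lin (l : I -> R) : vanish 1 (fun z => \sum_a l a * z a).
Proof. by apply: vanish_sum => a; apply: vanishZ; exact: vanish_var. Qed.

Lemma polyf_expands G : polyf G -> exists c l, expands G c l.
Proof.
elim=> [c|a|{}G H _ [c [l GH]] _ [d [k HH]]|{}G H _ [c [l GH]] _ [d [k HH]]].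
- exists c, (fun=> 0); rewrite /expands (_ : (fun _ => _) = fun=> 0); first exact: vanish0.
  by apply/funext => z; rewrite subrr big1 ?subr0 // => a _; rewrite mul0r.
- exists 0, (fun b => (b == a)%:R); rewrite /expands (_ : (fun _ => _) = fun=> 0).
    exact: vanish0.
  apply/funext => z; rewrite subr0 (bigD1 a) //= eqxx mul1r big1 ?addr0 ?subrr //.
  by move=> b /negPf ->; rewrite mul0r.
- exists (c + d), (fun a => l a + k a); have := vanishD GH HH.
  congr vanish; apply/funext => z.
  under [in RHS]eq_bigr do rewrite mulrDl.
  by rewrite big_split /=; ring.
- exists (c * d), (fun a => c * k a + d * l a).
  pose L z := \sum_a l a * z a; pose K z := \sum_a k a * z a.
  have L1 : vanish 1 L by exact: vanish_lin.
  have K1 : vanish 1 K by exact: vanish_lin.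
  pose G2 z := G z - c - L z; pose H2 z := H z - d - K z.
  (* In (c + L + G2) (d + K + H2), what exceeds degree one is L K, c H2 + d G2 and three products of
     order 3 or 4, lowered to order 2. *)
  have := vanishD (vanishM L1 K1) (vanishD
    (vanishD (vanishZ c HH) (vanishZ d GH))
    (vanishD (@vanishW 2 3 _ isT (vanishM L1 HH)) (vanishD
      (@vanishW 2 3 _ isT (vanishM GH K1))
      (@vanishW 2 4 _ isT (vanishM GH HH))))).
  congr vanish; apply/funext => z; rewrite -/(L z) -/(K z).
  have -> : \sum_a (c * k a + d * l a) * z a = c * K z + d * L z.
    rewrite /K /L !mulr_sumr -big_split; apply: eq_bigr => a _.
    by rewrite mulrDl !mulrA.
  by ring.
Qed.

(** Specialised to a one-point space, [vanish] yields scalar estimates, from which the linear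
    coefficients of an expansion are identified along coordinate rays. *)
Lemma abs_alg_norm : @alg_norm R unit (fun f => `|f tt|).
Proof.
split=> // [f g|c f|f g|]; first exact: ler_normD.
- by rewrite normrM.
- by rewrite normrM -mulrA ler_peMl ?mulr_ge0 // ler1n.
- by rewrite normr1.
Qed.

Definition basis_ray (a : I) (t : R) : I -> R := fun b => (b == a)%:R * t.

Lemma expands_ray G c l a : expands G c l -> exists2 C : R, 0 <= C &
  forall t, `|t| <= 1 -> `|G (basis_ray a t) - c - l a * t| <= C * t ^+ 2.
Proof.
move=> [C C0 H]; exists C => // t t1.
have hz b : `|basis_ray a t b| <= `|t|.
  by rewrite /basis_ray; case: eqP => _; rewrite ?mul1r ?mul0r // normr0.
have h0 b : `|basis_ray a t b - basis_ray a t b| <= 0 by rewrite subrr normr0.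
have [h _] := H unit _ abs_alg_norm (fun b _ => basis_ray a t b)
  (fun b _ => basis_ray a t b) `|t| 0 (normr_ge0 _) t1 (lexx _) hz hz h0.
move: h; rewrite real_normK ?num_real // (bigD1 a) //= big1 ?addr0.
  by rewrite /basis_ray eqxx mul1r.
by move=> b /negPf nb; rewrite /basis_ray nb mul0r mulr0.
Qed.

Lemma small_lin_eq0 (m C : R) : (forall t, 0 < t -> t <= 1 -> `|m * t| <= C * t ^+ 2) ->
  m = 0.
Proof.
move=> H; apply/eqP; rewrite -normr_le0 leNgt; apply/negP => m0.
have C0 : 0 <= C by have := H 1 ltr01 (lexx _); rewrite expr1n !mulr1; apply: le_trans.
pose t := Num.min 1 (`|m| / (2 * (C + 1))).
have C1 : 0 < 2 * (C + 1) by lra.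
have t0 : 0 < t by rewrite lt_min ltr01 divr_gt0.
have t1 : t <= 1 by rewrite ge_min lexx.
have t2 : t * (2 * (C + 1)) <= `|m| by rewrite -ler_pdivlMr // ge_min lexx orbT.
have := H t t0 t1; rewrite normrM (gtr0_norm t0) expr2 mulrA ler_pM2r //.
by nra.
Qed.

Lemma expands_cst G c l : expands G c l -> G (fun=> 0) = c.
Proof.
move=> [C C0 H].
have hz (b : I) : `|(0 : R)| <= 0 by rewrite normr0.
have h0 (b : I) : `|0 - 0 : R| <= 0 by rewrite subrr normr0.
have [h _] := H unit _ abs_alg_norm (fun b _ => 0)
  (fun b _ => 0) 0 0 (lexx _) ler01 (lexx _) hz hz h0.
move: h; rewrite expr0n mulr0 big1 ?subr0 ?normr_le0 ?subr_eq0; first by move/eqP.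
by move=> a _; rewrite mulr0.
Qed.

Lemma expands_lin G c l a m : expands G c l ->
  (exists C, forall t, 0 < t -> t <= 1 ->
    `|G (basis_ray a t) - G (fun=> 0) - m * t| <= C * t ^+ 2) -> l a = m.
Proof.
move=> E [D HD]; have [C C0 HC] := expands_ray a E.
apply/eqP; rewrite -subr_eq0; apply/eqP; apply: (@small_lin_eq0 _ (C + D)) => t t0 t1.
have := HD t t0 t1; rewrite (expands_cst E) => hD.
have := HC t; rewrite (gtr0_norm t0) => /(_ t1) hC.
have -> : (l a - m) * t = (G (basis_ray a t) - c - m * t) -
  (G (basis_ray a t) - c - l a * t) by ring.
by apply: le_trans (ler_normB _ _) _; rewrite mulrDl addrC lerD.
Qed.

Lemma expands_even G c l a : expands G c l ->
  (forall t, G (basis_ray a (- t)) = G (basis_ray a t)) -> l a = 0.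
Proof.
move=> E ev; have [C C0 HC] := expands_ray a E.
apply: (@small_lin_eq0 _ C) => t t0 t1.
have h1 := HC t; have h2 := HC (- t); move: h1 h2.
rewrite normrN (gtr0_norm t0) sqrrN => /(_ t1) h1 /(_ t1).
rewrite ev; move: h1; set g := G _ - c; rewrite !ler_norml mulrN opprK.
move=> /andP[a1 a2] /andP[b1 b2]; apply/andP; split; lra.
Qed.

End PolyFun.

(** * Picard iteration *)

Section Iteration.
Variables (R : realType) (I : finType).

(** Two coupled unknowns f = D + Q1 and s = Q2, both right-hand sides being evaluated at the jet
    [Z f s]. *)
Fixpoint picard (X : Type) (Z : (X -> R) -> (X -> R) -> I -> X -> R)
    (Q1 Q2 : (I -> R) -> R) (D : X -> R) (j : nat) : (X -> R) * (X -> R) :=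
  if j is j'.+1 then
    let z := Z (picard Z Q1 Q2 D j').1 (picard Z Q1 Q2 D j').2 in
    (fun x => D x + Q1 (z^~ x), fun x => Q2 (z^~ x))
  else (fun=> 0, fun=> 0).

(** The radius [rho] is chosen before the algebra, from the vanishing constants, [C1] and [r0]
    alone: one radius serves all grid sizes and all weights. *)
Lemma picard_bound (Q1 Q2 : (I -> R) -> R) (C1 r0 : R) :
  vanish 2 Q1 -> vanish 2 Q2 -> 1 <= C1 -> 0 < r0 ->
  exists rho : R, [/\ 0 < rho, rho <= r0 &
  forall (X : Type) (nu : (X -> R) -> R) Z D, alg_norm nu ->
    (forall f s, nu f <= rho -> nu s <= rho -> forall a, nu (Z f s a) <= C1 * rho) ->
    (forall f s f' s' d, nu (fun x => f x - f' x) <= d ->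
       nu (fun x => s x - s' x) <= d -> forall a,
       nu (fun x => Z f s a x - Z f' s' a x) <= C1 * d) ->
    nu D <= rho / 2 ->
    forall j, let p := picard Z Q1 Q2 D in
    [/\ nu (p j).1 <= rho, nu (p j).2 <= rho,
        nu (fun x => (p j.+1).1 x - (p j).1 x) <= rho / 2 ^+ j &
        nu (fun x => (p j.+1).2 x - (p j).2 x) <= rho / 2 ^+ j]].
Proof.
move=> [A A0 HA] [B B0 HB] C11 r00.
pose C2 := A + B + 1.
have C20 : 0 < C2 by rewrite /C2; lra.
have C21 : 1 <= C2 by rewrite /C2; lra.
have AC2 : A <= C2 by rewrite /C2; lra.
have BC2 : B <= C2 by rewrite /C2; lra.
(* Ensures C2 C1^2 rho <= 1/2. At jets of size C1 rho the quadratic terms then take at most half of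
   the radius, leaving the other half to the data, and differences are halved at each step. *)
pose rho := Num.min r0 (1 / (2 * C2 * C1 ^+ 2)).
have C10 : 0 < C1 by lra.
have K0 : 0 < 2 * C2 * C1 ^+ 2 by rewrite !mulr_gt0 // exprn_gt0.
have rho0 : 0 < rho by rewrite lt_min r00 divr_gt0.
have rhoK : C2 * C1 ^+ 2 * rho <= 1 / 2.
  have : rho * (2 * C2 * C1 ^+ 2) <= 1 by rewrite -ler_pdivlMr // ge_min lexx orbT.
  by lra.
have rhoC1 : C1 * rho <= 1.
  have h : C1 * rho <= C1 * (C1 * rho).
    by rewrite ler_peMl // mulr_ge0 // ltW.
  have h2 : C1 * (C1 * rho) <= C2 * (C1 * (C1 * rho)).
    by rewrite ler_peMl // !mulr_ge0 // ltW.
  by rewrite expr2 in rhoK; lra.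
exists rho; split=> //; first by rewrite ge_min lexx.
move=> X nu Z D nuP Zb Zd Db j p.
have C1r0 : 0 <= C1 * rho by rewrite mulr_ge0 // ltW.
have AC : A * (C1 * rho) ^+ 2 <= rho / 2.
  have h : A * (C1 * rho) ^+ 2 <= C2 * (C1 * rho) ^+ 2.
    by rewrite ler_wpM2r ?exprn_ge0.
  apply: (le_trans h); rewrite exprMn (expr2 rho) !mulrA [leRHS]mulrC.
  apply: ler_wpM2r; first exact: ltW.
  by move: rhoK; lra.
have BC : B * (C1 * rho) ^+ 2 <= rho / 2.
  have h : B * (C1 * rho) ^+ 2 <= C2 * (C1 * rho) ^+ 2.
    by rewrite ler_wpM2r ?exprn_ge0.
  apply: (le_trans h); rewrite exprMn (expr2 rho) !mulrA [leRHS]mulrC.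
  apply: ler_wpM2r; first exact: ltW.
  by move: rhoK; lra.
have AD d : 0 <= d -> A * (C1 * rho) * (C1 * d) <= d / 2.
  move=> d0; have -> : A * (C1 * rho) * (C1 * d) = (A * C1 ^+ 2 * rho) * d by ring.
  rewrite [leRHS]mulrC; apply: ler_wpM2r => //.
  apply: (@le_trans _ _ (C2 * C1 ^+ 2 * rho)); last lra.
  by rewrite !ler_wpM2r ?exprn_ge0 // ltW.
have BD d : 0 <= d -> B * (C1 * rho) * (C1 * d) <= d / 2.
  move=> d0; have -> : B * (C1 * rho) * (C1 * d) = (B * C1 ^+ 2 * rho) * d by ring.
  rewrite [leRHS]mulrC; apply: ler_wpM2r => //.
  apply: (@le_trans _ _ (C2 * C1 ^+ 2 * rho)); last lra.
  by rewrite !ler_wpM2r ?exprn_ge0 // ltW.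
have dd : C1 * 0 = 0 by rewrite mulr0.
have S f s : nu f <= rho -> nu s <= rho ->
   nu (fun x => D x + Q1 ((Z f s)^~ x)) <= rho /\ nu (fun x => Q2 ((Z f s)^~ x)) <= rho.
  move=> hf hs.
  have hz := Zb f s hf hs.
  have hz0 a : nu (fun x => Z f s a x - Z f s a x) <= 0.
    by under eq_fun do rewrite subrr; rewrite (an0 nuP).
  have [hA _] := HA X nu nuP _ _ _ _ C1r0 rhoC1 (lexx _) hz hz hz0.
  have [hB _] := HB X nu nuP _ _ _ _ C1r0 rhoC1 (lexx _) hz hz hz0.
  split; last by apply: (le_trans hB); lra.
  by apply: le_trans (anD nuP _ _) _; lra.
have bnd i : nu (p i).1 <= rho /\ nu (p i).2 <= rho.
  elim: i => [|i [IH1 IH2]] /=; first by rewrite (an0 nuP) ltW.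
  exact: S.
have dif i : nu (fun x => (p i.+1).1 x - (p i).1 x) <= rho / 2 ^+ i /\
        nu (fun x => (p i.+1).2 x - (p i).2 x) <= rho / 2 ^+ i.
  elim: i => [|i [IH1 IH2]].
    rewrite expr0 divr1; have [b1 b2] := bnd 1%N; split.
      by rewrite [X in nu X](_ : _ = (p 1%N).1) //; apply/funext => x; rewrite /= subr0.
    by rewrite [X in nu X](_ : _ = (p 1%N).2) //; apply/funext => x; rewrite /= subr0.
  have hd := Zd _ _ _ _ _ IH1 IH2.
  have [b1 b2] := bnd i; have [b1' b2'] := bnd i.+1.
  have q0 : 0 <= rho / 2 ^+ i by rewrite divr_ge0 ?ltW // exprn_ge0.
  have [_ hA] := HA X nu nuP _ _ _ _ C1r0 rhoC1 (mulr_ge0 (ltW C10) q0)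
    (Zb _ _ b1' b2') (Zb _ _ b1 b2) hd.
  have [_ hB] := HB X nu nuP _ _ _ _ C1r0 rhoC1 (mulr_ge0 (ltW C10) q0)
    (Zb _ _ b1' b2') (Zb _ _ b1 b2) hd.
  rewrite expr1 in hA; rewrite expr1 in hB.
  have E : rho / 2 ^+ i.+1 = (rho / 2 ^+ i) / 2.
    by rewrite exprS invfM [X in _ * X]mulrC mulrA.
  rewrite E; split; last exact: le_trans hB (BD _ q0).
  rewrite [X in nu X](_ : _ = (fun x => Q1 ((Z (p i.+1).1 (p i.+1).2)^~ x) -
     Q1 ((Z (p i).1 (p i).2)^~ x))); first exact: le_trans hA (AD _ q0).
  by apply/funext => x /=; ring.
by have [? ?] := bnd j; have [? ?] := dif j.
Qed.

End Iteration.

(** * Cutoff functions and periodisation *)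

Section UniformlySmooth.
Variable R : realType.

(** Bounds for the derivatives up to order [r], uniform in [j]. Later [j] is a scale together with a
    base point and the variable runs along a coordinate line. Derivatives are given as witnesses,
    which suits induction on [r]. *)
Fixpoint unif_smooth (r : nat) (J : Type) (F : J -> R -> R) : Prop :=
  (exists C : R, forall j t, `|F j t| <= C) /\
  (if r is r'.+1 then exists F' : J -> R -> R,
     (forall j t, is_derive (t : R) 1 (F j) (F' j t)) /\ unif_smooth r' F'
   else True).

Lemma unif_smooth_bound r J (F : J -> R -> R) : unif_smooth r F ->
  exists2 C : R, 0 <= C & forall j t, `|F j t| <= C.
Proof.
by case: r => [|r] [[C HC] _]; exists (Num.max 0 C);
  rewrite ?le_max ?lexx // => j t; rewrite le_max HC orbT.
Qed.

Lemma unif_smoothW r J (F : J -> R -> R) : unif_smooth r.+1 F -> unif_smooth r F.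
Proof.
elim: r J F => [|r IH] J F [bF [F' [dF uF]]]; split=> //.
by exists F'; split=> //; exact: IH.
Qed.

Lemma unif_smooth_reindex r J K (F : J -> R -> R) (p : K -> J) :
  unif_smooth r F -> unif_smooth r (fun k => F (p k)).
Proof.
elim: r F => [|r IH] F [[C HC] H]; split; try by exists C.
  by [].
by case: H => F' [dF uF]; exists (fun k => F' (p k)); split=> //; exact: IH.
Qed.

Lemma unif_smooth_cst r J (c : J -> R) (C : R) : (forall j, `|c j| <= C) ->
  unif_smooth r (fun j (_ : R) => c j).
Proof.
elim: r c C => [|r IH] c C HC; split; try by exists C.
  by [].
exists (fun _ _ => 0); split; first by move=> j t; exact: is_derive_cst.
by apply: (IH (fun=> 0) 0) => j; rewrite normr0.
Qed.

Lemma unif_smoothD r J (F G : J -> R -> R) : unif_smooth r F -> unif_smooth r G ->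
  unif_smooth r (fun j t => F j t + G j t).
Proof.
elim: r F G => [|r IH] F G [[C HC] HF] [[D HD] HG];
  (split; first by exists (C + D) => j t; apply: le_trans (ler_normD _ _) _; exact: lerD).
  by [].
case: HF HG => F' [dF uF] [G' [dG uG]].
exists (fun j t => F' j t + G' j t); split; last exact: IH.
by move=> j t; have := dF j t; have := dG j t => dg df; exact: is_deriveD.
Qed.

Lemma unif_smoothM r J (F G : J -> R -> R) : unif_smooth r F -> unif_smooth r G ->
  unif_smooth r (fun j t => F j t * G j t).
Proof.
elim: r F G => [|r IH] F G uF0 uG0; have := uF0; have := uG0;
 move=> [[D HD] HG] [[C HC] HF];
  (split; first by exists (C * D) => j t; rewrite normrM; apply: ler_pM).
  by [].
case: HF HG => F' [dF uF] [G' [dG uG]].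
exists (fun j t => F j t * G' j t + G j t * F' j t); split.
  by move=> j t; have := dF j t; have := dG j t => dg df; exact: is_deriveM.
by apply: unif_smoothD; apply: IH => //; apply: unif_smoothW.
Qed.

Lemma unif_smooth_comp r J (F G : J -> R -> R) : unif_smooth r F -> unif_smooth r G ->
  unif_smooth r (fun j t => F j (G j t)).
Proof.
elim: r F G => [|r IH] F G uF0 uG0; have := uF0; have := uG0;
 move=> [[D HD] HG] [[C HC] HF]; (split; first by exists C).
  by [].
case: HF HG => F' [dF uF] [G' [dG uG]].
exists (fun j t => F' j (G j t) * G' j t); split.
  by move=> j t; have := dF j (G j t); have := dG j t => dg df; exact: is_derive1_comp.
by apply: unif_smoothM => //; apply: IH => //; apply: unif_smoothW.
Qed.

Lemma is_derive_affine (f : R -> R) (a b t d : R) : is_derive (a * t + b) 1 f d ->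
  is_derive t 1 (fun s => f (a * s + b)) (d * a).
Proof.
move=> df; apply: (@is_derive1_comp _ f (fun s => a * s + b)) => //.
have h : is_derive t 1 ((a \*: (@id R)) + cst b) (a *: 1 + 0).
  by apply: is_deriveD.
by have := h; rewrite addr0 /GRing.scale /= mulr1.
Qed.

Lemma unif_smooth_affine r J (F : J -> R -> R) (a : R) (b : J -> R) : unif_smooth r F ->
  unif_smooth r (fun j t => F j (a * t + b j)).
Proof.
elim: r F => [|r IH] F [[C HC] HF]; (split; first by exists C).
  by [].
case: HF => F' [dF uF]; exists (fun j t => F' j (a * t + b j) * a); split.
  by move=> j t; apply: is_derive_affine; exact: dF.
apply: unif_smoothM; first exact: IH.
by apply: (@unif_smooth_cst _ _ _ `|a|).
Qed.

Lemma derive_locally0 (f : R -> R) (t d : R) :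
  (\forall s \near t, f s = 0) -> is_derive t 1 f d -> d = 0.
Proof.
by move=> f0 df; have [_ <-] := near_eq_is_derive f0 df; exact: derive_cst.
Qed.

Lemma near_gt1 (t : R) : 1 < `|t| -> \forall s \near t, 1 < `|s|.
Proof.
move=> t1; exists (`|t| - 1); first by rewrite /= subr_gt0.
move=> s /= ts; have := ler_distD s t 0; rewrite !subr0 => h.
by move: h ts; set a := `|t - s|; lra.
Qed.

Definition supported (J : Type) (F : J -> R -> R) := forall j t, 1 < `|t| -> F j t = 0.

Lemma supported_derive J (F F' : J -> R -> R) :
  (forall j t, is_derive (t : R) 1 (F j) (F' j t)) -> supported F -> supported F'.
Proof.
move=> dF sF j t t1; apply: derive_locally0 (dF j t).
by near=> s; apply: sF; near: s; exact: near_gt1.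
Unshelve. all: by end_near. Qed.

Lemma unif_smooth_mulid r J (F : J -> R -> R) : unif_smooth r F -> supported F ->
  unif_smooth r (fun j t => t * F j t).
Proof.
elim: r F => [|r IH] F uF0 sF; have := uF0; move=> [[C HC] HF];
  (split; first (exists C => j t; rewrite normrM;
   case: (lerP `|t| 1) => t1; last (by rewrite sF // normr0 mulr0 (le_trans _ (HC j t)));
   by apply: le_trans (HC j t); rewrite ler_piMl)).
  by [].
case: HF => F' [dF uF]; exists (fun j t => t * F' j t + F j t); split.
  move=> j t; have := is_deriveM (is_derive_id t 1) (dF j t).
  by rewrite /GRing.scale /= mulr1.
apply: unif_smoothD; last exact: unif_smoothW.
by apply: IH => //; exact: supported_derive dF sF.
Qed.

Definition mod2pi (t : R) : R := t - 2 * pi * (Num.floor (t / (2 * pi) + 2^-1))%:~R.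

Lemma mod2pi_small (t : R) : `|t| < 1 -> mod2pi t = t.
Proof.
move=> t1; rewrite /mod2pi; have p2 := pi_ge2 R.
suff -> : Num.floor (t / (2 * pi) + 2^-1) = 0 by rewrite mulr0 subr0.
apply: floor_def; rewrite add0r.
have h : `|t / (2 * pi)| <= 1 / 4.
  rewrite normrM normfV ler_pdivrMr ?normr_gt0 ?mulf_neq0 ?gt_eqF ?pi_gt0 //.
  rewrite (@ger0_norm _ (2 * pi)) ?mulr_ge0 ?pi_ge0 //; move: t1; set a := `|t|; lra.
by move: h; rewrite ler_norml => /andP[h1 h2]; apply/andP; split; lra.
Qed.

Lemma mod2pi_bound t : `|mod2pi t| <= pi.
Proof.
have p0 := pi_gt0 R.
have := floor_itv (t / (2 * pi) + 2^-1); rewrite /mod2pi.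
rewrite intrD; set q := (_ %:~R); move=> /andP[q1 q2].
have E : t = 2 * pi * (t / (2 * pi)).
  by move: (pi : R) p0 => p p0; field; exact: lt0r_neq0.
move: E q1 q2; set a := t / (2 * pi) => -> q1 q2; clearbody a q.
have h1 := ler_wpM2l (ltW p0) q1; have h2 := ler_wpM2l (ltW p0) (ltW q2).
by rewrite ler_norml; apply/andP; split; lra.
Qed.

Lemma mod2pi_periodic t : mod2pi (t + 2 * pi) = mod2pi t.
Proof.
have p0 := pi_gt0 R; rewrite /mod2pi.
have -> : (t + 2 * pi) / (2 * pi) + 2^-1 = (t / (2 * pi) + 2^-1) + 1%:~R.
  by move: (pi : R) p0 => p p0; field; exact: lt0r_neq0.
by rewrite floorDrz ?intr_int // intrKfloor rmorphD /=; ring.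
Qed.

Lemma mod2piE t : exists q : int, mod2pi t = t - 2 * pi * q%:~R.
Proof. by exists (Num.floor (t / (2 * pi) + 2^-1)). Qed.

(** [mod2pi] jumps only where F vanishes: if the integers chosen at t and at a nearby s differ, both
    arguments of F exceed 1 in absolute value, because pi >= 2. *)
Lemma mod2pi_near J (F : J -> R -> R) j (t : R) (q : int) : supported F ->
  mod2pi t = t - 2 * pi * q%:~R ->
  \forall s \near t, F j (1 * s + (- (2 * pi * q%:~R))) = F j (mod2pi s).
Proof.
move=> sF Eq; have p2 := pi_ge2 R.
near=> s; rewrite mul1r; have [q' Eq'] := mod2piE s.
have [->|ne] := eqVneq q q'; first by rewrite -Eq'.
have ts : `|t - s| < 1 by near: s; exists 1 => /=.
have b1 := mod2pi_bound t; have b2 := mod2pi_bound s.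
have D : 1 <= `|q%:~R - q'%:~R : R|.
  by rewrite -rmorphB -intr_norm /= -[1]/(1%:~R) ler_int -gtz0_ge1 normr_gt0 subr_eq0.
have g1 : 1 < `|s - 2 * pi * q%:~R|.
  have h : mod2pi s = (s - 2 * pi * q%:~R) + 2 * pi * (q%:~R - q'%:~R) by rewrite Eq'; ring.
  have : `|2 * pi * (q%:~R - q'%:~R)| <= `|mod2pi s| + `|s - 2 * pi * q%:~R|.
    by rewrite (_ : 2 * pi * _ = mod2pi s - (s - 2 * pi * q%:~R)) ?ler_normB // h; ring.
  rewrite normrM ger0_norm; last lra.
  set a := `|_ - _ : R| in D *; set b := `|mod2pi s| in b2 *; set c := `|_ - _|.
  by clearbody a b c; nra.
have g2 : 1 < `|mod2pi s|.
  have h : mod2pi s = mod2pi t + (s - t) + 2 * pi * (q%:~R - q'%:~R) by rewrite Eq' Eq; ring.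
  have : `|2 * pi * (q%:~R - q'%:~R)| <= `|mod2pi s| + `|mod2pi t| + `|t - s|.
    rewrite (_ : 2 * pi * _ = mod2pi s - mod2pi t + (t - s)); last by rewrite h; ring.
    by apply: le_trans (ler_normD _ _) _; rewrite lerD2r ler_normB.
  rewrite normrM ger0_norm; last lra.
  move: D b1 ts; set a := `|_ - _ : R|; set b := `|mod2pi s|; set c := `|_ - _|.
  set e := `|mod2pi t|.
  clearbody a b c e => D b1 ts.
  by nra.
by rewrite !sF.
Unshelve. all: by end_near. Qed.

Lemma unif_smooth_mod2pi r J (F : J -> R -> R) : unif_smooth r F -> supported F ->
  unif_smooth r (fun j t => F j (mod2pi t)).
Proof.
elim: r F => [|r IH] F [[C HC] HF] sF; (split; first by exists C).
  by [].
case: HF => F' [dF uF]; exists (fun j t => F' j (mod2pi t)); split; last first.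
  by apply: IH => //; exact: supported_derive dF sF.
move=> j t; have [q Eq] := mod2piE t.
apply: near_eq_is_derive (mod2pi_near j sF Eq) _.
have := @is_derive_affine (F j) 1 (- (2 * pi * q%:~R)) t _ (dF j _).
by rewrite mulr1 mul1r -Eq.
Qed.
End UniformlySmooth.

(** Differentiability from a quadratic remainder bound. Such inequalities survive pointwise limits,
    which is how derivatives of limits are obtained. *)
Lemma is_derive_quad (R : realType) (V : normedModType R) (f : V -> R) (a v : V) (d C : R) :
  (forall h, `|h| <= 1 -> `|f (h *: v + a) - f a - h * d| <= C * h ^+ 2) -> is_derive a v f d.
Proof.
move=> H.
have cv : h^-1 *: ((f \o shift a) (h *: v) - f a) @[h --> (0 : R)^'] --> d.
  apply/subr_cvg0; apply: (@cvg_to_0_linear _ _ C 1) => // h /andP[h0 h1].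
  have hn : h != 0 by rewrite -normr_gt0.
  have -> : h^-1 *: ((f \o shift a) (h *: v) - f a) - d =
    (f (h *: v + a) - f a - h * d) / h.
    by rewrite /GRing.scale /=; field.
  rewrite normrM normfV ler_pdivrMr //; apply: le_trans (H h (ltW h1)) _.
  by rewrite -real_normK ?num_real // expr2 mulrA.
split; first by apply/cvg_ex; exists d.
exact: cvg_lim cv.
Qed.

(** * A smooth plateau and the periodic coordinate *)

Section Flat.
Variable R : realType.

(** The polynomial factor makes the class of exp (-1/t) stable under derivation, so all orders are
    handled by one induction. *)
Definition flat (P : {poly R}) (t : R) : R :=
  if 0 < t then P.[t^-1] * expR (- t^-1) else 0.

Lemma powexp_bound j : exists C : R, forall s : R, 0 <= s -> `|s ^+ j * expR (- s)| <= C.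
Proof.
case: j => [|j].
  exists 1 => s s0; rewrite mul1r ger0_norm ?expR_ge0 // -expR0 ler_expR; lra.
exists (j.+1)`!%:R => s s0.
rewrite ger0_norm ?mulr_ge0 ?exprn_ge0 ?expR_ge0 // expRN ler_pdivrMr ?expR_gt0 //.
have := expR_ge1Dxn j s0; have f0 : (0 : R) < (j.+1)`!%:R by rewrite ltr0n fact_gt0.
set e := expR s => h; have : s ^+ j.+1 / (j.+1)`!%:R <= e by lra.
by rewrite ler_pdivrMr // mulrC.
Qed.

Lemma polyexp_bound (P : {poly R}) :
  exists C : R, forall s : R, 0 <= s -> `|P.[s] * expR (- s)| <= C.
Proof.
suff : forall j, exists C : R, forall s : R, 0 <= s -> `|P.[s] * s ^+ j * expR (- s)| <= C.
  by move=> /(_ 0%N)[C HC]; exists C => s /HC; rewrite mulr1.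
elim/poly_ind: P => [|P c IH] j.
  by exists 0 => s s0; rewrite horner0 !mul0r normr0.
have [C HC] := IH j.+1; have [D HD] := powexp_bound j.
exists (C + `|c| * D) => s s0; rewrite hornerMXaddC.
have -> : (P.[s] * s + c) * s ^+ j * expR (- s) =
  P.[s] * s ^+ j.+1 * expR (- s) + c * (s ^+ j * expR (- s)) by rewrite exprS; ring.
apply: le_trans (ler_normD _ _) _; rewrite lerD ?HC // normrM.
by rewrite ler_wpM2l // HD.
Qed.

Lemma flat_bound P : exists C : R, forall t, `|flat P t| <= C.
Proof.
have [C HC] := polyexp_bound P; exists C => t; rewrite /flat.
case: ifP => t0; first by apply: HC; rewrite invr_ge0 ltW.
by rewrite normr0; apply: le_trans (HC 0 (lexx _)).
Qed.

Lemma flat_sq P t : flat P t = t ^+ 2 * flat ('X^2 * P) t.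
Proof.
rewrite /flat; case: ifP => t0; last by rewrite mulr0.
by rewrite hornerM hornerXn; field; rewrite gt_eqF.
Qed.

Lemma is_derive_flat P (t : R) : is_derive t 1 (flat P) (flat ('X^2 * (P - P^`())) t).
Proof.
case: (ltrgtP t 0) => [t0|t0|->].
- have -> : flat ('X^2 * (P - P^`())) t = 0 by rewrite /flat ltNge ltW.
  apply: (@near_eq_is_derive _ _ _ (cst (0 : R))).
  near=> s; rewrite /flat ifN // -leNgt ltW //; near: s.
  exact: lt_nbhsl.
- have tn : t != 0 by rewrite gt_eqF.
  have -> : flat ('X^2 * (P - P^`())) t =
     P.[t^-1] * (expR (- t^-1) * t^-1 ^+ 2) + expR (- t^-1) * (P^`().[t^-1] * (- t^-1 ^+ 2)).
    by rewrite /flat t0 !hornerE /=; ring.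
  have dV : is_derive t 1 (fun s : R => s^-1) (- t^-1 ^+ 2).
    have := is_deriveV tn (is_derive_id t (1 : R)).
    by rewrite /GRing.scale /= mulr1 exprVn.
  have dN : is_derive t 1 (fun s : R => - s^-1) (t^-1 ^+ 2).
    have := is_deriveN dV; by rewrite opprK.
  have dE : is_derive t 1 (fun s : R => expR (- s^-1)) (expR (- t^-1) * t^-1 ^+ 2).
    by apply: (@is_derive1_comp _ expR (fun s => - s^-1)) => //; exact: is_derive_expR.
  have dP : is_derive t 1 (fun s : R => P.[s^-1]) (P^`().[t^-1] * (- t^-1 ^+ 2)).
    by apply: (@is_derive1_comp _ (horner P) (fun s => s^-1)) => //; exact: is_derive_poly.
  apply: near_eq_is_derive (is_deriveM dP dE).
  near=> s; rewrite /flat ifT //; near: s; exact: lt_nbhsr.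
- have -> : flat ('X^2 * (P - P^`())) 0 = 0 by rewrite /flat ltxx.
  (* At 0, [flat_sq] extracts a factor t^2 with a bounded cofactor, so the derivative there is 0. *)
  have [C HC] := flat_bound ('X^2 * P).
  apply: (@is_derive_quad _ _ _ _ _ _ C) => h _.
  rewrite mulr0 subr0 {2}/flat ltxx subr0 addr0 /GRing.scale /= mulr1 flat_sq.
  by rewrite normrM normrX real_normK ?num_real // mulrC ler_wpM2r // sqr_ge0.
Unshelve. all: by end_near. Qed.

Lemma unif_smooth_flat r J (P : {poly R}) : unif_smooth r (fun (_ : J) => flat P).
Proof.
elim: r P => [|r IH] P; (split; first by have [C HC] := flat_bound P; exists C).
  by [].
exists (fun _ => flat ('X^2 * (P - P^`()))); split=> // _ t.
exact: is_derive_flat.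
Qed.

Local Notation h := (flat 1).

Lemma flat1_ge0 t : 0 <= h t.
Proof. by rewrite /flat; case: ifP => // _; rewrite hornerC mul1r expR_ge0. Qed.

Lemma flat1_gt0 t : 0 < t -> 0 < h t.
Proof. by move=> t0; rewrite /flat t0 hornerC mul1r expR_gt0. Qed.

Lemma flat_npos P t : t <= 0 -> flat P t = 0.
Proof. by move=> t0; rewrite /flat ltNge t0. Qed.

Lemma flat1_le s t : s <= t -> h s <= h t.
Proof.
move=> st; case: (ltrP 0 s) => s0; last by rewrite (flat_npos _ s0) flat1_ge0.
have t0 := lt_le_trans s0 st.
by rewrite /flat s0 t0 !hornerC !mul1r ler_expR lerN2 lef_pV2.
Qed.

(* The plateau is obtained by composition: the inner sum vanishes on
   [-1/2, 1/2] and exceeds flat 1 (1/2) as soon as |t| > 1. *)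
Definition plateau (t : R) : R :=
  h (h 2^-1 - (h (t - 2^-1) + h (- t - 2^-1))) / h (h 2^-1).

Lemma plateau_supp t : 1 < `|t| -> plateau t = 0.
Proof.
move=> t1; rewrite /plateau flat_npos ?mul0r // subr_le0.
move: t1; rewrite lter_normr => /orP[] t1.
  by rewrite -[leLHS]addr0 lerD ?flat1_ge0 // flat1_le; lra.
by rewrite -[leLHS]add0r lerD ?flat1_ge0 // flat1_le; lra.
Qed.

Lemma plateau1 t : `|t| <= 2^-1 -> plateau t = 1.
Proof.
rewrite ler_norml => /andP[t1 t2].
rewrite /plateau (flat_npos _ (_ : t - 2^-1 <= 0)); last lra.
rewrite (flat_npos _ (_ : - t - 2^-1 <= 0)); last lra.
by rewrite addr0 subr0 divff // gt_eqF // !flat1_gt0.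
Qed.

Lemma unif_smooth_plateau r J : unif_smooth r (fun (_ : J) => plateau).
Proof.
have A a b : unif_smooth r (fun (_ : J) t => h (a * t + b)).
  by apply: (@unif_smooth_affine _ _ _ (fun=> h)); exact: unif_smooth_flat.
have C c : unif_smooth r (fun (_ : J) (_ : R) => c).
  exact: (@unif_smooth_cst _ _ _ _ `|c|).
have B : unif_smooth r (fun (_ : J) t => h 2^-1 + (-1) * (h (1 * t + - 2^-1) + h ((-1) * t + - 2^-1))).
  by apply: unif_smoothD => //; apply: unif_smoothM => //; apply: unif_smoothD.
have := unif_smoothM (unif_smooth_comp (unif_smooth_flat r J 1) B) (C (h (h 2^-1))^-1).
congr unif_smooth; apply/funext => j; apply/funext => t.
by rewrite /plateau mul1r !mulN1r.
Qed.

(** Smooth, 2 pi periodic and equal to t on [-1/2, 1/2]: it transplants coordinates, and functions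
    of them, to the torus. *)
Definition pcoord (t : R) : R := mod2pi t * plateau (mod2pi t).

Lemma unif_smooth_pcoord r J : unif_smooth r (fun (_ : J) => pcoord).
Proof.
apply: (@unif_smooth_mod2pi _ _ _ (fun _ t => t * plateau t)).
  apply: unif_smooth_mulid; first exact: unif_smooth_plateau.
  by move=> j t; exact: plateau_supp.
by move=> j t t1; rewrite plateau_supp ?mulr0.
Qed.

Lemma pcoord_periodic t : pcoord (t + 2 * pi) = pcoord t.
Proof. by rewrite /pcoord mod2pi_periodic. Qed.

Lemma pcoord_id t : `|t| <= 2^-1 -> pcoord t = t.
Proof.
move=> t1; rewrite /pcoord mod2pi_small; last by apply: (le_lt_trans t1); lra.
by rewrite plateau1 ?mulr1.
Qed.
End Flat.

Section Differences.
Variable R : realType.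

(** Second differences, because they act diagonally on the kernels [cas]; a first difference would
    mix cas t with cas (-t). *)
Definition sdiff (h : R) (g : R -> R) : R -> R := fun t => g (t + h) - 2 * g t + g (t - h).

Lemma is_derive_translate (g : R -> R) (b t d : R) : is_derive (t + b) 1 g d ->
  is_derive t 1 (fun s => g (s + b)) d.
Proof.
move=> dg; have := @is_derive_affine _ g 1 b t d; rewrite mul1r mulr1 => /(_ dg).
by congr is_derive; apply/funext => s; rewrite mul1r.
Qed.

Lemma is_derive_sdiff h (g g' : R -> R) : (forall t : R, is_derive t 1 g (g' t)) ->
  forall t : R, is_derive t 1 (sdiff h g) (sdiff h g' t).
Proof.
move=> dg t.
have h1 := is_derive_translate (dg (t + h)); have h2 := is_derive_translate (dg (t - h)).
have h3 := is_deriveZ (2 : R) (dg t).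
exact: is_deriveD (is_deriveB h1 h3) h2.
Qed.

Lemma is_derive_iter_sdiff h r (g g' : R -> R) : (forall t : R, is_derive t 1 g (g' t)) ->
  forall t : R, is_derive t 1 (iter r (sdiff h) g) (iter r (sdiff h) g' t).
Proof. by move=> dg; elim: r => //= r IH; exact: is_derive_sdiff. Qed.

Lemma mvt_bound (g g' : R -> R) (B : R) : (forall t : R, is_derive t 1 g (g' t)) ->
  (forall t, `|g' t| <= B) -> forall a h, 0 <= h -> `|g (a + h) - g a| <= B * h.
Proof.
move=> dg bg a h h0.
have ah : a <= a + h by rewrite lerDl.
have [|c _ ->] := MVT_segment ah (fun x _ => dg x).
  apply: continuous_subspaceT => x; apply: differentiable_continuous.
  by apply/derivable1_diffP; have [] := dg x.
by rewrite (addrC a) addrK normrM (ger0_norm h0) ler_wpM2r.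
Qed.

Lemma sdiff_bound (g g' g'' : R -> R) (B : R) :
  (forall t : R, is_derive t 1 g (g' t)) -> (forall t : R, is_derive t 1 g' (g'' t)) ->
  (forall t, `|g'' t| <= B) -> forall h t, 0 <= h -> `|sdiff h g t| <= B * h ^+ 2.
Proof.
move=> dg dg' bg h t h0.
pose D s := g (s + h) - g s.
have dD (s : R) : is_derive s 1 D (g' (s + h) - g' s).
  by have h1 := is_derive_translate (dg (s + h)); exact: is_deriveB h1 (dg s).
have := mvt_bound dD (fun s => mvt_bound dg' bg s h0) (t - h) h0.
rewrite /D subrK expr2 mulrA; congr (`|_| <= _); rewrite /sdiff; ring.
Qed.

Lemma iter_sdiff_bound r J (F : J -> R -> R) : unif_smooth r.*2 F ->
  exists2 C : R, 0 <= C & forall j t h, 0 <= h ->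
    `|iter r (sdiff h) (F j) t| <= C * h ^+ r.*2.
Proof.
elim: r F => [|r IH] F.
  by move=> /unif_smooth_bound[C C0 HC]; exists C => // j t h h0; rewrite double0 expr0 mulr1 /=.
rewrite doubleS => -[_ [F' [dF [_ [F'' [dF' uF'']]]]]].
have [C C0 HC] := IH _ uF''; exists C => // j t h h0.
have -> : C * h ^+ (r.*2).+2 = C * h ^+ r.*2 * h ^+ 2.
  by rewrite -mulrA -exprD addn2.
rewrite /=; apply: (sdiff_bound _ _ _ _ h0) => s.
- exact: is_derive_iter_sdiff (dF j) s.
- exact: is_derive_iter_sdiff (dF' j) s.
- exact: HC h0.
Qed.

End Differences.

(** * Decay of the discrete coefficients of smooth data *)

Section SineLowerBound.
Variable R : realType.

(** On [0, 1] the mean value theorem gives slope at least cos 1. On [1, pi/2] monotonicity gives sin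
    u >= sin 1 >= cos 1, and u < 2 accounts for the halving. *)
Lemma sin_lower (u : R) : 0 <= u <= pi / 2 -> cos 1 / 2 * u <= sin u.
Proof.
move=> /andP[u0 u2]; have c1 := @cos1_gt0 R; have p2 := pihalf_lt2 R.
have p1 := pihalf_ge1 R.
have dsin (x : R) : is_derive x 1 sin (cos x) by exact: is_derive_sin.
have key (v : R) : 0 <= v <= 1 -> cos 1 * v <= sin v.
  move=> /andP[v0 v1].
  have [|c] := @MVT_segment R sin cos 0 v v0 (fun x _ => dsin x).
    by apply: continuous_subspaceT => x; exact: continuous_sin.
  rewrite in_itv /= sin0 !subr0 => /andP[c0 cv] ->.
  rewrite ler_wpM2r //.
  have [->|cn1] := eqVneq c 1; first by [].
  apply: ltW; rewrite ltr_cos ?in_itv /= ?c0 ?ler01 //=.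
  - by rewrite lt_neqAle cn1 (le_trans cv v1).
  - by apply: le_trans (le_trans cv v1) _; lra.
  - by lra.
case: (lerP u 1) => u1.
  apply: le_trans (key u _); last by rewrite u0 u1.
  by rewrite ler_wpM2r //; lra.
have s1 := key 1; rewrite ler01 lexx mulr1 in s1.
apply: (@le_trans _ _ (sin 1)); last first.
  apply: ltW; rewrite ltr_sin ?in_itv //=; apply/andP; split; lra.
by apply: le_trans (s1 isT); nra.
Qed.

Lemma cos_gap (t : R) : `|t| <= pi -> (cos 1 / 2 * t) ^+ 2 <= 2 - 2 * cos t.
Proof.
move=> tp.
have E : 2 - 2 * cos t = 4 * sin (`|t| / 2) ^+ 2.
  have h : cos t = cos ((`|t| / 2) *+ 2) by rewrite mulr2n -splitr cos_norm.
  by rewrite h cos_mulr2n cos2sin2; ring.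
have t2 : 0 <= `|t| / 2 <= pi / 2 by rewrite divr_ge0 //= ler_pM2r.
have := sin_lower t2; have c1 := @cos1_gt0 R.
have a0 : 0 <= cos 1 / 2 * (`|t| / 2) by rewrite !mulr_ge0 ?invr_ge0 // ltW.
move=> h; have h2 : (cos 1 / 2 * (`|t| / 2)) ^+ 2 <= sin (`|t| / 2) ^+ 2.
  by rewrite lerXn2r // nnegrE // (le_trans a0).
rewrite E; move: h2; rewrite !exprMn real_normK ?num_real //.
by move: (sin _ ^+ 2) => q h2; lra.
Qed.
End SineLowerBound.

Section CoefDecay.
Variables (R : realType) (n M : nat).
Local Notation N := (M.*2.+1).
Local Notation h := (2 * pi / N%:R : R).
Local Notation grid := (grid n M).
Local Notation e i := (delta_mx 0 i : 'rV[R]_n).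

Definition gpt (x : grid) : 'rV[R]_n := \row_i (h * (cen x i)%:~R).

Definition gunshift (i : 'I_n) (x : grid) : grid :=
  [ffun j => if j == i then ord_pred (x j) else x j].

Lemma gunshiftK i : cancel (gunshift i) (@gshift n M i).
Proof.
by move=> x; apply/ffunP => j; rewrite !ffunE; case: eqP => // _; rewrite ord_predK.
Qed.

Lemma gshiftK i : cancel (@gshift n M i) (gunshift i).
Proof.
by move=> x; apply/ffunP => j; rewrite !ffunE; case: eqP => // _; rewrite ordSK.
Qed.

Definition gdiff (i : 'I_n) (g : grid -> R) (x : grid) : R :=
  g (gshift i x) - 2 * g x + g (gunshift i x).

Definition vdiff (t : R) (i : 'I_n) (f : 'rV[R]_n -> R) (y : 'rV[R]_n) : R :=
  f (y + t *: e i) - 2 * f y + f (y - t *: e i).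

Definition periodic2pi (f : 'rV[R]_n -> R) :=
  forall i y, f (y + (2 * pi) *: e i) = f y.

Lemma periodic2piz f i y (z : int) : periodic2pi f -> f (y + (2 * pi * z%:~R) *: e i) = f y.
Proof.
move=> P.
have Pn (m : nat) y' : f (y' + (2 * pi * m%:R) *: e i) = f y'.
  elim: m y' => [|m IH] y'; first by rewrite mulr0 scale0r addr0.
  by rewrite -[m.+1%:R]natr1 mulrDr mulr1 scalerDl addrA P IH.
case: z => m; first exact: Pn.
by rewrite NegzE mulrNz mulrN scaleNr -[LHS](Pn m.+1) subrK.
Qed.

Lemma vdiff_periodic t i f : periodic2pi f -> periodic2pi (vdiff t i f).
Proof.
move=> P j y; have E v : y + (2 * pi) *: e j + v = y + v + (2 * pi) *: e j.
  by rewrite addrAC.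
by rewrite /vdiff !E !P.
Qed.

Lemma gpt_gshift i x : exists z : int,
  gpt (gshift i x) = gpt x + h *: e i + (2 * pi * z%:~R) *: e i.
Proof.
have [b Hb] := cen_ordS (x i); exists (- b%:Z).
apply/rowP => j; rewrite !mxE eqxx /=; have hN := @natN_neq0 R M.
case: (eqVneq j i) => [->|ji]; last first.
  by rewrite /cen !ffunE (negPf ji) !mulr0 !addr0.
have -> : cen (gshift i x) i = cen x i + 1 - b%:Z * N%:Z.
  by rewrite /cen ffunE eqxx Hb; ring.
rewrite !rmorphD /= !rmorphN /= !rmorphM /= -[(N%:Z)%:~R]/(N%:R : R).
move: (pi : R) (N%:R : R) hN => p q hN.
by field.
Qed.

(** Periodicity of [f] absorbs the wrap-around of the cyclic shift. *)
Lemma gdiff_vdiff f i x : periodic2pi f ->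
  gdiff i (fun x => f (gpt x)) x = vdiff h i f (gpt x).
Proof.
move=> P; rewrite /gdiff /vdiff; congr (_ - _ + _).
  by have [z ->] := gpt_gshift i x; rewrite periodic2piz.
have [z] := gpt_gshift i (gunshift i x); rewrite gunshiftK => ->.
by rewrite addrAC addrK periodic2piz.
Qed.

Lemma iter_gdiff f i r : periodic2pi f ->
  iter r (gdiff i) (fun x => f (gpt x)) = fun x => iter r (vdiff h i) f (gpt x).
Proof.
move=> P; have Pr q : periodic2pi (iter q (vdiff h i) f).
  by elim: q => //= q; exact: vdiff_periodic.
elim: r => //= r ->; apply/funext => x; exact: gdiff_vdiff.
Qed.

Lemma iter_vdiff f i r t y s : iter r (vdiff t i) f (y + s *: e i) =
  iter r (sdiff t) (fun s => f (y + s *: e i)) s.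
Proof.
elim: r s => //= r IH s; rewrite /vdiff /sdiff -!IH.
by rewrite scalerBl scalerDl !addrA.
Qed.

(** Summation by parts moves the shifts onto the kernel, where cas (t + a) + cas (t - a) = 2 cos a
    cas t. *)
Lemma coef_gdiff i (g : grid -> R) m :
  coef (gdiff i g) m = - (2 - 2 * cos (h * (cen m i)%:~R)) * coef g m.
Proof.
rewrite /coef mulrCA; congr (_ * _).
have S1 : \sum_x g (gshift i x) * ch R (cen m) x = \sum_x g x * ch R (cen m) (gunshift i x).
  rewrite (reindex (gunshift i)) /=.
    by apply: eq_bigr => x _; rewrite gunshiftK.
  by exists (gshift i) => x _; rewrite ?gunshiftK ?gshiftK.
have S2 : \sum_x g (gunshift i x) * ch R (cen m) x = \sum_x g x * ch R (cen m) (gshift i x).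
  rewrite (reindex (gshift i)) /=.
    by apply: eq_bigr => x _; rewrite gshiftK.
  by exists (gunshift i) => x _; rewrite ?gunshiftK ?gshiftK.
under eq_bigr do rewrite /gdiff mulrDl mulrBl.
rewrite big_split sumrB /= S1 S2 -sumrB -big_split mulr_sumr; apply: eq_bigr => x _ /=.
have [z E1] := phase_gshift R (cen m) i x.
have [z' E2] := phase_gshift R (cen m) i (gunshift i x).
rewrite gunshiftK in E2.
have -> : ch R (cen m) (gshift i x) = cas (phase R (cen m) x + h * (cen m i)%:~R).
  by rewrite /ch E1 cas_periodz.
have -> : ch R (cen m) (gunshift i x) = cas (phase R (cen m) x - h * (cen m i)%:~R).
  rewrite /ch -[LHS](cas_periodz _ z') E2; congr cas; ring.
by rewrite /ch /cas !cosD !sinD cosN sinN; ring.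
Qed.

Lemma coef_le_sup (g : grid -> R) (B : R) m : (forall x, `|g x| <= B) -> `|coef g m| <= 2 * B.
Proof.
move=> H; rewrite /coef normrM normfV (ger0_norm (ler0n _ _)).
have c0 : 0 < (#|{: grid}|%:R : R) by rewrite lt0r card_grid_neq0 ler0n.
rewrite mulrC ler_pdivrMr // mulr_natr -sumr_const.
apply: le_trans (ler_norm_sum _ _ _) _; apply: ler_sum => x _.
by rewrite normrM mulrC ler_pM // cas_le2.
Qed.

Lemma coef_iter_gdiff i (g : grid -> R) m r : coef (iter r (gdiff i) g) m =
  (- (2 - 2 * cos (h * (cen m i)%:~R))) ^+ r * coef g m.
Proof.
elim: r => [|r IH]; first by rewrite mul1r.
by rewrite iterS coef_gdiff IH exprS mulrA.
Qed.

(** By [cos_gap] the multiplier of the r-fold second difference is at least (cos 1 / 2 times h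
    |m_i|)^(2r), while the difference itself is at most C h^(2r). The powers of h cancel, so the
    decay is uniform in M. *)
Lemma coef_decay1 f i r (C : R) m : periodic2pi f ->
  (forall y t, 0 <= t -> `|iter r (sdiff t) (fun s => f (y + s *: e i)) 0| <= C * t ^+ r.*2) ->
  `|coef (fun x => f (gpt x)) m| * `|(cen m i)%:~R| ^+ r.*2 <= 2 * C / (cos 1 / 2) ^+ r.*2.
Proof.
move=> P H.
have p0 := pi_gt0 R; have N0 : 0 < (N%:R : R) by rewrite ltr0n.
have h0 : 0 < h by rewrite divr_gt0 // mulr_gt0.
have B x : `|iter r (gdiff i) (fun x => f (gpt x)) x| <= C * h ^+ r.*2.
  rewrite iter_gdiff //; have := H (gpt x) h (ltW h0).
  by rewrite -iter_vdiff scale0r addr0.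
have := coef_le_sup m B; rewrite coef_iter_gdiff normrM normrX normrN.
set q := (cen m i)%:~R : R.
have hq : `|h * q| <= pi.
  rewrite normrM (gtr0_norm h0) mulrAC ler_pdivrMr // /q -intr_norm /=.
  have := cen_bound m i; rewrite -(ler_int R) => hb.
  have -> : (N%:R : R) = 2 * (M%:Z)%:~R + 1.
    by rewrite -natr1 -mul2n natrM.
  have MM : (0 : R) <= (M%:Z)%:~R by rewrite ler0z.
  by move: hb MM; move: (_%:~R) ((M%:Z)%:~R) => a b hb MM; nra.
have gap := cos_gap hq; have c1 := @cos1_gt0 R.
have g0 : 0 <= 2 - 2 * cos (h * q) by apply: le_trans gap; rewrite sqr_ge0.
rewrite (ger0_norm g0) => K.
have K2 : (cos 1 / 2 * (h * q)) ^+ r.*2 <= (2 - 2 * cos (h * q)) ^+ r.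
  by rewrite -(mul2n r) exprM lerXn2r // nnegrE sqr_ge0.
have K3 : (cos 1 / 2 * (h * q)) ^+ r.*2 * `|coef (fun x => f (gpt x)) m| <= 2 * (C * h ^+ r.*2).
  by apply: le_trans K; rewrite ler_wpM2r.
have Eq : `|q| ^+ r.*2 = q ^+ r.*2 by rewrite -(mul2n r) !exprM real_normK ?num_real.
rewrite Eq ler_pdivlMr ?exprn_gt0 ?divr_gt0 //.
rewrite -(ler_pM2r (exprn_gt0 r.*2 h0)); apply: le_trans (_ : _ <= 2 * (C * h ^+ r.*2)) _.
  by apply: le_trans K3; rewrite !exprMn; lra.
by rewrite mulrA.
Qed.

End CoefDecay.

(** * Wiener norms of sampled periodic data, uniformly in the grid *)

Section DataNorm.
Variables (R : realType) (n : nat) (T : Type) (f : T -> 'rV[R]_n -> R).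
Local Notation e i := (delta_mx 0 i : 'rV[R]_n).

Hypothesis n0 : (0 < n)%N.
Hypothesis fper : forall tau, periodic2pi (f tau).
Hypothesis fsm : forall i r, unif_smooth r
  (fun (p : T * 'rV[R]_n) t => f p.1 (p.2 + t *: e i)).

Definition sample M tau : grid n M -> R := fun x => f tau (gpt R x).

(** Decay is known for pure powers of single frequencies only. With a common bound b of 1 and the
    a_i, attained by one of them, the left side is at most ((1 + n) b)^s. *)
Lemma wt1_le (s : nat) (a : 'I_n -> R) : (forall i, 0 <= a i) ->
  (1 + \sum_i a i) ^+ s <= (1 + n%:R) ^+ s * (1 + \sum_i a i ^+ s.*2).
Proof.
move=> a0.
have [b [b1 ab bs]] : exists b : R, [/\ 1 <= b, forall i, i \in index_enum 'I_n -> a i <= b &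
    b ^+ s <= 1 + \sum_(i <- index_enum 'I_n) a i ^+ s.*2].
  elim: (index_enum _) => [|i l [b [b1 ab bs]]].
    by exists 1; rewrite big_nil addr0 expr1n lexx.
  have q0 : 0 <= \sum_(j <- l) a j ^+ s.*2 by apply: sumr_ge0 => j _; rewrite exprn_ge0.
  have p0 : 0 <= a i ^+ s.*2 by rewrite exprn_ge0.
  case: (lerP (a i) b) => aib.
    exists b; split=> // [j|]; last by rewrite big_cons; apply: (le_trans bs); lra.
    by rewrite inE => /orP[/eqP->|/ab].
  have ai1 : 1 <= a i by apply: (le_trans b1); exact: ltW.
  exists (a i); split=> // [j|].
    by rewrite inE => /orP[/eqP->|/ab h] //; apply: (le_trans h); exact: ltW.
  have : a i ^+ s <= a i ^+ s.*2 by rewrite ler_weXn2l // -addnn leq_addr.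
  by rewrite big_cons; move: q0; lra.
have b0 : 0 <= b by lra.
have nn0 : 0 <= (n%:R : R) by [].
apply: (@le_trans _ _ (((1 + n%:R) * b) ^+ s)).
  rewrite lerXn2r ?nnegrE ?mulr_ge0 ?addr_ge0 ?sumr_ge0 //.
  rewrite mulrDl mul1r; apply: lerD => //.
  have -> : n%:R * b = \sum_(i < n) b by rewrite sumr_const card_ord mulr_natl.
  apply: ler_sum => i _.
  by apply: ab; rewrite mem_index_enum.
by rewrite exprMn ler_wpM2l // exprn_ge0 // addr_ge0.
Qed.

Lemma coef_decay s : exists2 B : R, 0 <= B & forall M tau m,
  `|coef (@sample M tau) m| * wt 1 s (cen m) <= B.
Proof.
have H i : exists C, 0 <= C /\ forall (p : T * 'rV[R]_n) t h, 0 <= h ->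
    `|iter s (sdiff h) (fun t => f p.1 (p.2 + t *: e i)) t| <= C * h ^+ s.*2.
  by have [C C0 HC] := iter_sdiff_bound (fsm i s.*2); exists C.
have [C HC] := fin_all_exists H.
have [K [K0 HK]] : exists K : R, 0 <= K /\ forall M tau m, `|coef (@sample M tau) m| <= K.
  have [K K0 HK] := unif_smooth_bound (fsm (Ordinal n0) 0).
  exists (2 * K); split=> [|M tau m]; first by rewrite mulr_ge0.
  apply: coef_le_sup => x; have := HK (tau, gpt R x) 0.
  by rewrite /= scale0r addr0.
exists ((1 + n%:R) ^+ s * (K + \sum_i 2 * C i / (cos 1 / 2) ^+ s.*2)).
  have c1 := @cos1_gt0 R.
  rewrite mulr_ge0 ?exprn_ge0 ?addr_ge0 // sumr_ge0 // => i _.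
  rewrite !mulr_ge0 ?(HC i).1 // invr_ge0 exprn_ge0 // divr_ge0 // ltW //.
move=> M tau m.
have := @wt1_le s (fun i => `|(cen m i)%:~R|) (fun i => normr_ge0 _) => W.
rewrite /wt mul1r; apply: le_trans (ler_wpM2l (normr_ge0 _) W) _.
rewrite mulrCA ler_wpM2l ?exprn_ge0 ?addr_ge0 // mulrDr mulr1.
apply: lerD; first exact: HK.
rewrite mulr_sumr; apply: ler_sum => i _.
apply: coef_decay1; first exact: fper.
by move=> y t t0; have [_ h] := HC i; exact: (h (tau, y)).
Qed.

Lemma sum_sqr_inv M : \sum_(j < M.*2.+1) (1 + ((((j : nat)%:Z - M%:Z)%:~R : R)) ^+ 2)^-1 <= 5.
Proof.
pose F (k : nat) : R := (1 + (k%:R : R) ^+ 2)^-1.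
have F0 k : 0 <= F k by rewrite invr_ge0 addr_ge0 // sqr_ge0.
(* The increments are dominated by 1 / ((a + 1/2) (a + 3/2)), which telescopes; at m = 0 both sides
   equal 1. The half-line with the central term contributes at most 3, the other at most 2. *)
have G m : \sum_(0 <= k < m.+1) F k <= 3 - (m%:R + 2^-1)^-1.
  elim: m => [|m IH].
    by rewrite big_nat1 /F expr0n addr0 add0r invr1 invrK; lra.
  rewrite big_nat_recr //=; apply: le_trans (lerD IH (lexx _)) _.
  rewrite /F; have m0 : 0 <= (m%:R : R) by [].
  rewrite -[m.+1%:R]natr1.
  move: (m%:R : R) m0 => a a0.
  have h : (1 + (a + 1) ^+ 2)^-1 <= (a + 2^-1)^-1 - (a + 1 + 2^-1)^-1.
    have -> : (a + 2^-1)^-1 - (a + 1 + 2^-1)^-1 = ((a + 2^-1) * (a + 1 + 2^-1))^-1.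
      by field; apply/andP; split; lra.
    by rewrite lef_pV2 ?posrE; nra.
  by lra.
rewrite -(big_mkord predT (fun j => (1 + (((j%:Z - M%:Z)%:~R : R)) ^+ 2)^-1)) /=.
rewrite (@big_cat_nat _ _ _ M) //=; last by rewrite -addnn -addnS leq_addr.
have S1 : \sum_(M <= j < M.*2.+1) (1 + (((j%:Z - M%:Z)%:~R : R)) ^+ 2)^-1 <= 3.
  rewrite -{1}[M]add0n big_addn (_ : (M.*2.+1 - M)%N = M.+1); last by lia.
  apply: le_trans (_ : \sum_(0 <= k < M.+1) F k <= _).
    rewrite le_eqVlt; apply/orP; left; apply/eqP; apply: eq_bigr => k _.
    by rewrite /F PoszD addrK.
  by apply: le_trans (G M) _; rewrite lerBlDr lerDl invr_ge0 addr_ge0.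
have S2 : \sum_(0 <= j < M) (1 + (((j%:Z - M%:Z)%:~R : R)) ^+ 2)^-1 <= 2.
  rewrite big_nat_rev /=.
  have GM := G M; rewrite big_nat_recl // {1}/F expr0n addr0 invr1 in GM.
  apply: (@le_trans _ _ (\sum_(0 <= k < M) F k.+1)); last first.
    have : 0 <= (M%:R + 2^-1 : R)^-1 by rewrite invr_ge0 addr_ge0.
    by move: GM; lra.
  rewrite le_eqVlt; apply/orP; left; apply/eqP; apply: eq_big_nat => k /andP[_ kM].
  rewrite /F; congr (_^-1); congr (_ + _).
  rewrite add0n -subzn //.
  have -> : M%:Z - k.+1%:Z - M%:Z = - (k.+1%:Z) by ring.
  by rewrite rmorphN sqrrN.
by lra.
Qed.

Lemma sum_grid_inv M : \sum_(m : grid n M) \prod_i (1 + (((cen m i)%:~R : R)) ^+ 2)^-1 <= 5 ^+ n.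
Proof.
have := bigA_distr_bigA (fun (i : 'I_n) (j : 'I_(M.*2.+1)) =>
  (1 + ((((j : nat)%:Z - M%:Z)%:~R : R)) ^+ 2)^-1).
rewrite /= => <-; rewrite prodr_const card_ord lerXn2r ?nnegrE //; last exact: sum_sqr_inv.
by apply: sumr_ge0 => j _; rewrite invr_ge0 addr_ge0 // sqr_ge0.
Qed.

Lemma prod_le_wt M (m : grid n M) :
  \prod_i (1 + (((cen m i)%:~R : R)) ^+ 2) <= wt 1 n.*2 (cen m).
Proof.
rewrite /wt mul1r -mul2n exprM.
have E (b : R) : b ^+ n = \prod_(i < n) b by rewrite prodr_const card_ord.
rewrite E.
apply: ler_prod => i _; rewrite addr_ge0 ?sqr_ge0 //=.
rewrite (bigD1 i) //=; have S0 : 0 <= \sum_(j | j != i) `|((cen m j)%:~R : R)|.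
  by apply: sumr_ge0.
rewrite -[X in 1 + X]real_normK ?num_real //.
by move: (normr_ge0 ((cen m i)%:~R : R)) S0; move: `|_| (\sum_(_ | _) _) => a b; nra.
Qed.

(* Summability over the grid, uniformly in its size, costs 2n derivatives. *)
Lemma sum_decay M (g : grid n M -> R) s (B : R) :
  (forall m, `|coef g m| * wt 1 (s + n.*2) (cen m) <= B) -> nrm 1 s g <= 5 ^+ n * B.
Proof.
move=> HB; apply: (@le_trans _ _ (\sum_(m : grid n M)
   (\prod_i (1 + (((cen m i)%:~R : R)) ^+ 2)^-1) * B)); last first.
  have B0 : 0 <= B by apply: le_trans (HB [ffun=> ord0]); rewrite mulr_ge0 ?wt_ge0.
  by rewrite -mulr_suml ler_wpM2r // sum_grid_inv.
apply: ler_sum => m _.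
have P0 : 0 < \prod_i (1 + (((cen m i)%:~R : R)) ^+ 2).
  by apply: prodr_gt0 => i _; rewrite ltr_pwDl // sqr_ge0.
rewrite prodfV [leRHS]mulrC ler_pdivlMr //; apply: le_trans (HB m).
have -> : wt 1 (s + n.*2) (cen m) = wt 1 s (cen m) * wt (1 : R) n.*2 (cen m).
  by rewrite /wt exprD.
by rewrite mulrA ler_wpM2l ?mulr_ge0 ?wt_ge0 // prod_le_wt.
Qed.

Lemma sample_nrm s : exists2 B : R, 0 <= B & forall M tau, nrm 1 s (@sample M tau) <= B.
Proof.
have [B B0 HB] := coef_decay (s + n.*2).
exists (5 ^+ n * B) => [|M tau]; first by rewrite mulr_ge0.
by apply: sum_decay => m; exact: HB.
Qed.

(* Interpolation: the coefficients are small by smallness of the sup norm and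
   decay uniformly, so their geometric mean gives a small summable bound. *)
Lemma sample_small : exists2 B : R, 0 <= B & forall M tau (sup : R), 0 <= sup ->
  (forall y, `|f tau y| <= sup) -> nrm 0 0 (@sample M tau) <= Num.sqrt (B * sup).
Proof.
have [B B0 HB] := coef_decay (n.*2 + n.*2).
exists (5 ^+ n.*2 * (B * 2)) => [|M tau sup s0 Hs]; first by rewrite !mulr_ge0 ?exprn_ge0.
have -> : 5 ^+ n.*2 * (B * 2) * sup = (5 ^+ n) ^+ 2 * (B * (2 * sup)).
  by rewrite -exprM muln2; ring.
rewrite sqrtrM ?sqr_ge0 // sqrtr_sqr ger0_norm ?exprn_ge0 //.
have -> : nrm 0 0 (@sample M tau) = nrm 1 0 (@sample M tau) by [].
apply: sum_decay => m; rewrite add0n.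
set a := `|coef (@sample M tau) m|; set w := wt 1 n.*2 (cen m).
have a0 : 0 <= a by exact: normr_ge0. have w0 : 0 <= w by exact: wt_ge0.
have a1 : a <= 2 * sup by apply: coef_le_sup => x; exact: Hs.
have aw : a * w ^+ 2 <= B.
  have := HB M tau m; rewrite -/a; congr (_ * _ <= _).
  by rewrite /w /wt -exprM muln2 addnn.
rewrite -[leLHS]ger0_norm ?mulr_ge0 // -sqrtr_sqr ler_wsqrtr //.
have -> : (a * w) ^+ 2 = (a * w ^+ 2) * a by ring.
by rewrite ler_pM // mulr_ge0 // sqr_ge0.
Qed.
End DataNorm.

(** Rests on (1 + eta a)^s <= 1 + eta ((1 + a)^s - 1). With eps already fixed, it makes the data
    small in the norm of any order [s], by choice of [eta] alone. *)
Lemma nrm_interp (R : realType) n M (g : grid n M -> R) (eta : R) s :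
  0 <= eta -> eta <= 1 -> nrm eta s g <= nrm 0 0 g + eta * nrm 1 s g.
Proof.
move=> e0 e1; rewrite /nrm mulr_sumr -big_split; apply: ler_sum => m _ /=.
rewrite mulrCA -mulrDr ler_wpM2l // /wt expr0 mul1r.
have : 0 <= \sum_i `|((cen m i)%:~R : R)| by apply: sumr_ge0.
move: (\sum_i _) => a a0.
have h q : 0 <= (1 + a) ^+ q - 1 by rewrite subr_ge0 exprn_ege1 // lerDl.
suff : (1 + eta * a) ^+ s <= 1 + eta * ((1 + a) ^+ s - 1) by lra.
elim: s => [|q IH]; first by rewrite !expr0 subrr mulr0 addr0.
rewrite !exprS; have ea : 0 <= 1 + eta * a by rewrite addr_ge0 // mulr_ge0.
apply: le_trans (ler_wpM2l ea IH) _.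
have := h q; move: ((1 + a) ^+ q) => X hX.
have : 0 <= eta * a * (X - 1) * (1 - eta) by rewrite !mulr_ge0 // subr_ge0.
by lra.
Qed.

Lemma is_derive_line (R : realType) (V : normedModType R) (f : V -> R) (x v : V) (t : R) :
  derivable f (x + t *: v) v ->
  is_derive t 1 (fun s : R => f (x + s *: v)) ('D_v f (x + t *: v)).
Proof.
have E : (fun h : R => h^-1 *: (((fun s : R => f (x + s *: v)) \o shift t) (h *: (1 : R)) - f (x + t *: v))) =
  (fun h : R => h^-1 *: ((f \o shift (x + t *: v)) (h *: v) - f (x + t *: v))).
  apply/funext => h /=; congr (_ *: (f _ - _)).
  have -> : h *: (1 : R) = h by exact: mulr1.
  by rewrite scalerDl addrCA.
by move=> df; split; rewrite /derivable /derive E.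
Qed.

(** * Rescaled and periodised local data *)

Section LocalData.
Variables (R : realType) (n : nat) (V : set 'rV[R]_n) (psi : 'rV[R]_n -> R).
Hypotheses (V0 : V 0) (psi_smooth : smooth_on V psi).
Local Notation e i := (delta_mx 0 i : 'rV[R]_n).

Definition cube (d : R) : set 'rV[R]_n := [set x | forall i, `|x 0 i| <= d].

Lemma nbhs_cube (A : set 'rV[R]_n) : nbhs (0 : 'rV[R]_n) A -> exists2 d : R, 0 < d & cube d `<=` A.
Proof.
move=> /nbhs_ballP[d /= d0 dA]; exists (d / 2); first by rewrite divr_gt0.
move=> x xd; apply: dA; split=> // i j; rewrite /ball /= mxE sub0r normrN ord1.
apply: (le_lt_trans (xd j)); lra.
Qed.

Lemma compact_cube d : compact (cube d).
Proof.
have := @rV_compact _ n (fun=> `[- d, d]%classic) (fun=> @segment_compact R _ _).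
congr compact; apply/seteqP; split => x /= h i; have := h i;
 by rewrite in_itv /= ler_norml.
Qed.

Definition theta (y : 'rV[R]_n) : 'rV[R]_n := \row_i pcoord (y 0 i).

Lemma theta_bound : exists2 C : R, 0 < C & forall y, cube C (theta y).
Proof.
have [C C0 HC] := unif_smooth_bound (unif_smooth_pcoord R 0 unit).
exists (C + 1); first lra.
by move=> y i; rewrite mxE; apply: le_trans (HC tt _) _; lra.
Qed.

Lemma theta_periodic i y : theta (y + (2 * pi) *: e i) = theta y.
Proof.
apply/rowP => j; rewrite !mxE eqxx /=; case: eqP => _.
  by rewrite mulr1 pcoord_periodic.
by rewrite mulr0 addr0.
Qed.

Lemma theta_line i y t : theta (y + t *: e i) =
  \row_j (if j == i then 0 else pcoord (y 0 j)) + pcoord (y 0 i + t) *: e i.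
Proof.
apply/rowP => j; rewrite !mxE eqxx /=; case: eqP => [->|_].
  by rewrite mulr1 add0r mulr1.
by rewrite !mulr0 !addr0.
Qed.

Variables (C0 eps0 : R).
Hypotheses (C0_gt0 : 0 < C0) (eps0_gt0 : 0 < eps0).
Hypothesis thetaC : forall y, cube C0 (theta y).
Hypothesis cubeV : cube (eps0 * C0) `<=` V.

(** A type of scales, so that eps can belong to the index of a uniformly smooth family. *)
Definition scale_dom := {eps : R | 0 < eps <= eps0}.

Lemma scaled_in (eps : scale_dom) y : cube (eps0 * C0) (val eps *: theta y).
Proof.
move=> i; have /andP[p1 p2] := valP eps.
rewrite mxE normrM (gtr0_norm p1); apply: ler_pM => //; first exact: ltW.
exact: thetaC.
Qed.

(** For |y_i| <= 1/2 this is psi (eps y) - psi 0, and it is periodic everywhere; by [cubeV] it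
    evaluates [psi] only inside [V]. *)
Definition local_data (eps : scale_dom) (y : 'rV[R]_n) : R := psi (val eps *: theta y) - psi 0.

Lemma iter_partial_bounded s : exists C : R, forall x, cube (eps0 * C0) x ->
  `|iter_partial s psi x| <= C.
Proof.
set g := iter_partial s psi.
have cg : {within cube (eps0 * C0), continuous (fun x => `|g x|)}.
  apply: continuous_in_subspaceT => x /set_mem xc.
  have [cx _] := psi_smooth s (cubeV xc).
  by apply: (cvg_comp _ _ cx); exact: norm_continuous.
have ne : cube (eps0 * C0) !=set0.
  by exists 0 => i; rewrite mxE normr0 mulr_ge0 // ltW.
have [c _ Hc] := EVT_max_rV ne (@compact_cube _) cg.
by exists `|g c| => x xc; apply: Hc; apply: mem_set.
Qed.

(** Along direction [i] only the coordinate [pcoord (y 0 i + t)] moves, so each derivative raises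
    the order [j] of the pure partial of [psi]; hence the induction on [r] for all [j]. *)
Lemma unif_smooth_scaled i r j : unif_smooth r (fun (p : scale_dom * 'rV[R]_n) t =>
  iter_partial (nseq j i) psi (val p.1 *: theta (p.2 + t *: e i))).
Proof.
elim: r j => [|r IH] j; (split;
  first by have [C HC] := iter_partial_bounded (nseq j i); exists C => p t; exact/HC/scaled_in).
  by [].
have [_ [pc' [dpc upc]]] := unif_smooth_pcoord R r.+1 unit.
exists (fun p t => iter_partial (nseq j.+1 i) psi (val p.1 *: theta (p.2 + t *: e i)) *
  (val p.1 * pc' tt (p.2 0 i + t))); split; last first.
  apply: unif_smoothM; first exact: IH.
  apply: unif_smoothM.
    apply: (@unif_smooth_cst _ _ _ _ eps0) => p.
    by have /andP[p1 p2] := valP p.1; rewrite gtr0_norm.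
  have := unif_smooth_affine 1 (fun p : scale_dom * 'rV[R]_n => p.2 0 i)
    (unif_smooth_reindex (fun=> tt) upc).
  by congr unif_smooth; apply/funext => p; apply/funext => t; rewrite mul1r addrC.
move=> [eps y] t /=; set x0 := \row_j (if j == i then 0 else pcoord (y 0 j)).
have Et s : val eps *: theta (y + s *: e i) = val eps *: x0 + (val eps * pcoord (y 0 i + s)) *: e i.
  by rewrite theta_line scalerDr scalerA.
have Vt : V (val eps *: theta (y + t *: e i)) by apply/cubeV/scaled_in.
have [_ /(_ i) df] := psi_smooth (nseq j i) Vt.
rewrite Et in df; have dl := is_derive_line df.
have dp : is_derive t 1 (fun s => val eps * pcoord (y 0 i + s)) (val eps * pc' tt (y 0 i + t)).
  have -> : (fun s => val eps * pcoord (y 0 i + s)) = val eps \*: (fun s => pcoord (s + y 0 i)).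
    by apply/funext => s; rewrite addrC.
  rewrite (addrC (y 0 i) t).
  exact: is_deriveZ (is_derive_translate (dpc tt (t + y 0 i))).
have Ef : (fun s : R => iter_partial (nseq j i) psi (val eps *: theta (y + s *: e i))) =
  (fun s : R => iter_partial (nseq j i) psi (val eps *: x0 + s *: e i)) \o
  (fun s => val eps * pcoord (y 0 i + s)) by apply/funext => s; rewrite /= Et.
by rewrite Ef Et /partial; apply: is_derive1_comp.
Qed.

Lemma local_data_smooth i r : unif_smooth r
  (fun (p : scale_dom * 'rV[R]_n) t => local_data p.1 (p.2 + t *: e i)).
Proof.
apply: unif_smoothD; first exact: (unif_smooth_scaled i r 0).
exact: (@unif_smooth_cst _ _ _ _ `|- psi 0|).
Qed.

Lemma local_data_periodic eps : periodic2pi (local_data eps).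
Proof. by move=> i y; rewrite /local_data theta_periodic. Qed.

Lemma local_data_small (tol : R) : 0 < tol -> exists2 d : R, 0 < d &
  forall eps : scale_dom, val eps <= d -> forall y, `|local_data eps y| <= tol.
Proof.
move=> tol0; have [c0 _] := psi_smooth [::] V0.
have /cvgrPdist_le/(_ _ tol0)/nbhs_cube[d d0 dA] := c0.
exists (d / C0); first by rewrite divr_gt0.
move=> eps epsd y; rewrite distrC; apply: dA => i.
have /andP[p1 p2] := valP eps.
rewrite mxE normrM (gtr0_norm p1); apply: le_trans (ler_wpM2l (ltW p1) (thetaC y i)) _.
by rewrite -ler_pdivlMr.
Qed.
End LocalData.

(** * Smooth limits of trigonometric polynomials *)

Section SmoothFamily.
Variables (R : realType) (n : nat).
Local Notation e i := (delta_mx 0 i : 'rV[R]_n).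
Implicit Types (D : seq 'I_n -> 'rV[R]_n -> R).

(** All iterated partial derivatives are carried along as data, so that a limit can be taken at
    every order simultaneously. *)
Definition smooth_fam D := (forall s, continuous (D s)) /\
  (forall s i x, is_derive x (e i) (D s) (D (i :: s) x)).

Lemma smooth_fam_iter D s : smooth_fam D -> iter_partial s (D [::]) = D s.
Proof.
move=> [_ dD]; elim: s => //= i s ->; apply/funext => x.
by rewrite /partial; have [_ ->] := dD s i x.
Qed.

Lemma smooth_fam_smooth D U : smooth_fam D -> smooth_on U (D [::]).
Proof.
move=> FD s x _; rewrite smooth_fam_iter //; have [cD dD] := FD.
by split=> [|i]; [exact: cD | have [] := dD s i x].
Qed.

Lemma smooth_famD D E : smooth_fam D -> smooth_fam E ->
  smooth_fam (fun s x => D s x + E s x).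
Proof.
move=> [cD dD] [cE dE]; split=> [s x|s i x].
  exact: continuousD (cD s x) (cE s x).
exact: is_deriveD (dD s i x) (dE s i x).
Qed.

(** Both hypotheses are non-strict inequalities between finitely many values, hence inherited by
    pointwise limits with the same constants. *)
Lemma taylor_smooth_fam D (C : seq 'I_n -> R) :
  (forall s i x h, `|h| <= 1 -> `|D s (x + h *: e i) - D s x - h * D (i :: s) x| <= C s * h ^+ 2) ->
  (forall s x y, `|D s x - D s y| <= C s * \sum_j `|x 0 j - y 0 j|) ->
  smooth_fam D.
Proof.
move=> HT HL; split=> [s x|s i x]; last first.
  by apply: (@is_derive_quad _ _ _ _ _ _ (C s)) => h h1; rewrite (addrC (h *: _)); exact: HT.
apply/(@cvgrPdist_le _ _ _ _ (nbhs_filter x)) => eps eps0.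
pose K := (`|C s| * n%:R + 1); have K0 : 0 < K by rewrite ltr_wpDl ?mulr_ge0.
have B : nbhs x (ball x (eps / K)) by apply: nbhsx_ballx; rewrite divr_gt0.
apply: filterS B => y [_ xy]; apply: le_trans (HL s x y) _.
apply: (@le_trans _ _ (`|C s| * \sum_(j < n) (eps / K))).
  apply: (@le_trans _ _ (`|C s| * \sum_j `|x 0 j - y 0 j|)).
    by rewrite ler_wpM2r ?ler_norm // sumr_ge0.
  by rewrite ler_wpM2l //; apply: ler_sum => j _; apply: ltW; exact: xy.
rewrite sumr_const card_ord -[_ *+ n]mulr_natr.
have -> : `|C s| * (eps / K * n%:R) = eps * ((`|C s| * n%:R) / K) by ring.
by rewrite ler_piMr ?ltW // ltr_pdivrMr // mul1r ltrDl.
Qed.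
End SmoothFamily.

Section UltraLimit.
Variables (R : realType).

Lemma ultra_oo : exists U : set_system nat, UltraFilter U /\ \oo `<=` U.
Proof. by apply: ultraFilterLemma; exact: eventually_filter. Qed.

Variables (U : set_system nat).
Hypotheses (UU : UltraFilter U) (oU : \oo `<=` U).

(** Compactness provides a cluster point, and along an ultrafilter a cluster point is a limit. One
    filter thus serves all points and all derivatives, in place of diagonal subsequences. *)
Lemma ultra_cvg (x : nat -> R) (C : R) : (forall N, `|x N| <= C) ->
  exists l : R, x @ U --> l.
Proof.
move=> xC.
have PU := @ultra_proper _ _ UU.
have PF : ProperFilter (x @ U) by exact: fmap_proper_filter.
have xU : (x @ U) `[- C, C]%classic.
  have : U [set N | x N \in `[- C, C]] by apply: filterE => N; rewrite /= in_itv /= -ler_norml.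
  by [].
have [l [_ cl]] := @segment_compact R (- C) C (x @ U) PF xU.
exists l => B Bl.
have [//|nB] := in_ultra_setVsetC (x @^-1` B) UU.
by have [y [ny yB]] := cl (~` B) B nB Bl.
Qed.

Lemma ultra_le (x : nat -> R) (l C : R) : x @ U --> l -> (forall N, `|x N| <= C) -> `|l| <= C.
Proof.
move=> xl xC; have PU := @ultra_proper _ _ UU.
have h : `|x N| @[N --> U] --> `|l| by apply: (cvg_comp _ _ xl); exact: norm_continuous.
have near : \forall N \near U, [set y | y <= C] `|x N| by apply: filterE => N /=.
exact: (@closed_cvg _ _ U PU (fun N => `|x N|) [set y | y <= C] (@closed_le R C) near _ h).
Qed.

Lemma ulim_smooth_fam n (DN : nat -> seq 'I_n -> 'rV[R]_n -> R) (C : seq 'I_n -> R) :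
  (forall N s x, `|DN N s x| <= C s) ->
  (forall N s i x h, `|DN N s (x + h *: delta_mx 0 i) - DN N s x - h * DN N (i :: s) x|
     <= C s * h ^+ 2) ->
  (forall N s x y, `|DN N s x - DN N s y| <= C s * \sum_j `|x 0 j - y 0 j|) ->
  exists D, smooth_fam D /\ forall s x, DN N s x @[N --> U] --> D s x.
Proof.
move=> HB HT HL; have PU := @ultra_proper _ _ UU.
have H (p : seq 'I_n * 'rV[R]_n) : exists l : R, DN N p.1 p.2 @[N --> U] --> l.
  by apply: (@ultra_cvg _ (C p.1)) => N; exact: HB.
have [D HD] := boolp.choice H.
have HD2 s x : DN N s x @[N --> U] --> D (s, x) by exact: (HD (s, x)).
exists (fun s x => D (s, x)); split=> //.
apply: (@taylor_smooth_fam _ _ _ C) => [s i x h h1|s x y].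
  apply: (@ultra_le (fun N => DN N s (x + h *: delta_mx 0 i) - DN N s x - h * DN N (i :: s) x)) => //.
  by apply: cvgB; [exact: cvgB|apply: cvgMr].
by apply: (@ultra_le (fun N => DN N s x - DN N s y)) => //; exact: cvgB.
Qed.

Lemma polyf_cvg (I : finType) (G : (I -> R) -> R) (z : nat -> I -> R) (l : I -> R) :
  polyf G -> (forall a, z N a @[N --> U] --> l a) -> G (z N) @[N --> U] --> G l.
Proof.
have PU := @ultra_proper _ _ UU.
move=> + zl; elim=> [c|a|{}G H _ IG _ IH|{}G H _ IG _ IH].
- exact: cvg_cst.
- exact: zl.
- exact: cvgD.
- exact: cvgM.
Qed.

End UltraLimit.

Section Trig.
Variable R : realType.

(** Derivation is a shift by a quarter period, so iterated derivatives keep one closed form. *)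
Lemma is_derive_cas (t : R) : is_derive t 1 (@cas R) (cas (t + pi / 2)).
Proof.
have := is_deriveD (is_derive_cos t) (is_derive_sin t).
by rewrite /cas cosDpihalf sinDpihalf.
Qed.

Lemma cas_mvt (t h : R) : exists2 c : R, `|c - t| <= `|h| &
  cas (t + h) - cas t = h * cas (c + pi / 2).
Proof.
have cc (a b : R) : {within `[a, b], continuous (@cas R)}.
  apply: continuous_subspaceT => x; apply: differentiable_continuous.
  by apply/derivable1_diffP; have [] := is_derive_cas x.
case: (lerP 0 h) => h0.
  have [|c] := MVT_segment _ (fun x _ => is_derive_cas x) (cc t (t + h)).
    by rewrite lerDl.
  rewrite in_itv /= => /andP[c1 c2] E; exists c; last by rewrite E; ring.
  by rewrite !ger0_norm ?subr_ge0 // lerBlDl.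
have [|c] := MVT_segment _ (fun x _ => is_derive_cas x) (cc (t + h) t).
  by rewrite gerDl ltW.
rewrite in_itv /= => /andP[c1 c2] E; exists c.
  by rewrite (ltr0_norm h0) ler0_norm ?subr_le0 //; lra.
by apply: oppr_inj; rewrite opprB E; ring.
Qed.

Lemma cas_lip (a b : R) : `|cas b - cas a| <= 2 * `|b - a|.
Proof.
have [c _] := cas_mvt a (b - a); rewrite (addrC a) subrK => ->.
by rewrite normrM mulrC ler_wpM2r // cas_le2.
Qed.

Lemma cas_taylor (t h : R) : `|cas (t + h) - cas t - h * cas (t + pi / 2)| <= 2 * h ^+ 2.
Proof.
have [c ct ->] := cas_mvt t h; rewrite -mulrBr normrM.
have := cas_lip (t + pi / 2) (c + pi / 2).
rewrite (_ : c + pi / 2 - (t + pi / 2) = c - t); last by ring.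
rewrite -(real_normK (num_real h)).
by move: `|h| `|c - t| (normr_ge0 h) (normr_ge0 (c - t)) ct `|_| => a b a0 b0 ba d H; nra.
Qed.
End Trig.

Section TrigPoly.
Variables (R : realType) (n : nat).
Local Notation e i := (delta_mx 0 i : 'rV[R]_n).

Definition argm (om : R) M (m : grid n M) (x : 'rV[R]_n) : R :=
  \sum_i om * (cen m i)%:~R * x 0 i.

(* [trigp om a s] is the iterated partial derivative along [s] of the
   trigonometric polynomial [trigp om a [::]]. *)
Definition trigp (om : R) M (a : grid n M -> R) (s : seq 'I_n) (x : 'rV[R]_n) : R :=
  \sum_m a m * \prod_(i <- s) (om * (cen m i)%:~R) *
    cas (argm om m x + (size s)%:R * (pi / 2)).

Variables (om : R) (M : nat) (a : grid n M -> R).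

Lemma cen_le_sum (m : grid n M) i : `|((cen m i)%:~R : R)| <= \sum_j `|((cen m j)%:~R : R)|.
Proof. by rewrite (bigD1 i) //= lerDl sumr_ge0. Qed.

Lemma prod_freq_le (m : grid n M) (s : seq 'I_n) :
  `|\prod_(i <- s) (om * (cen m i)%:~R)| <= `|om| ^+ size s * wt 1 (size s) (cen m).
Proof.
elim: s => [|i s IH]; first by rewrite big_nil normr1 /wt !expr0 mulr1.
rewrite big_cons normrM; apply: le_trans (ler_wpM2l (normr_ge0 _) IH) _.
rewrite /wt /= !exprS normrM !mul1r.
have -> : `|om| * `|om| ^+ size s * ((1 + \sum_i0 `|((cen m i0)%:~R : R)|) *
   (1 + \sum_i0 `|((cen m i0)%:~R : R)|) ^+ size s) =
  `|om| * (1 + \sum_i0 `|((cen m i0)%:~R : R)|) * (`|om| ^+ size s *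
   (1 + \sum_i0 `|((cen m i0)%:~R : R)|) ^+ size s) by ring.
have S0 : 0 <= \sum_j `|((cen m j)%:~R : R)| by apply: sumr_ge0.
apply: ler_wpM2r; first by rewrite mulr_ge0 // exprn_ge0 // addr_ge0.
by rewrite ler_wpM2l //; have := cen_le_sum m i; lra.
Qed.

Variable A : nat -> R.
Hypothesis HA : forall k, \sum_m `|a m| * wt 1 k (cen m) <= A k.

Lemma trigp_sum_bound (s : seq 'I_n) (k : nat) (c : grid n M -> R) (B : R) : 0 <= B ->
  (forall m, `|c m| <= B * wt 1 k (cen m)) ->
  `|\sum_m a m * \prod_(i <- s) (om * (cen m i)%:~R) * c m|
    <= `|om| ^+ size s * B * A (size s + k).
Proof.
move=> B0 Hc; apply: le_trans (ler_norm_sum _ _ _) _.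
apply: (@le_trans _ _ (`|om| ^+ size s * B * \sum_m `|a m| * wt 1 (size s + k) (cen m))).
  rewrite mulr_sumr; apply: ler_sum => m _; rewrite !normrM.
  have -> : wt 1 (size s + k) (cen m) = wt (1 : R) (size s) (cen m) * wt 1 k (cen m).
    by rewrite /wt exprD.
  have -> : `|om| ^+ size s * B * (`|a m| * (wt 1 (size s) (cen m) * wt 1 k (cen m))) =
    `|a m| * (`|om| ^+ size s * wt 1 (size s) (cen m)) * (B * wt 1 k (cen m)) by ring.
  apply: ler_pM; [by rewrite mulr_ge0|by []| |exact: Hc].
  by rewrite ler_wpM2l // prod_freq_le.
by rewrite ler_wpM2l ?HA // mulr_ge0 // exprn_ge0.
Qed.

Lemma trigp_bound s x : `|trigp om a s x| <= `|om| ^+ size s * 2 * A (size s).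
Proof.
have := @trigp_sum_bound s 0 (fun m => cas (argm om m x + (size s)%:R * (pi / 2))) 2.
rewrite addn0; apply=> // m.
by rewrite /wt expr0 mulr1 cas_le2.
Qed.

Lemma trigp_lip s x y : `|trigp om a s x - trigp om a s y| <=
  `|om| ^+ size s * 2 * A (size s + 1) * `|om| * \sum_j `|x 0 j - y 0 j|.
Proof.
rewrite /trigp -sumrB; under eq_bigr do rewrite -mulrBr.
have -> : `|om| ^+ size s * 2 * A (size s + 1) * `|om| * \sum_j `|x 0 j - y 0 j| =
  `|om| ^+ size s * (2 * `|om| * \sum_j `|x 0 j - y 0 j|) * A (size s + 1) by ring.
have D0 : 0 <= \sum_j `|x 0 j - y 0 j| by apply: sumr_ge0.
apply: trigp_sum_bound => [|m]; first by rewrite !mulr_ge0.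
apply: le_trans (cas_lip _ _) _; rewrite -!mulrA ler_wpM2l //.
rewrite opprD addrACA subrr addr0 /argm -sumrB.
apply: le_trans (ler_norm_sum _ _ _) _; rewrite /wt expr1 mul1r.
rewrite mulrCA mulr_suml ler_sum // => j _.
rewrite -mulrBr normrM normrM mulrC ler_wpM2l // ler_wpM2l //.
by have := cen_le_sum m j; lra.
Qed.

Lemma argm_line (m : grid n M) x h i :
  argm om m (x + h *: e i) = argm om m x + h * (om * (cen m i)%:~R).
Proof.
rewrite /argm (bigD1 i) //= [in RHS](bigD1 i) //= !mxE !eqxx mulr1.
rewrite (eq_bigr (fun j => om * (cen m j)%:~R * x 0 j)); first by ring.
by move=> j ji; rewrite !mxE (negPf ji) andbF mulr0 addr0.
Qed.

Lemma trigp_taylor s i x h :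
  `|trigp om a s (x + h *: e i) - trigp om a s x - h * trigp om a (i :: s) x| <=
  `|om| ^+ size s * 2 * A (size s + 2) * `|om| ^+ 2 * h ^+ 2.
Proof.
pose b (m : grid n M) := om * (cen m i)%:~R.
pose t (m : grid n M) := argm om m x + (size s)%:R * (pi / 2).
have -> : trigp om a s (x + h *: e i) - trigp om a s x - h * trigp om a (i :: s) x =
  \sum_m a m * \prod_(i <- s) (om * (cen m i)%:~R) *
   (cas (t m + h * b m) - cas (t m) - h * b m * cas (t m + pi / 2)).
  rewrite /trigp mulr_sumr -!sumrB; apply: eq_bigr => m _.
  rewrite big_cons argm_line -/(b m).
  have -> : argm om m x + h * b m + (size s)%:R * (pi / 2) = t m + h * b m by rewrite /t; ring.
  have -> : argm om m x + (size (i :: s))%:R * (pi / 2) = t m + pi / 2.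
    by rewrite /t /= -addn1 natrD; ring.
  by rewrite /t; ring.
have -> : `|om| ^+ size s * 2 * A (size s + 2) * `|om| ^+ 2 * h ^+ 2 =
   `|om| ^+ size s * (2 * `|om| ^+ 2 * h ^+ 2) * A (size s + 2) by ring.
apply: trigp_sum_bound => [|m]; first by apply: mulr_ge0 (mulr_ge0 _ _) _; rewrite ?sqr_ge0.
apply: le_trans (cas_taylor _ _) _; rewrite -[_ * h ^+ 2]mulrA -[leRHS]mulrA.
rewrite ler_wpM2l // /b !exprMn real_normK ?num_real //.
rewrite mulrCA -[leRHS]mulrA ler_wpM2l ?sqr_ge0 //.
rewrite ler_wpM2l ?sqr_ge0 // /wt mul1r -(real_normK (num_real (_%:~R : R))).
have h1 := cen_le_sum m i; rewrite lerXn2r ?nnegrE ?addr_ge0 //; last lra.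
by apply: sumr_ge0.
Qed.
End TrigPoly.

(** * Curvature matrices and elementary symmetric functions *)

Section RealEigenvalues.
Variable R : realType.
Local Notation C := (complex R).
Local Notation toC := (real_complex R).

(** A left eigenvector v = w g satisfies w h = a w g. Pairing with the conjugate of w exhibits [a]
    as a quotient of values of two Hermitian forms, the denominator being positive. *)
Lemma pencil_eigen_real n (g h : 'M[R]_n) (a : C) :
  g^T = g -> h^T = h ->
  (forall w : 'rV[C]_n, w != 0 -> 0 < \sum_i \sum_j w 0 i * toC (g i j) * (w 0 j)^*) ->
  g \in unitmx -> root (char_poly (map_mx toC (invmx g *m h))) a -> a \is Num.real.
Proof.
move=> gT hT gpos gu; rewrite -eigenvalue_root_char => /eigenvalueP[v vA v0].
pose w := v *m map_mx toC (invmx g).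
have vw : v = w *m map_mx toC g.
  by rewrite /w -mulmxA -map_mxM mulVmx // map_mx1 mulmx1.
have w0 : w != 0 by apply: contraNneq v0 => w0; rewrite vw w0 mul0mx.
have wE : w *m map_mx toC h = a *: (w *m map_mx toC g).
  by rewrite -vw -vA map_mxM mulmxA.
clear vw vA; clearbody w; clear v0 v.
pose form (m : 'M[R]_n) := \sum_i \sum_j w 0 i * toC (m i j) * (w 0 j)^*.
have formE m : form m = \sum_j (w *m map_mx toC m) 0 j * (w 0 j)^*.
  rewrite /form exchange_big; apply: eq_bigr => j _ /=.
  by rewrite mxE mulr_suml; apply: eq_bigr => i _; rewrite !mxE.
have formJ m : m^T = m -> (form m)^* = form m.
  move=> mT; rewrite /form raddf_sum exchange_big; apply: eq_bigr => j _ /=.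
  rewrite raddf_sum; apply: eq_bigr => i _ /=.
  have cR x : (toC x)^* = toC x by apply: conj_Creal; apply/complex_realP; exists x.
  by rewrite !rmorphM /= conjCK cR -{1}mT mxE; ring.
have E : form h = a * form g.
  rewrite !formE mulr_sumr; apply: eq_bigr => j _; rewrite mulrA; congr (_ * _).
  by rewrite wE [LHS]mxE.
have gp : 0 < form g by exact: gpos.
have -> : a = form h / form g by rewrite E mulfK // gt_eqF.
by apply/CrealP; rewrite rmorphM fmorphV /= !formJ.
Qed.

Lemma char_poly_split n (A : 'M[R]_n) :
  (forall a : C, root (char_poly (map_mx toC A)) a -> a \is Num.real) ->
  exists kappa : 'rV[R]_n, char_poly A = \prod_(i < n) ('X - (kappa 0 i)%:P).
Proof.
move=> H; have [r Er] := closed_field_poly_normal (char_poly (map_mx toC A)).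
have Em := char_poly_monic (map_mx toC A).
rewrite (monicP Em) scale1r in Er.
have [s Es] : exists s : seq R, r = map toC s.
  have : all (fun z => z \is Num.real) r.
    by apply/allP => z zr; apply: H; rewrite Er root_prod_XsubC.
  elim: {Er} r => [|z r IH] /=; first by exists [::].
  by move=> /andP[/complex_realP[k ->] /IH[s ->]]; exists (k :: s).
have E : char_poly A = \prod_(x <- s) ('X - x%:P).
  apply: (map_poly_inj toC); rewrite map_char_poly Er Es big_map rmorph_prod.
  by apply: eq_bigr => x _; rewrite rmorphB /= map_polyX map_polyC.
have sz : size s = n.
  by have := size_char_poly A; rewrite E size_prod_XsubC => -[].
exists (\row_i s`_i); rewrite E (big_nth 0) sz big_mkord.
by apply: eq_bigr => i _; rewrite mxE.
Qed.

End RealEigenvalues.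

Section CurvatureMatrices.
Variables (R : realType) (n : nat) (p : 'I_n -> R).
Local Notation C := (complex R).
Local Notation toC := (real_complex R).

Let W2 := 1 + \sum_i p i ^+ 2.
Definition grad_form : 'M[R]_n := \matrix_(i, j) ((i == j)%:R + p i * p j).
(** The inverse of [grad_form] times 1 + |p|^2 (Sherman-Morrison); clearing the denominator keeps
    the equation polynomial in p. *)
Definition grad_coform : 'M[R]_n := \matrix_(i, j) (W2 * (i == j)%:R - p i * p j).

Lemma W2_gt0 : 0 < W2.
Proof. by rewrite ltr_pwDl // sumr_ge0 // => i _; rewrite sqr_ge0. Qed.

Lemma sum_delta (i : 'I_n) (F : 'I_n -> R) : \sum_j (i == j)%:R * F j = F i.
Proof.
rewrite (bigD1 i) //= eqxx mul1r big1 ?addr0 // => j ji.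
by rewrite eq_sym (negPf ji) mul0r.
Qed.

Lemma grad_formM : grad_form *m grad_coform = W2%:M.
Proof.
apply/matrixP => i k; rewrite !mxE.
transitivity (\sum_j ((i == j)%:R * (W2 * (j == k)%:R - p j * p k)
   + p i * (W2 * ((k == j)%:R * p j) - p k * p j ^+ 2))).
  apply: eq_bigr => j _; rewrite !mxE (eq_sym k j); ring.
rewrite big_split /= sum_delta -mulr_sumr sumrB -!mulr_sumr sum_delta.
have -> : \sum_j p j ^+ 2 = W2 - 1 by rewrite /W2; ring.
by rewrite -mulr_natr; ring.
Qed.

Lemma grad_form_unit : grad_form \in unitmx.
Proof.
have W0 : W2 != 0 by rewrite gt_eqF // W2_gt0.
have E : grad_form *m (W2^-1 *: grad_coform) = 1%:M.
  by rewrite -scalemxAr grad_formM scale_scalar_mx mulVf.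
by have [] := mulmx1_unit E.
Qed.

Lemma grad_form_inv : invmx grad_form = W2^-1 *: grad_coform.
Proof.
have W0 : W2 != 0 by rewrite gt_eqF // W2_gt0.
apply: (can_inj (mulKmx grad_form_unit)).
by rewrite mulmxV ?grad_form_unit // -scalemxAr grad_formM scale_scalar_mx mulVf.
Qed.

Lemma grad_form_sym : grad_form^T = grad_form.
Proof. by apply/matrixP => i j; rewrite !mxE eq_sym (mulrC (p j)). Qed.

Lemma grad_form_pos (w : 'rV[C]_n) : w != 0 ->
  0 < \sum_i \sum_j w 0 i * toC (grad_form i j) * (w 0 j)^*.
Proof.
move=> w0; pose q := \sum_i w 0 i * toC (p i).
have cR x : (toC x)^* = toC x by apply: conj_Creal; apply/complex_realP; exists x.
have -> : \sum_i \sum_j w 0 i * toC (grad_form i j) * (w 0 j)^* =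
   \sum_i `|w 0 i| ^+ 2 + `|q| ^+ 2.
  rewrite (normCK q) /q raddf_sum mulr_suml -big_split; apply: eq_bigr => i _ /=.
  rewrite normCK mulr_sumr.
  transitivity (\sum_j (w 0 i * (i == j)%:R * (w 0 j)^* +
      w 0 i * toC (p i) * (w 0 j * toC (p j))^*)).
    apply: eq_bigr => j _; rewrite mxE rmorphD /= rmorphM rmorph_nat.
    by rewrite rmorphM /= cR; ring.
  rewrite big_split /=; congr (_ + _).
  rewrite (bigD1 i) //= eqxx mulr1 big1 ?addr0 // => j ji.
  by rewrite eq_sym (negPf ji) mulr0 mul0r.
have [i wi] : exists i, w 0 i != 0.
  apply: contrapT => /forallNP al; case/eqP: w0; apply/rowP => i; rewrite mxE.
  by apply/eqP; have := al i => /negP; rewrite negbK.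
rewrite ltr_wpDr ?exprn_ge0 // (bigD1 i) //= ltr_pwDl ?exprn_gt0 ?normr_gt0 //.
by apply: sumr_ge0 => j _; rewrite exprn_ge0.
Qed.
End CurvatureMatrices.

(** * Elementary symmetric functions read off the characteristic polynomial *)

Section SigmaCoef.
Variable R : realType.

(** sigma_k of the spectrum by Vieta: polynomial in the entries, and meaningful before the
    eigenvalues are known to be real. *)
Definition sigmaM (n k : nat) (A : 'M[R]_n) : R := (-1) ^+ k * (char_poly A)`_(n - k).

Lemma coef_prod_ord (n m : nat) (kappa : 'I_n -> R) : (m <= n)%N ->
  (\prod_(i < n) ('X - (kappa i)%:P))`_m =
  (-1) ^+ (n - m) * \sum_(A : {set 'I_n} | #|A| == (n - m)%N) \prod_(i in A) kappa i.
Proof.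
pose ps := [seq kappa i | i <- enum 'I_n].
have sz : size ps = n by rewrite size_map size_enum_ord.
have -> : \prod_(i < n) ('X - (kappa i)%:P) = \prod_(x <- ps) ('X - x%:P).
  by rewrite big_map big_enum.
have nthE (i : 'I_n) : kappa i = ps`_i.
  by rewrite (nth_map i) ?size_enum_ord // nth_ord_enum.
under [in RHS]eq_bigr do under eq_bigr do rewrite nthE.
clearbody ps => {nthE}; move: {kappa} ps sz => ps sz; case: n / sz => mn.
exact: coef_prod_XsubC.
Qed.

Lemma sigmaM_sigma n k (A : 'M[R]_n) (kappa : 'rV[R]_n) : (k <= n)%N ->
  eigenvalues_with_mult A kappa -> sigmaM k A = sigma k kappa.
Proof.
move=> kn EA; rewrite /sigmaM EA coef_prod_ord ?leq_subr // subKn //.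
by rewrite mulrA -exprD addnn -mul2n exprM sqrrN !expr1n mul1r.
Qed.

(** Substituting c X in the characteristic polynomial of c A pulls a factor c out of each row; the
    claim compares coefficients of degree n - k. *)
Lemma sigmaM_scale n k (A : 'M[R]_n) (c : R) : c != 0 -> (k <= n)%N ->
  sigmaM k (c *: A) = c ^+ k * sigmaM k A.
Proof.
move=> c0 kn; rewrite /sigmaM mulrCA; congr (_ * _).
have E : char_poly (c *: A) \Po (c *: 'X) = c ^+ n *: char_poly A.
  rewrite /char_poly -(det_map_mx (comp_poly (c *: 'X))).
  have -> : map_mx (comp_poly (c *: 'X)) (char_poly_mx (c *: A)) = c%:P *: char_poly_mx A.
    apply/matrixP => i j; rewrite !mxE rmorphB raddfMn /= comp_polyX comp_polyC.
    by rewrite polyCM mulrBr -mul_polyC -mulrnAr.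
  by rewrite detZ -rmorphXn /= mul_polyC.
have := congr1 (fun q : {poly R} => q`_(n - k)) E.
rewrite coefZ => E2.
have E3 : (char_poly (c *: A) \Po (c *: 'X))`_(n - k) =
    (char_poly (c *: A))`_(n - k) * c ^+ (n - k).
  rewrite comp_polyE coef_sum.
  under eq_bigr do rewrite exprZn !coefZ coefXn.
  case: (ltnP (n - k) (size (char_poly (c *: A)))) => sz.
    rewrite (bigD1 (Ordinal sz)) //= eqxx mulr1 big1 ?addr0 // => i.
    by rewrite -val_eqE /= eq_sym => /negPf ->; rewrite !mulr0.
  rewrite nth_default // mul0r big1 // => i _.
  by rewrite eq_sym ltn_eqF ?(leq_trans (ltn_ord i) sz) // !mulr0.
have cu : c ^+ (n - k) != 0 by rewrite expf_neq0.
apply: (mulIf cu); rewrite -E3 E2 mulrAC -exprD subnKC //.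
Qed.

Lemma char_poly_trmx n (A : 'M[R]_n) : char_poly A^T = char_poly A.
Proof.
rewrite /char_poly -[RHS]det_tr; congr (\det _).
by apply/matrixP => i j; rewrite !mxE eq_sym.
Qed.

(** The perturbed matrix stays triangular, so only its diagonal matters; transposition reduces to
    the lower triangular case. *)
Lemma sigmaM_offdiag n k (d : 'I_n -> R) (a b : 'I_n) (t : R) : a != b ->
  sigmaM k (\matrix_(i, j) (d i *+ (i == j) + t *+ ((i == a) && (j == b)))) =
  sigmaM k (\matrix_(i, j) (d i *+ (i == j))).
Proof.
move=> ab; rewrite /sigmaM; congr (_ * nth _ (polyseq _) _).
wlog lt : a b ab / (b < a)%N.
  move=> W; case: (ltngtP b a) => [|lt|/val_inj E]; [exact: W| |by rewrite E eqxx in ab].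
  rewrite -[LHS]char_poly_trmx -[RHS]char_poly_trmx.
  have -> : (\matrix_(i, j) (d i *+ (i == j) + t *+ ((i == a) && (j == b))))^T =
    \matrix_(i, j) (d i *+ (i == j) + t *+ ((i == b) && (j == a))) :> 'M[R]_n.
    apply/matrixP => i j; rewrite !mxE eq_sym andbC; congr (_ + _).
    by case: (eqVneq i j) => [->|].
  rewrite W // 1?eq_sym //; congr char_poly; apply/matrixP => i j; rewrite !mxE eq_sym.
  by case: (eqVneq i j) => [->|].
rewrite !char_poly_trig.
- apply: eq_bigr => i _; rewrite !mxE eqxx; congr ('X - (_)%:P).
  by case: (eqVneq i a) => [->|] /=; rewrite ?(negPf ab) ?addr0.
- by apply/is_trig_mxP => i j ij; rewrite mxE -val_eqE /= ltn_eqF.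
- apply/is_trig_mxP => i j ij; rewrite mxE -val_eqE /= ltn_eqF // add0r.
  case: eqP => //= ia; case: eqP => //= jb.
  by move: ij lt; rewrite ia jb; lia.
Qed.

(** sigma_{k-1} of the entries other than lam_i: the product has degree n - 1, and n - k = (n - 1) -
    (k - 1). *)
Definition sigma_deriv n k (lam : 'I_n -> R) (i : 'I_n) : R :=
  (-1) ^+ k.-1 * (\prod_(j < n | j != i) ('X - (lam j)%:P))`_(n - k).

Lemma char_poly_diag n (d : 'I_n -> R) :
  char_poly (\matrix_(i, j) (d i *+ (i == j)) : 'M[R]_n) = \prod_(i < n) ('X - (d i)%:P).
Proof.
rewrite char_poly_trig.
  by apply: eq_bigr => i _; rewrite !mxE eqxx.
by apply/is_trig_mxP => i j ij; rewrite mxE -val_eqE /= ltn_eqF.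
Qed.

Lemma sigmaM_diag_ray n k (lam : 'I_n -> R) (a : 'I_n) (t : R) : (0 < k)%N ->
  sigmaM k (\matrix_(i, j) ((lam i + t *+ (i == a)) *+ (i == j))) =
  sigmaM k (\matrix_(i, j) (lam i *+ (i == j))) + sigma_deriv k lam a * t.
Proof.
move=> k0; rewrite /sigmaM /sigma_deriv !char_poly_diag.
rewrite (bigD1 a) //= [in RHS](bigD1 a) //= eqxx.
rewrite (eq_bigr (fun j => 'X - (lam j)%:P)); last first.
  by move=> j /negPf ja; rewrite ja addr0.
set q := \prod_(_ < n | _) _.
have -> : ('X - (lam a + t *+ true)%:P) * q = ('X - (lam a)%:P) * q - t *: q.
  by rewrite polyCD opprD addrA mulrDl mulNr mul_polyC.
have -> : (-1) ^+ k = - (-1) ^+ k.-1 :> R by rewrite -{1}(prednK k0) exprS mulN1r.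
by rewrite coefB coefZ; ring.
Qed.
End SigmaCoef.

Section PolyfMatrix.
Variables (R : realType) (I : finType).

Definition polyfP (P : (I -> R) -> {poly R}) := forall j, polyf (fun z => (P z)`_j).

Lemma polyfPC g : polyf g -> polyfP (fun z => (g z)%:P).
Proof.
move=> h [|j]; under eq_fun do rewrite coefC /=; first exact: h.
exact: PolyCst.
Qed.

Lemma polyfP_cst (q : {poly R}) : polyfP (fun=> q).
Proof. by move=> j; exact: PolyCst. Qed.

Lemma polyfPD P Q : polyfP P -> polyfP Q -> polyfP (fun z => P z + Q z).
Proof. by move=> p q j; under eq_fun do rewrite coefD; exact: PolyAdd. Qed.

Lemma polyfPM P Q : polyfP P -> polyfP Q -> polyfP (fun z => P z * Q z).
Proof.
move=> p q j; under eq_fun do rewrite coefM.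
by apply: polyf_sum => i; exact: PolyMul.
Qed.

Lemma polyfP_sum (J : Type) (r : seq J) (A : pred J) (F : J -> (I -> R) -> {poly R}) :
  (forall j, polyfP (F j)) -> polyfP (fun z => \sum_(j <- r | A j) F j z).
Proof.
move=> h; elim: r => [|j r IH].
  by under eq_fun do rewrite big_nil; exact: polyfP_cst.
by under eq_fun do rewrite big_cons; case: (A j) => //; apply: polyfPD.
Qed.

Lemma polyfP_prod (J : Type) (r : seq J) (A : pred J) (F : J -> (I -> R) -> {poly R}) :
  (forall j, polyfP (F j)) -> polyfP (fun z => \prod_(j <- r | A j) F j z).
Proof.
move=> h; elim: r => [|j r IH].
  by under eq_fun do rewrite big_nil; exact: polyfP_cst.
by under eq_fun do rewrite big_cons; case: (A j) => //; apply: polyfPM.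
Qed.

Lemma polyf_sigmaM n k (A : (I -> R) -> 'M[R]_n) :
  (forall i j, polyf (fun z => A z i j)) -> polyf (fun z => sigmaM k (A z)).
Proof.
move=> hA; rewrite /sigmaM; apply: PolyMul; first exact: PolyCst.
suff : polyfP (fun z => \det (char_poly_mx (A z))) by apply.
rewrite /determinant.
apply: polyfP_sum => s; apply: polyfPM; first exact: polyfP_cst.
apply: polyfP_prod => i; under eq_fun do rewrite !mxE -polyCN.
apply: polyfPD; first exact: polyfP_cst.
by apply: polyfPC; exact: polyf_opp.
Qed.

Lemma polyf_mulmx n (A B : (I -> R) -> 'M[R]_n) :
  (forall i j, polyf (fun z => A z i j)) -> (forall i j, polyf (fun z => B z i j)) ->
  forall i j, polyf (fun z => (A z *m B z) i j).
Proof.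
move=> hA hB i j; under eq_fun do rewrite mxE.
by apply: polyf_sum => l; exact: PolyMul.
Qed.
End PolyfMatrix.

(** * Choice of the model eigenvalues *)

Section LambdaChoice.
Variable R : realType.

Lemma coef_XsubC_exp (t : R) m j : (j <= m)%N ->
  (('X - t%:P) ^+ m)`_j = (- t) ^+ (m - j) *+ 'C(m, j).
Proof.
move=> jm; rewrite -polyCN addrC exprDn coef_sum.
have jm1 : (j < m.+1)%N by [].
rewrite (bigD1 (Ordinal jm1)) //= big1 ?addr0.
  by rewrite coefMn -rmorphXn /= coefCM coefXn eqxx mulr1.
move=> i; rewrite -val_eqE /= => ij.
by rewrite coefMn -rmorphXn /= coefCM coefXn eq_sym (negPf ij) mulr0 mul0rn.
Qed.

(** With M = j + d + 1, the absorption identities give (j + 2)(d + 1) y z = d (j + 1) x^2 for the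
    consecutive binomials z, x, y. The strict inequality is what makes the S_i positive below. *)
Lemma binom_log_concave (M j : nat) : (j < M)%N ->
  ('C(M, j.+2) * 'C(M, j) < 'C(M, j.+1) ^ 2)%N.
Proof.
move=> jM; have x0 : (0 < 'C(M, j.+1))%N by rewrite bin_gt0.
have E1 := mul_bin_left M j; have E2 := mul_bin_left M j.+1.
have [d dE] : exists d, (M = j + d.+1)%N by exists (M - j).-1; lia.
subst M; move: E1 E2.
rewrite (_ : (j + d.+1 - j)%N = d.+1); last by lia.
rewrite (_ : (j + d.+1 - j.+1)%N = d); last by lia.
move: 'C(_, j.+2) 'C(_, j.+1) 'C(_, j) x0 => y x z x0 E1 E2.
have E : (j.+2 * d.+1 * (y * z) = d * j.+1 * x ^ 2)%N.
  rewrite (_ : (j.+2 * d.+1 * (y * z) = (j.+2 * y) * (d.+1 * z))%N); last by lia.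
  by rewrite E2 -E1 -mulnn; lia.
rewrite ltnNge; apply/negP => le.
have : (j.+2 * d.+1 * x ^ 2 <= d * j.+1 * x ^ 2)%N by rewrite -E leq_mul2l le orbT.
rewrite leq_pmul2r ?expn_gt0 ?x0 //; lia.
Qed.

(** With n = m + 2 and k = j + 2, sigma_k of (-a, t, ..., t) is affine in a with slope -D, which
    determines a. The derivative in the first entry is D itself; the others have the sign of (t X -
    a Z) D = t^k (X^2 - Y Z) + c Z, positive for large t. *)
Lemma lambda_choice n k (c : R) : (2 <= k)%N -> (k <= n - 1)%N ->
  exists lam : 'I_n -> R,
    sigmaM k (\matrix_(i, j) (lam i *+ (i == j)) : 'M[R]_n) = c /\
    forall i, 0 < sigma_deriv k lam i.
Proof.
case: n => [|[|m]]; try by case: k => [|[|k]].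
case: k => [|[|j]] // _; rewrite subn1 /= => jm.
pose X := 'C(m, j.+1); pose Y := 'C(m, j.+2); pose Z := 'C(m, j).
have XYZ : (Y * Z < X ^ 2)%N by apply: binom_log_concave.
have X0 : (0 < X)%N by rewrite bin_gt0.
(* Makes t - |c| Z = 1, a positive lower bound for the quantity that decides the sign of the
   remaining derivatives. *)
pose t : R := 1 + `|c| * Z%:R.
have t1 : 1 <= t by rewrite lerDl mulr_ge0.
have t0 : 0 < t by lra.
pose D : R := t ^+ j.+1 * (X + Z)%:R.
have XZ : (0 : R) < (X + Z)%:R by rewrite ltr0n addn_gt0 X0.
have D0 : 0 < D by rewrite mulr_gt0 // exprn_gt0.
pose a : R := (t ^+ j.+2 * (Y + X)%:R - c) / D.
pose lam (i : 'I_m.+2) : R := if i == ord0 then - a else t.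
have P : \prod_(i < m.+2) ('X - (lam i)%:P) = ('X + a%:P) * ('X - t%:P) ^+ m.+1.
  rewrite big_ord_recl /lam eqxx polyCN opprK; congr (_ * _).
  by rewrite (eq_bigr (fun=> 'X - t%:P)) ?prodr_const ?card_ord // => i _.
have P0 : \prod_(i < m.+2 | i != ord0) ('X - (lam i)%:P) = ('X - t%:P) ^+ m.+1.
  apply: (@mulfI _ ('X + a%:P)); first by rewrite -(opprK a) polyCN polyXsubC_eq0.
  by rewrite -P [RHS](bigD1 ord0) //= {2}/lam eqxx polyCN opprK.
have Pi i : i != ord0 ->
    \prod_(l < m.+2 | l != i) ('X - (lam l)%:P) = ('X + a%:P) * ('X - t%:P) ^+ m.
  move=> i0; apply: (@mulfI _ ('X - t%:P)); first by rewrite polyXsubC_eq0.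
  rewrite mulrCA -exprS -P [RHS](bigD1 i) //=; congr (('X - _%:P) * _).
  by rewrite /lam (negPf i0).
have sg q : (-1) ^+ q * (- t) ^+ q = t ^+ q.
  by rewrite -exprMn mulN1r opprK.
have coefXa (q : {poly R}) l : (('X + a%:P) * q)`_l.+1 = q`_l + a * q`_l.+1.
  by rewrite mulrDl coefD coefXM coefCM.
have B1 : 'C(m.+1, j.+2) = (Y + X)%N by rewrite binS.
have B2 : 'C(m.+1, j.+1) = (X + Z)%N by rewrite binS.
exists lam; split.
  rewrite /sigmaM char_poly_diag P.
  have -> : (m.+2 - j.+2)%N = (m.+1 - j.+2).+1 by lia.
  rewrite coefXa !coef_XsubC_exp; [|lia|lia].
  have -> : (m.+1 - (m.+1 - j.+2))%N = j.+2 by lia.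
  have -> : (m.+1 - (m.+1 - j.+2).+1)%N = j.+1 by lia.
  have -> : (m.+1 - j.+2).+1 = (m.+1 - j.+1)%N by lia.
  rewrite !bin_sub; [|lia|lia]; rewrite B1 B2.
  rewrite -[_ *+ (Y + X)]mulr_natr -[_ *+ (X + Z)]mulr_natr.
  have -> : (-1) ^+ j.+2 * ((- t) ^+ j.+2 * (Y + X)%:R + a * ((- t) ^+ j.+1 * (X + Z)%:R)) =
      t ^+ j.+2 * (Y + X)%:R - a * D.
    by rewrite /D -(sg j.+2) -(sg j.+1) !exprS; ring.
  by rewrite /a divfK ?gt_eqF //; ring.
move=> i; rewrite /sigma_deriv.
case: (eqVneq i ord0) => [->|i0].
  rewrite P0 coef_XsubC_exp; last by lia.
  have -> : (m.+1 - (m.+2 - j.+2))%N = j.+1 by lia.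
  have -> : (m.+2 - j.+2)%N = (m.+1 - j.+1)%N by lia.
  rewrite bin_sub; last by lia.
  by rewrite B2 mulrnAr sg -mulr_natr.
rewrite Pi //; have -> : (m.+2 - j.+2)%N = (m - j.+1).+1 by lia.
rewrite coefXa !coef_XsubC_exp; [|lia|lia].
have -> : (m - (m - j.+1))%N = j.+1 by lia.
have -> : (m - (m - j.+1).+1)%N = j by lia.
have -> : (m - j.+1).+1 = (m - j)%N by lia.
rewrite !bin_sub; [|lia|lia]; rewrite -/X -/Z.
have -> : (-1) ^+ j.+1 * ((- t) ^+ j.+1 *+ X + a * ((- t) ^+ j *+ Z)) =
    t ^+ j * (t * X%:R - a * Z%:R).
  by rewrite -(sg j) -[_ *+ X]mulr_natr -[_ *+ Z]mulr_natr !exprS; ring.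
rewrite mulr_gt0 ?exprn_gt0 // -(pmulr_lgt0 _ D0).
have -> : (t * X%:R - a * Z%:R) * D = t ^+ j.+2 * ((X ^ 2)%:R - (Y * Z)%:R) + c * Z%:R.
  have aD : a * D = t ^+ j.+2 * (Y + X)%:R - c by rewrite /a divfK ?gt_eqF.
  transitivity (t * X%:R * D - a * D * Z%:R); first by ring.
  by rewrite aD /D !natrD natrX natrM (exprS t j.+1); ring.
have B : (1 : R) <= (X ^ 2)%:R - (Y * Z)%:R.
  by rewrite lerBrDl natr1 ler_nat.
have tj : t <= t ^+ j.+2 by rewrite exprS ler_peMr ?exprn_ege1 // ltW.
have h1 : t <= t ^+ j.+2 * ((X ^ 2)%:R - (Y * Z)%:R).
  by apply: (le_trans tj); rewrite ler_peMr // exprn_ge0 // ltW.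
have h2 : - (`|c| * Z%:R) <= c * Z%:R by rewrite -mulNr ler_wpM2r // lerNnormlW.
by move: h1; set w := t ^+ j.+2 * _ => h1; rewrite /t in h1; lra.
Qed.
End LambdaChoice.

(** * The polynomial form of the curvature equation and its linear part *)

Section CurvatureExpansion.
Variables (R : realType) (n k : nat) (lam : 'I_n -> R) (psi0 : R).

(* Unknowns of the pointwise equation: the gradient, the perturbation of the
   Hessian, the excess of sqrt(1 + |grad u|^2) over 1 (index [inr true]) and
   that of the right-hand side over its value at 0 (index [inr false]). *)
Definition jet : finType := ('I_n + 'I_n * 'I_n + bool)%type.
Definition jp (i : 'I_n) : jet := inl (inl i).
Definition jB (i j : 'I_n) : jet := inl (inr (i, j)).
Definition jw : jet := inr true.
Definition jpsi : jet := inr false.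

Definition jhess (z : jet -> R) : 'M[R]_n :=
  \matrix_(i, j) (lam i *+ (i == j) + z (jB i j)).

Definition curv_poly (z : jet -> R) : R :=
  sigmaM k (grad_coform (fun i => z (jp i)) *m jhess z).

(** With W = 1 + w = sqrt (1 + |p|^2), the curvature matrix is W^-3 times [grad_coform p] times the
    Hessian: W^-2 from the inverse metric, W^-1 from the second form. Homogeneity of degree k gives
    the power 3 k. *)
Definition rhs_poly (z : jet -> R) : R := (1 + z jw) ^+ (3 * k) * (psi0 + z jpsi).

Lemma polyf_curv : polyf curv_poly.
Proof.
apply: polyf_sigmaM; apply: polyf_mulmx => i j.
  under eq_fun do rewrite mxE; apply: polyf_sub.
    apply: PolyMul; last exact: PolyCst.
    apply: PolyAdd; first exact: PolyCst.
    by apply: polyf_sum => l; apply: polyf_exp; exact: PolyVar.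
  by apply: PolyMul; exact: PolyVar.
by under eq_fun do rewrite mxE; apply: PolyAdd; [exact: PolyCst|exact: PolyVar].
Qed.

Lemma polyf_rhs : polyf rhs_poly.
Proof.
by apply: PolyMul; [apply: polyf_exp|]; apply: PolyAdd; (exact: PolyCst || exact: PolyVar).
Qed.

Lemma grad_coform0 : grad_coform (fun _ : 'I_n => 0 : R) = 1%:M.
Proof.
apply/matrixP => i j; rewrite !mxE mul0r subr0 big1 ?addr0 ?mul1r //.
by move=> l _; rewrite expr0n.
Qed.

Lemma grad_coformN (p : 'I_n -> R) : grad_coform (fun i => - p i) = grad_coform p.
Proof.
apply/matrixP => i j; rewrite !mxE mulrNN; congr ((1 + _) * _ - _).
by apply: eq_bigr => l _; rewrite sqrrN.
Qed.

Lemma curv_flat (z : jet -> R) : (forall i, z (jp i) = 0) -> curv_poly z = sigmaM k (jhess z).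
Proof.
move=> h; rewrite /curv_poly (_ : (fun i => z (jp i)) = fun=> 0); last by apply/funext.
by rewrite grad_coform0 mul1mx.
Qed.

Lemma curv0 : curv_poly (fun=> 0) = sigmaM k (\matrix_(i, j) (lam i *+ (i == j)) : 'M[R]_n).
Proof.
rewrite curv_flat //; congr sigmaM; apply/matrixP => i j.
by rewrite !mxE addr0.
Qed.

Lemma pow_expand (K : nat) : exists2 C : R, 0 <= C & forall t, 0 < t -> t <= 1 ->
  `|(1 + t) ^+ K - 1 - K%:R * t| <= C * t ^+ 2.
Proof.
elim: K => [|K [C C0 IH]].
  by exists 0 => // t _ _; rewrite expr0 subrr mul0r subrr normr0 mul0r.
exists (2 * C + K%:R) => [|t t0 t1]; first by rewrite addr_ge0 // mulr_ge0.
have -> : (1 + t) ^+ K.+1 - 1 - K.+1%:R * t =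
  (1 + t) * ((1 + t) ^+ K - 1 - K%:R * t) + K%:R * t ^+ 2.
  by rewrite exprS -natr1; ring.
apply: le_trans (ler_normD _ _) _; rewrite normrM mulrDl.
rewrite (ger0_norm (_ : 0 <= 1 + t)); last lra.
rewrite (ger0_norm (_ : 0 <= K%:R * t ^+ 2)); last by rewrite mulr_ge0 // sqr_ge0.
rewrite lerD2r -mulrA; apply: ler_pM => //; [lra|lra|exact: IH].
Qed.

Definition lin_coef (a : jet) : R := match a with
  | inl (inl _) => 0
  | inl (inr (i, j)) => sigma_deriv k lam i *+ (i == j)
  | inr true => - ((3 * k)%:R * psi0)
  | inr false => - 1
  end.

Lemma sum_lin_coef z : \sum_a lin_coef a * z a =
  \sum_i sigma_deriv k lam i * z (jB i i) - (3 * k)%:R * psi0 * z jw - z jpsi.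
Proof.
rewrite big_sumType /= big_sumType /= big_bool /= big1 ?add0r => [|i _]; last by rewrite mul0r.
rewrite mulN1r mulNr addrA; congr (_ - _ - _).
rewrite (eq_bigr (fun p : 'I_n * 'I_n => (sigma_deriv k lam p.1 *+ (p.1 == p.2)) * z (jB p.1 p.2)));
  last by case.
rewrite -(pair_bigA _ (fun i j => (sigma_deriv k lam i *+ (i == j)) * z (jB i j))) /=.
apply: eq_bigr => i _; rewrite (bigD1 i) //= eqxx big1 ?addr0 // => j ji.
by rewrite eq_sym (negPf ji) mul0r.
Qed.

Hypothesis k_gt0 : (0 < k)%N.
Hypothesis lam_psi0 : sigmaM k (\matrix_(i, j) (lam i *+ (i == j)) : 'M[R]_n) = psi0.

(** Evenness in p kills the gradient coefficients, an off-diagonal entry leaves the matrix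
    triangular, and in a diagonal entry sigma_k is affine with slope [sigma_deriv]. *)
Lemma curv_poly_lin c l : expands curv_poly c l ->
  forall a, l a = match a with inl b => lin_coef (inl b) | inr _ => 0 end.
Proof.
have E0 (b : bool) t : basis_ray (inr b : jet) t = fun a => (a == inr b)%:R * t by [].
move=> E [[i|[i j]]|b].
- apply: (expands_even E) => t; rewrite /curv_poly.
  have -> : jhess (basis_ray (inl (inl i)) (- t)) = jhess (basis_ray (jp i) t).
    by apply/matrixP => i' j'; rewrite !mxE /basis_ray /= !mul0r.
  rewrite (_ : (fun i' => basis_ray (inl (inl i) : jet) (- t) (jp i')) =
    fun i' => - basis_ray (jp i) t (jp i')) ?grad_coformN //.
  by apply/funext => i'; rewrite /basis_ray mulrN.
- apply: (expands_lin E); exists 0 => t t0 t1; rewrite mul0r normr_le0.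
  have pz i' : basis_ray (inl (inr (i, j)) : jet) t (jp i') = 0 by rewrite /basis_ray mul0r.
  rewrite (curv_flat pz) curv0 /=.
  have hE : jhess (basis_ray (jB i j) t) = \matrix_(i', j') (lam i' *+ (i' == j') +
      t *+ ((i' == i) && (j' == j))).
    apply/matrixP => i' j'; rewrite !mxE /basis_ray.
    rewrite (_ : (jB i' j' == jB i j) = ((i' == i) && (j' == j))) //.
    by rewrite mulr_natl.
  rewrite hE; case: (eqVneq i j) => [<-|ij]; last first.
    by rewrite sigmaM_offdiag // subrr mul0r subrr.
  rewrite (_ : (\matrix_(_, _) _) = \matrix_(i', j') ((lam i' + t *+ (i' == i)) *+ (i' == j'))).
    by rewrite sigmaM_diag_ray // subr_eq0 addrC addKr.
  apply/matrixP => i' j'; rewrite !mxE mulrnDl; congr (_ + _).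
  case: (eqVneq i' j') => [<-|ne]; first by rewrite andbb.
  rewrite mulr0n (_ : _ && _ = false) //; apply/negP => /andP[/eqP e1 /eqP e2].
  by rewrite e1 e2 eqxx in ne.
- apply: (expands_lin E); exists 0 => t t0 t1; rewrite !mul0r subr0 normr_le0.
  have pz i' : basis_ray (inr b : jet) t (jp i') = 0 by rewrite /basis_ray mul0r.
  rewrite (curv_flat pz) curv0 subr_eq0; apply/eqP; congr sigmaM.
  by apply/matrixP => i' j'; rewrite !mxE /basis_ray mul0r addr0.
Qed.

Lemma rhs_poly_lin c l : expands rhs_poly c l ->
  forall a, l a = match a with inl b => 0 | inr b => - lin_coef (inr b) end.
Proof.
move=> E [b|[]]; apply: (expands_lin E).
- exists 0 => t t0 t1; rewrite /rhs_poly /basis_ray /= !mul0r.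
  by rewrite !addr0 subrr subr0 normr0.
- have [C C0 HC] := pow_expand (3 * k); exists (C * `|psi0|) => t t0 t1.
  rewrite /rhs_poly /basis_ray /= mul1r mul0r !addr0 expr1n mul1r opprK.
  have -> : (1 + t) ^+ (3 * k) * psi0 - psi0 - (3 * k)%:R * psi0 * t =
    ((1 + t) ^+ (3 * k) - 1 - (3 * k)%:R * t) * psi0 by ring.
  by rewrite normrM mulrAC ler_wpM2r // HC.
- exists 0 => t t0 t1; rewrite /rhs_poly /basis_ray /= mul1r mul0r !addr0 expr1n !mul1r opprK.
  rewrite [X in `|X|](_ : _ = 0); last by ring.
  by rewrite normr0 ?mul0r.
Qed.

Lemma curv_expand : exists Q, vanish 2 Q /\ forall z,
  curv_poly z - rhs_poly z = \sum_i sigma_deriv k lam i * z (jB i i)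
    - (3 * k)%:R * psi0 * z jw - z jpsi + Q z.
Proof.
have [c1 [l1 E1]] := polyf_expands polyf_curv.
have [c2 [l2 E2]] := polyf_expands polyf_rhs.
have L1 := curv_poly_lin E1; have L2 := rhs_poly_lin E2.
have C1 := expands_cst E1; have C2 := expands_cst E2.
rewrite curv0 lam_psi0 in C1.
rewrite /rhs_poly !addr0 expr1n mul1r in C2.
exists (fun z => (curv_poly z - c1 - \sum_a l1 a * z a) +
   (-1) * (rhs_poly z - c2 - \sum_a l2 a * z a)); split.
  by apply: vanishD => //; apply: vanishZ.
move=> z; rewrite -sum_lin_coef.
have -> : \sum_a lin_coef a * z a = \sum_a l1 a * z a - \sum_a l2 a * z a.
  rewrite -sumrB; apply: eq_bigr => a _; rewrite -mulrBl L1 L2; congr (_ * _).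
  by case: a => [b|b]; rewrite ?subr0 // sub0r opprK.
by rewrite -C1 -C2; ring.
Qed.

End CurvatureExpansion.

(** * Discretised equation *)

Section DiscreteOperators.
Variables (R : realType) (n M : nat) (lam S : 'I_n -> R) (eps s0 : R).
Local Notation grid := (grid n M).
Hypotheses (n0 : (0 < n)%N) (s0_gt0 : 0 < s0) (S_ge : forall i, s0 <= S i).
Hypotheses (eps_gt0 : 0 < eps) (eps_le1 : eps <= 1).

(** Symbol of minus sum_i S_i d_ii; the lower bound [s0] of the S_i makes it dominate each squared
    frequency. *)
Definition symb (m : grid) : R := \sum_i S i * (cen m i)%:~R ^+ 2.
Definition trS : R := \sum_i S i.
Definition zmode : grid := red M (fun=> 0).

(* The zero Fourier mode of [f] is not in the range of the operator
   sum_i S i d_ii on the torus; it is carried by the quadratic polynomial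
   coef f 0 |x|^2 / (2 trS). *)
Definition Jop i (f : grid -> R) (x : grid) : R :=
  \sum_m (- (eps * (cen m i)%:~R / symb m) * coef f m) * ch R (fun j => - cen m j) x.
Definition Kop i j (f : grid -> R) (x : grid) : R :=
  \sum_m (((cen m i)%:~R * (cen m j)%:~R / symb m +
    (trS^-1 *+ (i == j)) *+ (m == zmode)) * coef f m) * ch R (cen m) x.

Lemma cen_zmode i : cen zmode i = 0.
Proof. by apply/eqP; rewrite -normr_le0 -(normr0 int) cen_red_le. Qed.

Lemma S_gt0 i : 0 < S i. Proof. exact: lt_le_trans (S_ge i). Qed.

Lemma symb_ge (m : grid) i : s0 * (cen m i)%:~R ^+ 2 <= symb m.
Proof.
rewrite /symb (bigD1 i) //= -[leLHS]addr0 lerD //.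
  by rewrite ler_wpM2r ?sqr_ge0.
by apply: sumr_ge0 => j _; rewrite mulr_ge0 ?sqr_ge0 // ltW // S_gt0.
Qed.

Lemma symb_ge0 m : 0 <= symb m.
Proof. by apply: le_trans (symb_ge m (Ordinal n0)); rewrite mulr_ge0 ?sqr_ge0 // ltW. Qed.

Lemma trS_ge : s0 <= trS.
Proof.
apply: le_trans (S_ge (Ordinal n0)) _; rewrite /trS (bigD1 (Ordinal n0)) //= lerDl.
by apply: sumr_ge0 => j _; rewrite ltW // S_gt0.
Qed.

Lemma trSV_le : 0 <= trS^-1 <= s0^-1.
Proof.
have h := trS_ge; have t0 : 0 < trS by exact: lt_le_trans h.
by rewrite invr_ge0 (ltW t0) lef_pV2.
Qed.

Lemma symb_eq0 m : (symb m == 0) = (m == zmode).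
Proof.
apply/eqP/eqP => [h|->]; last first.
  by rewrite /symb big1 // => i _; rewrite cen_zmode expr0n mulr0.
apply: cen_inj; apply/funext => i; rewrite cen_zmode; apply/eqP.
have := symb_ge m i; rewrite h pmulr_rle0 // => h2.
have : ((cen m i)%:~R : R) ^+ 2 == 0 by rewrite eq_le h2 sqr_ge0.
by rewrite sqrf_eq0 intr_eq0.
Qed.

(** One bound for all multipliers: a and b are frequencies or eps, which is at most 1 and so at most
    any nonzero frequency. Where [symb] vanishes the quotient is 0 by the convention for
    division. *)
Lemma mode_quot_le m (a b : R) : a ^+ 2 <= symb m / s0 -> b ^+ 2 <= symb m / s0 ->
  `|a * b / symb m| <= s0^-1.
Proof.
move=> ha hb; have [s0E|sn] := eqVneq (symb m) 0.
  by rewrite s0E invr0 mulr0 normr0 invr_ge0 ltW.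
have sp : 0 < symb m by rewrite lt_neqAle eq_sym sn symb_ge0.
rewrite normrM normfV (gtr0_norm sp) ler_pdivrMr // [leRHS]mulrC normrM.
have q0 : 0 <= symb m / s0 by rewrite divr_ge0 // ltW.
suff h : (`|a| * `|b|) ^+ 2 <= (symb m / s0) ^+ 2.
  by rewrite -(@ler_pXn2r _ 2) // nnegrE // mulr_ge0.
rewrite exprMn (expr2 (symb m / s0)).
by apply: ler_pM; rewrite ?sqr_ge0 // real_normK ?num_real.
Qed.

Lemma cen_sq_le m i : ((cen m i)%:~R : R) ^+ 2 <= symb m / s0.
Proof. by rewrite ler_pdivlMr // mulrC symb_ge. Qed.

Lemma Jmult_le i m : `|- (eps * (cen m i)%:~R / symb m)| <= s0^-1.
Proof.
rewrite normrN; have [s0E|sn] := eqVneq (cen m i) 0.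
  by rewrite s0E mulr0 mul0r normr0 invr_ge0 ltW.
apply: mode_quot_le; last exact: cen_sq_le.
apply: le_trans (cen_sq_le m i); apply: (@le_trans _ _ 1).
  by rewrite expr_le1 // ltW.
rewrite -[leRHS]real_normK ?num_real // -intr_norm exprn_ege1 //.
by rewrite -[1]/(1%:~R) ler_int -gtz0_ge1 normr_gt0.
Qed.

Lemma Kmult_le i j m : `|(cen m i)%:~R * (cen m j)%:~R / symb m +
    (trS^-1 *+ (i == j)) *+ (m == zmode)| <= 2 * s0^-1.
Proof.
apply: le_trans (ler_normD _ _) _; rewrite mulrDl mul1r lerD //.
  by apply: mode_quot_le; exact: cen_sq_le.
have /andP[t1 t2] := trSV_le.
have s1 : 0 <= s0^-1 by rewrite invr_ge0 ltW.
by case: (i == j); case: (m == zmode); rewrite ?mulr1n ?mulr0n ?mul0rn ?normr0 // ger0_norm.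
Qed.

Section Norms.
Variables (eta : R) (q : nat).
Hypothesis eta0 : 0 <= eta.
Local Notation nu := (@nrm R n M eta q).

Lemma nrm_mult (c : grid -> R) (k : grid -> 'I_n -> int) (B : R) (f : grid -> R) :
  (forall m, `|c m| <= B) -> (forall m i, `|k m i| <= `|cen m i|) ->
  nu (fun x => \sum_m (c m * coef f m) * ch R (k m) x) <= B * nu f.
Proof.
move=> cB kc; apply: le_trans (nrm_trig M q eta0 _ _) _.
rewrite mulr_sumr; apply: ler_sum => m _; rewrite normrM mulrA.
apply: ler_pM; rewrite ?mulr_ge0 ?wt_ge0 //; last exact: wt_le.
by rewrite ler_wpM2r.
Qed.

Lemma nrm_Jop i f : nu (Jop i f) <= s0^-1 * nu f.
Proof.
by apply: nrm_mult => [m|m j]; [exact: Jmult_le|rewrite normrN].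
Qed.

Lemma nrm_Kop i j f : nu (Kop i j f) <= 2 * s0^-1 * nu f.
Proof. by apply: nrm_mult => [m|m l //]; exact: Kmult_le. Qed.
End Norms.

Lemma hcoefB (f g : grid -> R) m : coef (fun x => f x - g x) m = coef f m - coef g m.
Proof.
rewrite (_ : (fun x => f x - g x) = (fun x => f x + (-1) * g x)).
  by rewrite hcoefD hcoefZ mulN1r.
by apply/funext => x; rewrite mulN1r.
Qed.

Lemma JopB i f g x : Jop i f x - Jop i g x = Jop i (fun y => f y - g y) x.
Proof.
rewrite /Jop -sumrB; apply: eq_bigr => m _; rewrite hcoefB; ring.
Qed.

Lemma KopB i j f g x : Kop i j f x - Kop i j g x = Kop i j (fun y => f y - g y) x.
Proof.
rewrite /Kop -sumrB; apply: eq_bigr => m _; rewrite hcoefB.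
by rewrite -mulrBl -mulrBr.
Qed.

(** Nonzero modes give symb / symb = 1. At the zero mode that quotient is 0, and the added trS^-1
    sums to trS / trS = 1. *)
Lemma Kop_trace f x : \sum_i S i * Kop i i f x = f x.
Proof.
under eq_bigr do rewrite /Kop mulr_sumr.
rewrite exchange_big [RHS]coef_inv; apply: eq_bigr => m _ /=.
under eq_bigr do rewrite mulrA mulrA.
rewrite -!mulr_suml; congr (_ * _); rewrite -[RHS]mul1r; congr (_ * _).
have t0 : trS != 0 by rewrite gt_eqF // (lt_le_trans s0_gt0 trS_ge).
under eq_bigr do rewrite eqxx mulr1n mulrDr.
rewrite big_split /=.
have -> : \sum_i S i * ((cen m i)%:~R * (cen m i)%:~R / symb m) = symb m / symb m.
  by rewrite {2}/symb mulr_suml; apply: eq_bigr => i _; rewrite -expr2 mulrA.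
rewrite -mulr_suml -/trS -symb_eq0; case: eqP => [->|/eqP sn].
  by rewrite mul0r add0r mulr1n mulfV.
by rewrite mulfV // mulr0n mulr0 addr0.
Qed.

(** The jet of u = sum_i (lam_i + coef f 0 / trS) x_i^2 / 2 plus a periodic part. In the gradient,
    x_i is replaced by the small periodic function [xi i]; the constant Hessian diag lam is added in
    [jhess]. *)
Definition jetz (xi : 'I_n -> grid -> R) (Psi f s : grid -> R) (a : jet n) : grid -> R :=
  match a with
  | inl (inl i) => fun x => (lam i + coef f zmode / trS) * xi i x + Jop i f x
  | inl (inr (i, j)) => Kop i j f
  | inr true => s
  | inr false => Psi
  end.

Definition jet_cst : R := 1 + \sum_i `|lam i| + 3 * s0^-1.

Lemma jet_cst_ge1 : 1 <= jet_cst.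
Proof.
rewrite /jet_cst -addrA lerDl addr_ge0 ?sumr_ge0 // mulr_ge0 // invr_ge0 ltW //.
Qed.

Section JetBounds.
Variables (eta : R) (q : nat) (rho : R) (xi : 'I_n -> grid -> R) (Psi : grid -> R).
Hypotheses (eta0 : 0 <= eta) (rho0 : 0 < rho) (rho1 : rho <= 1).
Local Notation nu := (@nrm R n M eta q).
Hypotheses (xiB : forall i, nu (xi i) <= rho) (PsiB : nu Psi <= rho).

Lemma jetz_bound f s : nu f <= rho -> nu s <= rho ->
  forall a, nu (jetz xi Psi f s a) <= jet_cst * rho.
Proof.
have L i : `|lam i| <= \sum_i `|lam i| by rewrite (bigD1 i) //= lerDl sumr_ge0.
have L0 : 0 <= \sum_i `|lam i| by apply: sumr_ge0.
have s1 : 0 <= s0^-1 by rewrite invr_ge0 ltW.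
have /andP[t1 t2] := trSV_le.
have r0 := ltW rho0.
have J1 : rho <= jet_cst * rho by rewrite ler_peMl // jet_cst_ge1.
move=> fB sB [[i|[i j]]|[]] /=; last 2 first.
- exact: le_trans J1.
- exact: le_trans J1.
- apply: le_trans (nrmD q eta0 _ _) _ => //; rewrite nrmZ //.
  (* The product of the zero mode with [xi i] is quadratic; [rho <= 1] makes it linear in rho. *)
  have c1 : `|lam i + coef f zmode / trS| <= \sum_i `|lam i| + s0^-1.
    apply: le_trans (ler_normD _ _) _; apply: lerD => //.
    rewrite normrM (ger0_norm t1) -[leRHS]mul1r; apply: ler_pM => //.
    by apply: le_trans (coef_le_nrm q eta0 f zmode) _; exact: le_trans fB rho1.
  have h1 := ler_pM (normr_ge0 _) (nrm_ge0 q eta0 _) c1 (xiB i).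
  have h2 := nrm_Jop q eta0 i f.
  have h3 := ler_wpM2l s1 fB.
  have h4 : 0 <= s0^-1 * rho by rewrite mulr_ge0.
  by rewrite /jet_cst; lra.
apply: le_trans (nrm_Kop q eta0 i j f) _.
have h3 : 2 * s0^-1 * nu f <= 2 * s0^-1 * rho by rewrite ler_wpM2l // mulr_ge0.
apply: (le_trans h3); rewrite ler_wpM2r // /jet_cst; lra.
Qed.

Lemma jetz_lip f s f' s' d : nu (fun x => f x - f' x) <= d ->
  nu (fun x => s x - s' x) <= d -> forall a,
  nu (fun x => jetz xi Psi f s a x - jetz xi Psi f' s' a x) <= jet_cst * d.
Proof.
have L0 : 0 <= \sum_i `|lam i| by apply: sumr_ge0.
have s1 : 0 <= s0^-1 by rewrite invr_ge0 ltW.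
have /andP[t1 t2] := trSV_le.
move=> fB sB; have d0 : 0 <= d by apply: le_trans fB; exact: nrm_ge0.
have J1 : d <= jet_cst * d by rewrite ler_peMl // jet_cst_ge1.
move=> [[i|[i j]]|[]] /=; last 2 first.
- exact: le_trans J1.
- by under eq_fun do rewrite subrr; rewrite nrm0 // mulr_ge0 // (le_trans _ jet_cst_ge1).
- have -> : (fun x => (lam i + coef f zmode / trS) * xi i x + Jop i f x -
      ((lam i + coef f' zmode / trS) * xi i x + Jop i f' x)) =
    (fun x => (coef (fun y => f y - f' y) zmode / trS) * xi i x + Jop i (fun y => f y - f' y) x).
    by apply/funext => x; rewrite -JopB hcoefB; ring.
  apply: le_trans (nrmD q eta0 _ _) _ => //; rewrite nrmZ //.
  have c1 : `|coef (fun y => f y - f' y) zmode / trS| <= d * s0^-1.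
    rewrite normrM (ger0_norm t1); apply: ler_pM => //.
    exact: le_trans (coef_le_nrm q eta0 _ zmode) _.
  have h1 := ler_pM (normr_ge0 _) (nrm_ge0 q eta0 _) c1 (le_trans (xiB i) rho1).
  have h2 := nrm_Jop q eta0 i (fun y => f y - f' y).
  have h3 := ler_wpM2l s1 fB.
  have h4 : 0 <= s0^-1 * d by rewrite mulr_ge0.
  have h5 : 0 <= (\sum_i `|lam i|) * d by rewrite mulr_ge0.
  by rewrite /jet_cst; lra.
under eq_fun do rewrite KopB.
apply: le_trans (nrm_Kop q eta0 i j _) _.
have h3 : 2 * s0^-1 * nu (fun x => f x - f' x) <= 2 * s0^-1 * d by rewrite ler_wpM2l // mulr_ge0.
apply: (le_trans h3); rewrite ler_wpM2r // /jet_cst; lra.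
Qed.
End JetBounds.

Section Potential.
Variable f : grid -> R.

(** Coefficients of the periodic part of u. In x = eps y its frequencies are m / eps, so eps^2
    brings second derivatives back to the multipliers of [Kop]; the coefficient at the zero mode is
    0. *)
Definition potential (m : grid) : R := - (eps ^+ 2 * (coef f m / symb m)).

Lemma potential_le m : `|potential m| <= s0^-1 * `|coef f m|.
Proof.
have s1 : 0 <= s0^-1 by rewrite invr_ge0 ltW.
rewrite /potential normrN; have [s0E|sn] := eqVneq (symb m) 0.
  by rewrite s0E invr0 !mulr0 normr0 mulr_ge0.
have [i ci] : exists i, cen m i != 0.
  apply: contrapT => /forallNP al; case/eqP: sn; rewrite /symb big1 // => i _.
  have /negP := al i; rewrite negbK => /eqP ->.
  by rewrite expr0n mulr0.
have c1 : 1 <= symb m / s0.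
  apply: le_trans (cen_sq_le m i); rewrite -[leRHS]real_normK ?num_real //.
  rewrite -intr_norm exprn_ege1 //.
  by rewrite -[1]/(1%:~R) ler_int -gtz0_ge1 normr_gt0.
have e2 : eps ^+ 2 <= symb m / s0 by apply: le_trans c1; rewrite expr_le1 // ltW.
have -> : eps ^+ 2 * (coef f m / symb m) = eps * eps / symb m * coef f m by ring.
by rewrite normrM ler_wpM2r // mode_quot_le.
Qed.

Lemma argm_gpt (m x : grid) : argm eps^-1 m (eps *: gpt R x) = phase R (cen m) x.
Proof.
rewrite /argm /phase /dot rmorph_sum mulr_sumr; apply: eq_bigr => i _ /=.
rewrite !mxE rmorphM /=; move: (2 * pi / _) => hh.
have e0 : eps != 0 by rewrite gt_eqF.
by field.
Qed.

(** The source of the reflected frequencies in [Jop]: a first derivative turns cas t into cas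
    (-t). *)
Lemma cas_pihalf (t : R) : cas (t + pi / 2) = cas (- t).
Proof. by rewrite /cas cosDpihalf sinDpihalf cosN sinN addrC. Qed.

Lemma cas_pi2 (t : R) : cas (t + 2 * (pi / 2)) = - cas t.
Proof.
have -> : t + 2 * (pi / 2) = t + pi / 2 + pi / 2 by ring.
by rewrite /cas !cosDpihalf !sinDpihalf cosDpihalf; ring.
Qed.

Lemma trigp_Jop i x : trigp eps^-1 potential [:: i] (eps *: gpt R x) = Jop i f x.
Proof.
apply: eq_bigr => m _; rewrite big_seq1 argm_gpt /= mul1r cas_pihalf.
rewrite -(@phaseN R n M (cen m) (fun j => - cen m j)) // /ch /potential.
congr (_ * _).
have e0 : eps != 0 by rewrite gt_eqF.
by rewrite expr2; move: (symb m)^-1 => v; field.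
Qed.

Lemma trigp_Kop i j x : trigp eps^-1 potential [:: i; j] (eps *: gpt R x) +
  (coef f zmode / trS) *+ (i == j) = Kop i j f x.
Proof.
rewrite /Kop; under [RHS]eq_bigr do rewrite !mulrDl.
rewrite big_split /=; congr (_ + _).
  apply: eq_bigr => m _; rewrite !big_cons big_nil argm_gpt /= cas_pi2 /ch /potential.
  have e0 : eps != 0 by rewrite gt_eqF.
  by rewrite !expr2 mulr1; move: (symb m)^-1 => v; field.
rewrite (bigD1 zmode) //= eqxx big1 ?addr0 => [|m /negPf ->]; last by rewrite mulr0n !mul0r.
have -> : ch R (cen zmode) x = 1 by rewrite -(@ch0 R n M x); congr ch; apply/funext => l; exact: cen_zmode.
by rewrite mulr1n mulr1; case: (i == j); rewrite ?mulr1n ?mulr0n ?mul0r // mulrC.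
Qed.
End Potential.

End DiscreteOperators.

Lemma pos_lower_bound (R : realType) n (S : 'I_n -> R) : (forall i, 0 < S i) ->
  exists2 s0 : R, 0 < s0 & forall i, s0 <= S i.
Proof.
move=> S0; have I0 : 0 <= \sum_i (S i)^-1 by apply: sumr_ge0 => i _; rewrite invr_ge0 ltW.
exists (\sum_i (S i)^-1 + 1)^-1 => [|i]; first by rewrite invr_gt0 ltr_wpDl.
rewrite -[leRHS]invrK lef_pV2 ?posrE ?invr_gt0 ?ltr_wpDl //.
apply: (@le_trans _ _ (\sum_i (S i)^-1)); last by rewrite lerDl.
by rewrite (bigD1 i) //= lerDl sumr_ge0 // => j _; rewrite invr_ge0 ltW.
Qed.

Section NearGrid.
Variables (R : realType) (n M : nat).
Local Notation h := (2 * pi / (M.*2.+1)%:R : R).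

(** Rounds y_i / h. As |y_i| <= 1/2, this quotient is at most (2 M + 1) / 8 in absolute value, so
    the rounded index stays in [-M, M]. *)
Lemma gpt_near (y : 'rV[R]_n) : (forall i, `|y 0 i| <= 2^-1) ->
  exists g : grid n M, forall i, `|y 0 i - gpt R g 0 i| <= h.
Proof.
move=> yb.
have p2 := pi_ge2 R; have p0 := pi_gt0 R.
have N0 : 0 < ((M.*2.+1)%:R : R) by rewrite ltr0n.
have NE : ((M.*2.+1)%:R : R) = 2 * M%:R + 1 by rewrite -natr1 -mul2n natrM.
have h0 : 0 < h by rewrite divr_gt0 // mulr_gt0.
pose q i := y 0 i / h; pose kk i : int := Num.floor (q i + 2^-1).
have qb i : `|q i| <= (2 * M%:R + 1) / 8.
  rewrite /q normrM normfV (gtr0_norm h0) ler_pdivrMr //.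
  have -> : (2 * M%:R + 1) / 8 * h = pi / 4.
    by rewrite -NE; move: (pi : R) => p; field; rewrite nat1r pnatr_eq0.
  by apply: le_trans (yb i) _; lra.
have M0 : 0 <= (M%:R : R) by [].
have kb i : ((kk i)%:~R <= q i + 2^-1) && (q i + 2^-1 < (kk i)%:~R + 1).
  by have := floor_itv (q i + 2^-1); rewrite intrD.
have kM i : - M%:Z <= kk i <= M%:Z.
  have /andP[k1 k2] := kb i; have := qb i; rewrite ler_norml => /andP[q1 q2].
  have l1 : (- (M%:R : R) - 1 < (kk i)%:~R) by lra.
  have l2 : ((kk i)%:~R < M%:R + 1 :> R) by lra.
  have e1 : - (M%:R : R) - 1 = (- M%:Z - 1)%:~R by rewrite intrB intrN.
  have e2 : (M%:R : R) + 1 = (M%:Z + 1)%:~R by rewrite intrD.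
  by move: l1 l2; rewrite e1 e2 !ltr_int; move: (kk i) => z; lia.
have ck i : cen (red M kk) i = kk i.
  rewrite cen_redE divz_small ?mulr0 ?subr0 //.
  have := kM i; move: (kk i) => z.
  have -> : (M.*2.+1)%:Z = 2 * M%:Z + 1 by rewrite -addn1 -mul2n PoszD PoszM.
  by lia.
exists (red M kk) => i; rewrite mxE ck.
have -> : y 0 i - h * (kk i)%:~R = h * (q i - (kk i)%:~R).
  by rewrite [RHS]mulrBr /q [h * (_ / _)]mulrC divfK // gt_eqF.
rewrite normrM (gtr0_norm h0) ler_piMr ?(ltW h0) //.
have /andP[k1 k2] := kb i; rewrite ler_norml; apply/andP; split; lra.
Qed.
End NearGrid.

Section CoordinateFamilies.
Variables (R : realType) (n : nat).
Local Notation e i := (delta_mx 0 i : 'rV[R]_n).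

Definition coord_fam (i : 'I_n) (s : seq 'I_n) (x : 'rV[R]_n) : R :=
  match s with [::] => x 0 i | [:: j] => (i == j)%:R | _ => 0 end.

Lemma coord_smooth i : smooth_fam (coord_fam i).
Proof.
apply: (@taylor_smooth_fam _ _ _ (fun=> 1)) => [s j x h _|s x y].
  rewrite mul1r [X in `|X|](_ : _ = 0) ?normr0 ?sqr_ge0 //.
  case: s => [|l [|l' s]] /=; rewrite ?mxE ?eqxx /=; ring.
have D0 : 0 <= \sum_j `|x 0 j - y 0 j| by apply: sumr_ge0.
rewrite mul1r; case: s => [|l [|l' s]] /=; rewrite ?subrr ?normr0 //.
by rewrite (bigD1 i) //= lerDl sumr_ge0.
Qed.

Definition quad_fam (mu : 'I_n -> R) (s : seq 'I_n) (x : 'rV[R]_n) : R :=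
  match s with
  | [::] => \sum_i mu i * x 0 i ^+ 2 / 2
  | [:: j] => mu j * x 0 j
  | [:: j; l] => mu l *+ (j == l)
  | _ => 0 end.

Lemma quad_smooth mu : smooth_fam (quad_fam mu).
Proof.
have cx i : continuous (fun x : 'rV[R]_n => x 0 i) by exact: (proj1 (coord_smooth i) [::]).
split=> [s x|s j x].
  case: s => [|i [|j [|l s]]] /=.
  - have H (r : seq 'I_n) : {for x, continuous (fun y : 'rV[R]_n => \sum_(i <- r) mu i * y 0 i ^+ 2 / 2 : R)}.
      elim: r => [|i r IH].
        rewrite (_ : (fun _ => _) = cst (0 : R)); first exact: cst_continuous.
        by apply/funext => y; rewrite big_nil.
      rewrite (_ : (fun _ => _) = (fun y : 'rV[R]_n => mu i * (y 0 i * y 0 i) * 2^-1) \+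
        (fun y => \sum_(i <- r) mu i * y 0 i ^+ 2 / 2)); last first.
        by apply/funext => y; rewrite big_cons expr2.
      have c1 := continuousM (cx i x) (cx i x).
      have kc (c : R) : {for x, continuous (cst c : 'rV[R]_n -> R)} by exact: cst_continuous.
      have c3 := continuousM (continuousM (kc (mu i)) c1) (kc 2^-1).
      exact: continuousD c3 IH.
    exact: H.
  - have kc : {for x, continuous (cst (mu i) : 'rV[R]_n -> R)} by exact: cst_continuous.
    exact: continuousM kc (cx i x).
  - exact: cst_continuous.
  - exact: cst_continuous.
apply: (@is_derive_quad _ _ _ _ _ _ (`|mu j|)) => h h1.
have hh : 0 <= `|mu j| * h ^+ 2 by rewrite mulr_ge0 // sqr_ge0.
case: s => [|i [|l [|l' s]]] /=; rewrite ?mulr0 ?subrr ?normr0 ?subr0 ?subrr ?normr0 //.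
- rewrite -sumrB (bigD1 j) //= big1 ?addr0 => [|i ij].
    rewrite !mxE !eqxx mulr1.
    have -> : mu j * (h + x 0 j) ^+ 2 / 2 - mu j * x 0 j ^+ 2 / 2 - h * (mu j * x 0 j) =
      mu j * (h ^+ 2) * 2^-1 by field.
    rewrite normrM normrM (ger0_norm (sqr_ge0 h)) (@ger0_norm _ 2^-1) //.
    by lra.
  by rewrite !mxE (negPf ij) andbF mulr0 add0r subrr.
- rewrite !mxE eqxx /=.
  rewrite [X in `|X|](_ : _ = 0) ?normr0 //.
  by rewrite (eq_sym j); case: (eqVneq i j) => [->|_]; rewrite ?mulr1n ?mulr0n; ring.
Qed.
End CoordinateFamilies.

Section LocalDataNorms.
Variables (R : realType) (n : nat) (V : set 'rV[R]_n) (psi : 'rV[R]_n -> R) (C0 eps0 : R).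
Hypotheses (n0 : (0 < n)%N) (V0 : V 0) (psi_smooth : smooth_on V psi).
Hypotheses (C0_gt0 : 0 < C0) (eps0_gt0 : 0 < eps0).
Hypothesis thetaC : forall y : 'rV[R]_n, cube C0 (theta y).
Hypothesis cubeV : cube (eps0 * C0) `<=` V.

Lemma local_data_norm_small (tol : R) : 0 < tol -> exists2 d : R, 0 < d &
  forall eps : scale_dom eps0, val eps <= d -> forall M,
    nrm 0 0 (@sample _ _ _ (local_data psi (eps0 := eps0)) M eps) <= tol.
Proof.
move=> tol0.
have fper := local_data_periodic psi (eps0 := eps0).
have fsm := local_data_smooth psi_smooth C0_gt0 eps0_gt0 thetaC cubeV.
have [B B0 HB] := sample_small n0 fper fsm.
have B1 : 0 < B + 1 by rewrite ltr_wpDl.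
have t0 : 0 < tol ^+ 2 / (B + 1) by rewrite divr_gt0 // exprn_gt0.
have [d d0 Hd] := local_data_small V0 psi_smooth eps0 C0_gt0 thetaC t0.
exists d => // eps epsd M.
apply: le_trans (HB M eps _ (ltW t0) (Hd eps epsd)) _.
rewrite -[leRHS]ger0_norm ?(ltW tol0) // -sqrtr_sqr ler_wsqrtr //.
by rewrite mulrCA ler_piMr ?sqr_ge0 // ler_pdivrMr // mul1r lerDl.
Qed.

Lemma local_data_norm_bound q : exists2 B : R, 0 <= B &
  forall (eps : scale_dom eps0) M,
    nrm 1 q (@sample _ _ _ (local_data psi (eps0 := eps0)) M eps) <= B.
Proof.
have fper := local_data_periodic psi (eps0 := eps0).
have fsm := local_data_smooth psi_smooth C0_gt0 eps0_gt0 thetaC cubeV.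
have [B B0 HB] := sample_nrm n0 fper fsm q.
by exists B => // eps M; exact: HB.
Qed.
End LocalDataNorms.

(** Returns from the weight with small [eta], where the contraction runs, to weight 1; the constant
    is independent of M. *)
Lemma nrm_rescale (R : realType) n M (g : grid n M -> R) (eta : R) q : 0 < eta -> eta <= 1 ->
  nrm 1 q g <= eta^-1 ^+ q * nrm eta q g.
Proof.
move=> e0 e1; rewrite /nrm mulr_sumr; apply: ler_sum => m _.
rewrite mulrCA ler_wpM2l // /wt -exprMn mul1r.
have a0 : 0 <= \sum_i `|((cen m i)%:~R : R)| by apply: sumr_ge0.
have E1 : 1 <= eta^-1 by rewrite invf_ge1.
rewrite lerXn2r ?nnegrE ?mulr_ge0 ?addr_ge0 ?invr_ge0 ?(ltW e0) //.
  by rewrite mulr_ge0 // ltW.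
by rewrite mulrDr mulr1 mulKf ?gt_eqF // lerD2r.
Qed.

(** * Approximate solutions on the grids *)

Section ApproximateSolutions.
Variables (R : realType) (n k : nat) (V : set 'rV[R]_n) (psi : 'rV[R]_n -> R) (C0 eps0 : R).
Hypotheses (n0 : (0 < n)%N) (k0 : (0 < k)%N) (V0 : V 0) (psi_smooth : smooth_on V psi).
Hypotheses (C0_gt0 : 0 < C0) (eps0_gt0 : 0 < eps0) (eps0_le1 : eps0 <= 1).
Hypothesis thetaC : forall y : 'rV[R]_n, cube C0 (theta y).
Hypothesis cubeV : cube (eps0 * C0) `<=` V.
Variables (lam : 'I_n -> R) (s0 : R).
Local Notation S := (sigma_deriv k lam).
Hypothesis lam_psi0 : sigmaM k (\matrix_(i, j) (lam i *+ (i == j)) : 'M[R]_n) = psi 0.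
Hypotheses (s0_gt0 : 0 < s0) (S_ge : forall i, s0 <= S i).

Definition xi_data (eps : scale_dom eps0) M i : grid n M -> R :=
  sample (local_data (fun v : 'rV[R]_n => v 0 i) (eps0 := eps0)) eps.
Definition psi_data (eps : scale_dom eps0) M : grid n M -> R := sample (local_data psi (eps0 := eps0)) eps.
Definition disc_jet (eps : scale_dom eps0) M (f s : grid n M -> R) (x : grid n M) : jet n -> R :=
  (jetz lam S (val eps) (@xi_data eps M) (@psi_data eps M) f s)^~ x.

Lemma coord_smooth_on i : smooth_on setT (fun v : 'rV[R]_n => v 0 i).
Proof. by have := @smooth_fam_smooth R n (coord_fam i) setT (coord_smooth R i). Qed.

Lemma common_scale (sig : R) : 0 < sig -> exists eps : scale_dom eps0,
  forall M, nrm 0 0 (@psi_data eps M) <= sig /\ forall i, nrm 0 0 (@xi_data eps M i) <= sig.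
Proof.
move=> sig0.
have [d d0 Hd] := local_data_norm_small n0 V0 psi_smooth C0_gt0 eps0_gt0 thetaC cubeV sig0.
have H i : exists e, 0 < e /\ forall eps : scale_dom eps0, val eps <= e ->
    forall M, nrm 0 0 (@xi_data eps M i) <= sig.
  have [e e0 He] := @local_data_norm_small R n setT (fun v => v 0 i) C0 eps0 n0 I
    (coord_smooth_on i) C0_gt0 eps0_gt0 thetaC (fun _ _ => I) sig sig0.
  by exists e.
have [e He] := fin_all_exists H.
have [m m0 Hm] := pos_lower_bound (fun i => (He i).1).
pose ep := Num.min eps0 (Num.min d m).
have ep_dom : 0 < ep <= eps0 by rewrite !lt_min eps0_gt0 d0 m0 ge_min lexx.
exists (exist _ ep ep_dom) => M; split.
  by apply: Hd; rewrite /= !ge_min lexx !orbT.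
move=> i; apply: (He i).2; apply: le_trans (Hm i); by rewrite /= !ge_min lexx !orbT.
Qed.

(** Grid M carries the M-th iterate, and both residuals are combinations of differences of
    consecutive iterates, hence O(2^-M). The scale [eps] is fixed before the order [q], so one
    sequence has bounds of all orders. *)
Lemma approx_solutions : exists (eps : scale_dom eps0)
    (f s : forall M, grid n M -> R) (K : R),
  [/\ forall q, exists A, forall M, nrm 1 q (f M) <= A /\ nrm 1 q (s M) <= A,
      forall M x, `|s M x| <= 2^-1 &
      forall M x, let z := disc_jet eps (f M) (s M) x in
        `|curv_poly k lam z - rhs_poly k (psi 0) z| <= K / 2 ^+ M /\
        `|2 * z (jw n) + z (jw n) ^+ 2 - \sum_i z (jp i) ^+ 2| <= K / 2 ^+ M].
Proof.
have [Q [vQ EQ]] := curv_expand k0 lam_psi0.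
(* (1 + w)^2 = 1 + |p|^2 solved for its linear term: w = (|p|^2 - w^2) / 2. *)
pose Q2 (z : jet n -> R) := 2^-1 * (\sum_i z (jp i) * z (jp i) + (-1) * (z (jw n) * z (jw n))).
have vQ2 : vanish 2 Q2.
  apply: vanishZ; apply: vanishD.
    by apply: vanish_sum => i; apply: (@vanishM _ _ 1 1); exact: vanish_var.
  by apply: vanishZ; apply: (@vanishM _ _ 1 1); exact: vanish_var.
pose b := (3 * k)%:R * psi 0.
(* The expanded equation reads f = Psi + b w - Q. Replacing w by Q2, its value at a fixed point,
   removes the linear term b w and leaves a purely quadratic nonlinearity. *)
pose Q1 (z : jet n -> R) := (-1) * Q z + b * Q2 z.
have vQ1 : vanish 2 Q1 by apply: vanishD; apply: vanishZ.
have C11 := jet_cst_ge1 lam s0_gt0.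
(* With rho <= 1/4, [val_le_nrm] yields |s| <= 1/2 pointwise, which keeps 1 + w positive. *)
have q4 : (0 : R) < 4^-1 by [].
have [rho [rho0 rho4 Hrho]] := picard_bound vQ1 vQ2 C11 q4.
have rho1 : rho <= 1 by apply: (le_trans rho4); lra.
have sig0 : 0 < rho / 4 by lra.
have [eps Heps] := common_scale sig0.
have /andP[ep0 ep1] := valP eps.
have ep11 : val eps <= 1 by apply: le_trans eps0_le1.
pose p M := picard (jetz lam S (val eps) (@xi_data eps M) (@psi_data eps M)) Q1 Q2 (@psi_data eps M).
have key eta q : 0 <= eta ->
  (forall M, nrm eta q (@psi_data eps M) <= rho / 2 /\ forall i, nrm eta q (@xi_data eps M i) <= rho / 2) ->
  forall M j, [/\ nrm eta q (p M j).1 <= rho, nrm eta q (p M j).2 <= rho,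
    nrm eta q (fun x => (p M j.+1).1 x - (p M j).1 x) <= rho / 2 ^+ j &
    nrm eta q (fun x => (p M j.+1).2 x - (p M j).2 x) <= rho / 2 ^+ j].
  move=> eta0 HD M j; have [hp hx] := HD M.
  have r2 : rho / 2 <= rho by lra.
  apply: (Hrho _ _ _ _ (nrm_alg n M q eta0)) => //.
    move=> f s hf hs a; apply: jetz_bound => //; last exact: le_trans r2.
    by move=> i; exact: le_trans r2.
  move=> f s f' s' d hf hs a; apply: (@jetz_lip _ _ _ _ _ _ _ n0 s0_gt0 S_ge ep0 ep11 _ _ rho) => //.
  by move=> i; exact: le_trans r2.
have key0 : forall M j, [/\ nrm 0 0 (p M j).1 <= rho, nrm 0 0 (p M j).2 <= rho,
    nrm 0 0 (fun x => (p M j.+1).1 x - (p M j).1 x) <= rho / 2 ^+ j &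
    nrm 0 0 (fun x => (p M j.+1).2 x - (p M j).2 x) <= rho / 2 ^+ j].
  apply: key => // M; have [h1 h2] := Heps M.
  by split=> [|i]; [apply: (le_trans h1)|apply: (le_trans (h2 i))]; lra.
exists eps, (fun M => (p M M).1), (fun M => (p M M).2), (2 * rho * (1 + `|b|) + 4 * rho); split.
- move=> q.
  have [Bp Bp0 HBp] := local_data_norm_bound n0 psi_smooth C0_gt0 eps0_gt0 thetaC cubeV q.
  have H i : exists B, 0 <= B /\ forall (eps : scale_dom eps0) M, nrm 1 q (@xi_data eps M i) <= B.
    have [B B0 HB] := @local_data_norm_bound R n setT (fun v => v 0 i) C0 eps0 n0
      (coord_smooth_on i) C0_gt0 eps0_gt0 thetaC (fun _ _ => I) q.
    by exists B.
  have [B HB] := fin_all_exists H.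
  pose BB := Bp + \sum_i B i.
  have SB : 0 <= \sum_i B i by apply: sumr_ge0 => i _; exact: (HB i).1.
  have BB0 : 0 <= BB by rewrite addr_ge0.
  have BBi i : B i <= BB.
    apply: (@le_trans _ _ (\sum_i B i)); last by rewrite lerDr.
    by rewrite (bigD1 i) //= lerDl sumr_ge0 // => j _; exact: (HB j).1.
  have BBp : Bp <= BB by rewrite lerDl.
  (* By [nrm_interp] the weighted data are at most rho / 4 + eta BB <= rho / 2, as the contraction
     requires. *)
  pose eta := Num.min 1 (rho / 4 / (BB + 1)).
  have B10 : 0 < BB + 1 by lra.
  have eta0 : 0 < eta by rewrite lt_min ltr01 divr_gt0.
  have eta1 : eta <= 1 by rewrite ge_min lexx.
  have etaB : eta * BB <= rho / 4.
    have : eta * (BB + 1) <= rho / 4 by rewrite -ler_pdivlMr // ge_min lexx orbT.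
    by have := ltW eta0; lra.
  have HD M : nrm eta q (@psi_data eps M) <= rho / 2 /\ forall i, nrm eta q (@xi_data eps M i) <= rho / 2.
    have [h1 h2] := Heps M; split=> [|i].
      have := nrm_interp (@psi_data eps M) q (ltW eta0) eta1.
      have := ler_wpM2l (ltW eta0) (le_trans (HBp eps M) BBp); rewrite -/(@psi_data eps M); lra.
    have := nrm_interp (@xi_data eps M i) q (ltW eta0) eta1.
    have := ler_wpM2l (ltW eta0) (le_trans ((HB i).2 eps M) (BBi i)); have := h2 i; lra.
  exists (eta^-1 ^+ q * rho) => M; have [h1 h2 _ _] := key eta q (ltW eta0) HD M M.
  have e0 : 0 <= eta^-1 ^+ q by rewrite exprn_ge0 // invr_ge0 ltW.
  by split; (apply: le_trans (nrm_rescale _ q eta0 eta1) _; rewrite ler_wpM2l).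
- move=> M x; have [_ h _ _] := key0 M M.
  by apply: le_trans (val_le_nrm 0 (lexx 0) _ x) _; lra.
move=> M x z; have [_ _ h3 h4] := key0 M M.
have v3 := val_le_nrm 0 (lexx 0) (fun x => (p M M.+1).1 x - (p M M).1 x) x.
have v4 := val_le_nrm 0 (lexx 0) (fun x => (p M M.+1).2 x - (p M M).2 x) x.
have E1 : (p M M.+1).1 x = @psi_data eps M x + Q1 z by [].
have E2 : (p M M.+1).2 x = Q2 z by [].
have zw : z (jw n) = (p M M).2 x by [].
have zp : z (jpsi n) = @psi_data eps M x by [].
have zB : \sum_i S i * z (jB i i) = (p M M).1 x.
  exact: (Kop_trace n0 s0_gt0 S_ge).
have q0 : 0 <= rho / 2 ^+ M by rewrite divr_ge0 ?(ltW rho0) // exprn_ge0.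
have w3 : `|(p M M.+1).1 x - (p M M).1 x| <= 2 * (rho / 2 ^+ M) by apply: (le_trans v3); lra.
have w4 : `|(p M M.+1).2 x - (p M M).2 x| <= 2 * (rho / 2 ^+ M) by apply: (le_trans v4); lra.
have b0 := normr_ge0 b.
have qb : 0 <= (rho / 2 ^+ M) * `|b| by rewrite mulr_ge0.
have -> : (2 * rho * (1 + `|b|) + 4 * rho) / 2 ^+ M =
  2 * (rho / 2 ^+ M) + 2 * (rho / 2 ^+ M) * `|b| + 4 * (rho / 2 ^+ M) by ring.
split.
  rewrite EQ zB.
  have -> : (p M M).1 x - (3 * k)%:R * psi 0 * z (jw n) - z (jpsi n) + Q z =
    - ((p M M.+1).1 x - (p M M).1 x) + b * ((p M M.+1).2 x - (p M M).2 x).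
    by rewrite E1 E2 zw zp /Q1 -/b; ring.
  apply: le_trans (ler_normD _ _) _; rewrite normrN normrM.
  have := ler_wpM2l b0 w4; move: w3; move: (`|_ - _|) (`|b| * `|_|) => u v; lra.
have -> : 2 * z (jw n) + z (jw n) ^+ 2 - \sum_i z (jp i) ^+ 2 =
   - 2 * ((p M M.+1).2 x - (p M M).2 x).
  rewrite E2 -zw /Q2; under eq_bigr do rewrite expr2.
  by field.
rewrite normrM normrN (ger0_norm (_ : 0 <= 2)) //.
by move: w4; move: (`|_ - _|) => u; lra.
Qed.

End ApproximateSolutions.

(** * Passage to the limit *)

Section TrigLimit.
Variables (R : realType) (n : nat) (U : set_system nat).
Hypotheses (UU : UltraFilter U).

Lemma trig_limit (om : R) (a : forall M, grid n M -> R) :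
  (forall q, exists A : R, forall M, \sum_m `|a M m| * wt 1 q (cen m) <= A) ->
  exists (D : seq 'I_n -> 'rV[R]_n -> R) (C : seq 'I_n -> R),
  [/\ smooth_fam D, forall s x, trigp om (a M) s x @[M --> U] --> D s x &
      forall M s x y, `|trigp om (a M) s x - trigp om (a M) s y| <=
        C s * \sum_j `|x 0 j - y 0 j|].
Proof.
move=> H; have [A HA] := boolp.choice H.
have HM M q : \sum_m `|a M m| * wt 1 q (cen m) <= A q by exact: HA.
have A0 q : 0 <= A q.
  by apply: le_trans (HM 0%N q); apply: sumr_ge0 => m _; rewrite mulr_ge0 ?wt_ge0.
pose c1 (s : seq 'I_n) := `|om| ^+ size s * 2 * A (size s).
pose c2 (s : seq 'I_n) := `|om| ^+ size s * 2 * A (size s + 1)%N * `|om|.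
pose c3 (s : seq 'I_n) := `|om| ^+ size s * 2 * A (size s + 2)%N * `|om| ^+ 2.
have p0 (s : seq 'I_n) : 0 <= `|om| ^+ size s * 2 by rewrite mulr_ge0 // exprn_ge0.
have c10 s : 0 <= c1 s by rewrite /c1 mulr_ge0.
have c20 s : 0 <= c2 s by rewrite /c2 !mulr_ge0.
have c30 s : 0 <= c3 s by apply: mulr_ge0; [rewrite mulr_ge0|rewrite exprn_ge0].
pose C s := c1 s + c2 s + c3 s.
have L M s x y : `|trigp om (a M) s x - trigp om (a M) s y| <= C s * \sum_j `|x 0 j - y 0 j|.
  apply: le_trans (trigp_lip om (HM M) s x y) _; rewrite -/(c2 s) ler_wpM2r ?sumr_ge0 //.
  by have := c10 s; have := c30 s; rewrite /C; lra.
have B M s x : `|trigp om (a M) s x| <= C s.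
  apply: le_trans (trigp_bound om (HM M) s x) _; rewrite -/(c1 s).
  by have := c20 s; have := c30 s; rewrite /C; lra.
have TT M s i x h : `|trigp om (a M) s (x + h *: delta_mx 0 i) - trigp om (a M) s x
    - h * trigp om (a M) (i :: s) x| <= C s * h ^+ 2.
  apply: le_trans (trigp_taylor om (HM M) s i x h) _; rewrite -/(c3 s) ler_wpM2r ?sqr_ge0 //.
  by have := c20 s; have := c10 s; rewrite /C; lra.
have [D [sD cD]] := ulim_smooth_fam UU B TT L.
by exists D, C.
Qed.

End TrigLimit.

Section UltraSqueeze.
Variables (R : realType) (U : set_system nat).
Hypotheses (UU : UltraFilter U) (oU : \oo `<=` U).

Lemma ultra_squeeze0 (r : nat -> R) (B : R) : (forall M, `|r M| <= B * (M.+1)%:R^-1) ->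
  r @ U --> (0 : R).
Proof.
move=> H.
have h : r @ \oo --> (0 : R).
  have cB : B * harmonic M @[M --> \oo] --> (0 : R).
    by rewrite -(mulr0 B); apply: cvgMr; exact: cvg_harmonic.
  have cN : - (B * harmonic M) @[M --> \oo] --> (0 : R) by rewrite -oppr0; exact: cvgN.
  apply: (squeeze_cvgr _ cN cB); apply: nearW => M.
  by have := H M; rewrite ler_norml.
by move=> A /h; exact: oU.
Qed.

Lemma ultra_squeeze (r t : nat -> R) (B l : R) :
  (forall M, `|r M - t M| <= B * (M.+1)%:R^-1) -> t @ U --> l -> r @ U --> l.
Proof.
move=> H tl; have PU := @ultra_proper _ _ UU.
have -> : r = (fun M => (r M - t M) + t M) by apply/funext => M; rewrite subrK.
by rewrite -[l]add0r; apply: cvgD => //; exact: ultra_squeeze0 H.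
Qed.
End UltraSqueeze.

Lemma continuous_pcoord (R : realType) : continuous (@pcoord R).
Proof.
move=> t; have [_ [d [dp _]]] := unif_smooth_pcoord R 1 unit.
apply: differentiable_continuous; apply/derivable1_diffP.
by have [] := dp tt t.
Qed.

Section LocalSolution.
Variables (R : realType) (n k : nat).

Lemma sqrt_area (u : 'rV[R]_n -> R) x (w : R) : 0 < 1 + w ->
  (1 + w) ^+ 2 = area_sq u x -> Num.sqrt (area_sq u x) = 1 + w.
Proof. by move=> w0 <-; rewrite sqrtr_sqr ger0_norm // ltW. Qed.

(** [w] is an independent unknown: its quadratic equation and the sign of 1 + w identify 1 + w with
    the square root. Existence of a real [kappa] comes from symmetry of H and positivity of the
    metric. *)
Lemma curvature_solution (u : 'rV[R]_n -> R) x (w psix : R) (H : 'M[R]_n) :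
  (k <= n)%N -> 0 < 1 + w -> (1 + w) ^+ 2 = area_sq u x ->
  H = \matrix_(i, j) partial i (partial j u) x -> H^T = H ->
  sigmaM k (grad_coform (fun i => partial i u x) *m H) = (1 + w) ^+ (3 * k) * psix ->
  exists kappa : 'rV[R]_n, principal_curvatures u x kappa /\ sigma k kappa = psix.
Proof.
move=> kn w0 wE HE HT HS; set p := fun i => partial i u x in HS.
have W := sqrt_area w0 wE.
have gE : first_form u x = grad_form p by apply/matrixP => i j; rewrite !mxE.
have hE : second_form u x = (1 + w)^-1 *: H.
  by apply/matrixP => i j; rewrite HE !mxE W mulrC.
have wn : 1 + w != 0 by rewrite gt_eqF.
have AE : invmx (first_form u x) *m second_form u x = (1 + w)^-1 ^+ 3 *: (grad_coform p *m H).
  rewrite gE grad_form_inv hE -scalemxAl -scalemxAr scalerA -/(area_sq u x) -wE.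
  by congr (_ *: _); field.
have [kappa Hk] : exists kappa : 'rV[R]_n,
    char_poly (invmx (first_form u x) *m second_form u x) = \prod_(i < n) ('X - (kappa 0 i)%:P).
  apply: char_poly_split => a; rewrite gE; apply: pencil_eigen_real.
  - exact: grad_form_sym.
  - by rewrite hE linearZ /= HT.
  - exact: grad_form_pos.
  - exact: grad_form_unit.
exists kappa; split => //.
rewrite -(@sigmaM_sigma R n k _ kappa kn Hk) AE sigmaM_scale //; last first.
  by rewrite expf_neq0 // invr_neq0.
by rewrite HS -exprM exprVn mulKf // expf_neq0.
Qed.
End LocalSolution.

Unset Implicit Arguments.
Set Strict Implicit.
Set Printing Implicit Defensive.

Theorem theorem1p1 (R : realType) (n k : nat) (hk2 : (2 <= k)%N)
    (hkn : (k <= n - 1)%N) (V : set 'rV[R]_n) (psi : 'rV[R]_n -> R)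
    (V_open : open V) (V0 : V 0) (psi_smooth : smooth_on V psi) :
  exists (U : set 'rV[R]_n) (u : 'rV[R]_n -> R),
    [/\ open U, U 0, U `<=` V, smooth_on U u
      & forall x : 'rV[R]_n, U x ->
          exists kappa : 'rV[R]_n,
            principal_curvatures u x kappa /\ sigma k kappa = psi x].
Proof.
have n0 : (0 < n)%N by lia.
have k0 : (0 < k)%N by lia.
have kn : (k <= n)%N by lia.
have [lam [lamE Spos]] := lambda_choice (psi 0) hk2 hkn.
have [s0 s0_gt0 S_ge] := pos_lower_bound Spos.
have [C0 C0_gt0 thetaC] := theta_bound R n.
have [dV dV0 dVV] : exists2 d : R, 0 < d & cube d `<=` V.
  by apply: nbhs_cube; exact: open_nbhs_nbhs.
(* [theta] takes values in the cube of size C0, so for eps <= eps0 the points eps theta(y) stay in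
   V. *)
pose eps0 := Num.min 1 (dV / C0).
have eps0_gt0 : 0 < eps0 by rewrite lt_min ltr01 divr_gt0.
have eps0_le1 : eps0 <= 1 by rewrite ge_min lexx.
have cubeV : cube (eps0 * C0) `<=` V.
  move=> x xc; apply: dVV => i; apply: le_trans (xc i) _.
  by rewrite -ler_pdivlMr // ge_min lexx orbT.
have [eps [f [s [K [Hfs Hs Hz]]]]] := approx_solutions n0 k0 V0 psi_smooth C0_gt0
  eps0_gt0 eps0_le1 thetaC cubeV lamE s0_gt0 S_ge.
have /andP[ep0 ep1] := valP eps.
pose e := val eps; have ep11 : e <= 1 by apply: le_trans eps0_le1.
pose S := sigma_deriv k lam; pose T := trS S.
have [U [UU oU]] := ultra_oo.
have PU := @ultra_proper _ _ UU.
have [W [CW [sW cW LW]]] : exists D C, [/\ smooth_fam D,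
    forall q x, trigp e^-1 (potential S e (f M)) q x @[M --> U] --> D q x &
    forall M q x y, `|trigp e^-1 (potential S e (f M)) q x - trigp e^-1 (potential S e (f M)) q y| <=
        C q * \sum_j `|x 0 j - y 0 j|].
  apply: (@trig_limit R n U UU e^-1 (fun M => potential S e (f M))) => q.
  have [A HA] := Hfs q; exists (s0^-1 * A) => M; have [h _] := HA M.
  have s1 : 0 <= s0^-1 by rewrite invr_ge0 ltW.
  apply: le_trans (ler_wpM2l s1 h); rewrite /nrm mulr_sumr; apply: ler_sum => m _.
  by rewrite mulrA ler_wpM2r ?wt_ge0 // (potential_le n0 s0_gt0).
have [E [CE [sE cE LE]]] : exists D C, [/\ smooth_fam D,
    forall q x, trigp e^-1 (coef (s M)) q x @[M --> U] --> D q x &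
    forall M q x y, `|trigp e^-1 (coef (s M)) q x - trigp e^-1 (coef (s M)) q y| <=
        C q * \sum_j `|x 0 j - y 0 j|].
  apply: (@trig_limit R n U UU e^-1 (fun M => coef (s M))) => q.
  by have [A HA] := Hfs q; exists A => M; have [_ h] := HA M.
have [c cM] : exists c : R, coef (f M) (zmode n M) @[M --> U] --> c.
  have [A HA] := Hfs 0%N; apply: (@ultra_cvg _ U UU _ A) => M; have [h _] := HA M.
  by apply: le_trans h; apply: coef_le_nrm.
(* The limit of the zero modes joins the quadratic part of u. *)
pose mu i := lam i + c / T.
pose Du q x := quad_fam mu q x + W q x.
have sDu : smooth_fam Du by apply: smooth_famD => //; exact: quad_smooth.
pose u := Du [::].
(* On this ball x / e lies in [-1/2, 1/2]^n, where [theta] is the identity: the periodised data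
   coincide there with the original ones. *)
exists (ball (0 : 'rV[R]_n) (e / 2)), u.
have e2 : 0 < e / 2 by rewrite divr_gt0.
have inb x : ball (0 : 'rV[R]_n) (e / 2) x -> forall i, `|x 0 i| < e / 2.
  by move=> [_ h] i; have := h 0 i; rewrite /ball /= mxE sub0r normrN.
have smallC x : ball (0 : 'rV[R]_n) (e / 2) x -> x = e *: theta (e^-1 *: x).
  move=> /inb h; apply/rowP => i; rewrite !mxE pcoord_id ?mulVKf ?gt_eqF //.
  rewrite normrM gtr0_norm ?invr_gt0 // mulrC ler_pdivrMr // mulrC.
  exact: ltW.
split.
- exact: ball_open.
- exact: ballxx.
- move=> x xb; rewrite (smallC x xb); apply: cubeV; exact: scaled_in.
- exact: smooth_fam_smooth.
move=> x xb.
have yb i : `|(e^-1 *: x) 0 i| <= 2^-1.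
  rewrite mxE normrM gtr0_norm ?invr_gt0 // mulrC ler_pdivrMr // mulrC.
  exact: ltW (inb x xb i).
(* The discrete equations hold at grid points only; x / e is approached by nearby grid points, and
   Lipschitz bounds uniform in M carry the limits over. *)
have G M := cid (gpt_near M yb).
pose g M := sval (G M).
have Hg M i : `|(e^-1 *: x) 0 i - gpt R (g M) 0 i| <= 2 * pi / (M.*2.+1)%:R by exact: (svalP (G M)).
have p0 := pi_gt0 R.
have Hg2 M i : `|(e^-1 *: x) 0 i - gpt R (g M) 0 i| <= 2 * pi * (M.+1)%:R^-1.
  apply: le_trans (Hg M i) _; rewrite ler_wpM2l ?mulr_ge0 ?(ltW p0) //.
  by rewrite lef_pV2 ?posrE ?ltr0n // ler_nat; lia.
pose P M := e *: gpt R (g M).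
have PD M i : `|P M 0 i - x 0 i| <= 2 * pi * (M.+1)%:R^-1.
  have -> : P M 0 i - x 0 i = - (e * ((e^-1 *: x) 0 i - gpt R (g M) 0 i)).
    by rewrite !mxE mulrBr mulVKf ?gt_eqF // opprB.
  rewrite normrN normrM (gtr0_norm ep0); apply: le_trans (Hg2 M i).
  by rewrite ler_piMl.
have trig_at (a : forall M, grid n M -> R) q (l B : R) :
    (forall M y z, `|trigp e^-1 (a M) q y - trigp e^-1 (a M) q z| <= B * \sum_j `|y 0 j - z 0 j|) ->
    trigp e^-1 (a M) q x @[M --> U] --> l -> trigp e^-1 (a M) q (P M) @[M --> U] --> l.
  move=> LB cx.
  suff hh M : `|trigp e^-1 (a M) q (P M) - trigp e^-1 (a M) q x| <=
    `|B| * (n%:R * (2 * pi)) * (M.+1)%:R^-1 by exact: (ultra_squeeze UU oU hh cx).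
  apply: le_trans (LB M _ _) _.
  apply: (@le_trans _ _ (`|B| * \sum_j `|P M 0 j - x 0 j|)).
    by rewrite ler_wpM2r ?ler_norm // sumr_ge0.
  rewrite -!mulrA ler_wpM2l //.
  apply: (@le_trans _ _ (\sum_(j < n) 2 * pi * (M.+1)%:R^-1)); first exact: ler_sum.
  by rewrite sumr_const card_ord -[_ *+ n]mulr_natl !mulrA.
pose z M := disc_jet k psi lam eps (f M) (s M) (g M).
(* The expected limit of the discrete jets: the gradient of u, the Hessian minus diag lam, the
   excess of the square root and that of [psi], all at x. *)
pose zl (a : jet n) : R := match a with
  | inl (inl i) => mu i * x 0 i + W [:: i] x
  | inl (inr (i, j)) => W [:: i; j] x + (c / T) *+ (i == j)
  | inr true => E [::] x
  | inr false => psi x - psi 0 end.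
pose X M := e *: theta (gpt R (g M)).
have gy i : gpt R (g M) 0 i @[M --> U] --> (e^-1 *: x) 0 i.
  apply: (ultra_squeeze UU oU (B := 2 * pi) (t := fun=> (e^-1 *: x) 0 i)); last exact: cvg_cst.
  by move=> M; rewrite distrC.
have Xi i : X M 0 i @[M --> U] --> x 0 i.
  have -> : x 0 i = e * pcoord ((e^-1 *: x) 0 i) by rewrite {1}(smallC x xb) !mxE.
  have -> : (fun M => X M 0 i) = (fun M => e * pcoord (gpt R (g M) 0 i)).
    by apply/funext => M; rewrite !mxE.
  by apply: cvgMr; apply: (cvg_comp _ _ (gy i)); exact: continuous_pcoord.
have Xx : X M @[M --> U] --> x.
  apply/cvg_ballP => d d0.
  have H i : \forall M \near U, `|x 0 i - X M 0 i| < d.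
    by have /cvgrPdist_lt/(_ d d0) := Xi i.
  have H2 : \forall M \near U, forall i, `|x 0 i - X M 0 i| < d by apply: filter_forall.
  apply: filterS H2 => M HM; split=> // i j; rewrite ord1; exact: HM.
have xV : V x by rewrite (smallC x xb); apply: cubeV; exact: scaled_in.
have zcvg a : z M a @[M --> U] --> zl a.
  case: a => [[i|[i j]]|[]].
  - have -> : (fun M => z M (inl (inl i))) = (fun M =>
      (lam i + coef (f M) (zmode n M) / T) * X M 0 i +
      trigp e^-1 (potential S e (f M)) [:: i] (P M)).
      apply/funext => M; rewrite trigp_Jop // /z /disc_jet /= /xi_data /sample /local_data.
      by rewrite [X in _ - X]mxE subr0.
    apply: cvgD; last exact: trig_at (LW ^~ [:: i]) (cW _ _).
    apply: cvgM => //; apply: cvgD; first exact: cvg_cst.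
    by apply: cvgMl.
  - have -> : (fun M => z M (inl (inr (i, j)))) = (fun M =>
      trigp e^-1 (potential S e (f M)) [:: i; j] (P M) + (coef (f M) (zmode n M) / T) *+ (i == j)).
      by apply/funext => M; rewrite trigp_Kop.
    apply: cvgD; first exact: trig_at (LW ^~ [:: i; j]) (cW _ _).
    case: (i == j); rewrite ?mulr1n ?mulr0n; first by apply: cvgMl.
    exact: cvg_cst.
  - have -> : (fun M => z M (inr true)) = (fun M => trigp e^-1 (coef (s M)) [::] (P M)).
      apply/funext => M; rewrite /z /disc_jet /= {1}(coef_inv (s M) (g M)).
      apply: eq_bigr => m _; rewrite big_nil mulr1 /= mul0r addr0 /ch; congr (_ * cas _).
      by rewrite argm_gpt.
    exact: trig_at (LE ^~ [::]) (cE _ _).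
  have -> : (fun M => z M (inr false)) = (fun M => psi (X M) - psi 0) by [].
  apply: cvgB; last exact: cvg_cst.
  by apply: (cvg_comp _ _ Xx); have [cpsi _] := psi_smooth [::] x xV.
have KM M : K / 2 ^+ M <= `|K| * (M.+1)%:R^-1.
  apply: (@le_trans _ _ (`|K| / 2 ^+ M)).
    by rewrite ler_wpM2r ?ler_norm // invr_ge0 exprn_ge0.
  rewrite ler_wpM2l // lef_pV2 ?posrE ?exprn_gt0 ?ltr0n //.
  by rewrite -natrX ler_nat ltn_expl.
have eq1 : curv_poly k lam zl - rhs_poly k (psi 0) zl = 0.
  have c1 := polyf_cvg UU (polyf_sub (polyf_curv k lam) (polyf_rhs n k (psi 0))) zcvg.
  have c2 : (curv_poly k lam (z M) - rhs_poly k (psi 0) (z M)) @[M --> U] --> (0 : R).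
    apply: (ultra_squeeze0 oU (B := `|K|)) => N; have [h _] := Hz N (g N).
    exact: le_trans h (KM N).
  exact: cvg_unique c1 c2.
have eq2 : 2 * zl (jw n) + zl (jw n) ^+ 2 - \sum_i zl (jp i) ^+ 2 = 0.
  have pf : polyf (fun z : jet n -> R => 2 * z (jw n) + z (jw n) ^+ 2 - \sum_i z (jp i) ^+ 2).
    apply: polyf_sub; last by apply: polyf_sum => i; apply: polyf_exp; exact: PolyVar.
    apply: PolyAdd; last by apply: polyf_exp; exact: PolyVar.
    by apply: PolyMul; [exact: PolyCst|exact: PolyVar].
  have c1 := polyf_cvg UU pf zcvg.
  have c2 : (2 * z M (jw n) + z M (jw n) ^+ 2 - \sum_i z M (jp i) ^+ 2) @[M --> U] --> (0 : R).
    apply: (ultra_squeeze0 oU (B := `|K|)) => N; have [_ h] := Hz N (g N).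
    exact: le_trans h (KM N).
  exact: cvg_unique c1 c2.
have wb : `|zl (jw n)| <= 2^-1.
  by apply: (ultra_le UU (zcvg (jw n))) => M; exact: Hs.
(* Symmetry of the Hessian is read off the trigonometric polynomials, whose frequency factors
   commute, and passes to the limit. *)
have Wsym i j : W [:: i; j] x = W [:: j; i] x.
  have c1 := cW [:: i; j] x; have c2 := cW [:: j; i] x.
  have Et : (fun M => trigp e^-1 (potential S e (f M)) [:: i; j] x) =
    (fun M => trigp e^-1 (potential S e (f M)) [:: j; i] x).
    apply/funext => M; apply: eq_bigr => m _; rewrite !big_cons !big_nil /=.
    by congr (_ * _ * _); ring.
  by rewrite Et in c1; exact: cvg_unique c1 c2.
have du i : partial i u x = zl (jp i).
  by rewrite -[partial i u]/(iter_partial [:: i] u) smooth_fam_iter.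
have ddu i j : partial i (partial j u) x = jhess lam zl i j.
  rewrite -[partial i _]/(iter_partial [:: i; j] u) smooth_fam_iter // mxE.
  by rewrite /Du /= /mu; case: (eqVneq i j) => [->|_]; rewrite ?mulr1n ?mulr0n; ring.
apply: (@curvature_solution R n k u x (zl (jw n)) (psi x) (jhess lam zl)) => //.
- by move: wb; rewrite ler_norml => /andP[w1 w2]; lra.
- rewrite /area_sq (eq_bigr (fun i => zl (jp i) ^+ 2)); last by move=> i _; rewrite du.
  by move: eq2; move: (\sum_i _) (zl (jw n)) => q w h; lra.
- by apply/matrixP => i j; rewrite [RHS]mxE ddu.
- apply/matrixP => i j; rewrite !mxE /= Wsym (eq_sym j).
  by case: (eqVneq i j) => [->|].
have -> : (fun i => partial i u x) = (fun i => zl (jp i)) by apply/funext => i; exact: du.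
have E3 : curv_poly k lam zl = rhs_poly k (psi 0) zl by apply/eqP; rewrite -subr_eq0 eq1.
rewrite -[LHS]/(curv_poly k lam zl) E3 /rhs_poly; congr (_ * _).
by rewrite /= addrC subrK.
Qed.
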